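(* Let $F$ be a minimal Q-net in $\mathbb{S}^3$ with discrete conformal metric $s$. Then there exists a Q-net $\hat F$ in $\mathbb{R}^3$ of constant mean curvature $H=1$ with the same discrete conformal metric $s$. More generally, this correspondence (preserving the discrete conformal metric) takes any Q-net of constant mean curvature $H$ lying in the sphere of curvature $\kappa$ to a Q-net of constant mean curvature $H'$ in the sphere of curvature $\kappa'$, provided $H^2+\kappa=H'^2+\kappa'$. The Euclidean case corresponds to $\kappa'=0$. Additionally, the two Q-nets $F$ and $\hat F$ (with Gauss maps $N$, $\hat N$) are given by the following immersion formulas with the same Lax matrices $\mathcal U(\lambda)$, $\mathcal V(\lambda)$, where $\Phi$ denotes a frame of these Lax matrices: $$F=\Phi(\lambda_1)^{-1}\mathbf M\,\Phi(\lambda_2),\qquad N=-\Phi(\lambda_1)^{-1}\mathbf k\,\mathbf M\,\Phi(\lambda_2),\qquad \lambda_1=e^{i\pi/4},\ \lambda_2=e^{-i\pi/4},\ \mathbf M=\exp\!\big(\tfrac{\pi}{4}\mathbf k\big),$$ for the minimal net in $\mathbb{S}^3$, and $$\hat N=-\Phi^{-1}\mathbf k\,\Phi,\qquad \hat F=-\Phi^{-1}\frac{\partial\Phi}{\partial\gamma}-\frac12\hat N\qquad\text{evaluated at }\lambda=e^{i\gamma},\ \gamma=0,$$ for the net of constant mean curvature $1$ in $\mathbb{R}^3$.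
   Context: Notation. For a function $f$ on $\mathbb{Z}^2$, $f,f_1,f_2,f_{12}$ denote its values at $(m,n),(m+1,n),(m,n+1),(m+1,n+1)$; faces are the quadruples $(f,f_1,f_{12},f_2)$. Quaternions are represented by complex $2\times2$ matrices with $$\mathbf i=\begin{pmatrix}0&-i\\-i&0\end{pmatrix},\ \mathbf j=\begin{pmatrix}0&-1\\1&0\end{pmatrix},\ \mathbf k=\begin{pmatrix}-i&0\\0&i\end{pmatrix},\ \mathbf 1=\begin{pmatrix}1&0\\0&1\end{pmatrix};$$ $(X_1,X_2,X_3,X_4)\in\mathbb{R}^4$ corresponds to $X_1\mathbf i+X_2\mathbf j+X_3\mathbf k+X_4\mathbf 1$, $\mathbb{R}^3$ to imaginary quaternions ($X_4=0$), $\mathbb{S}^3$ to unit quaternions, i.e. $SU(2)$. Q-nets. A Q-net (with Gauss map) is a pair $(F,N)$ of maps on $\mathbb{Z}^2$ with planar faces that are edge-parallel (corresponding edges of $F$ and $N$ are parallel), where either $F$ lies in $\mathbb{R}^3$ and $N$ in $\mathbb{S}^2$, or $F$ and $N$ lie in $\mathbb{S}^3$ and $F\perp N$ at each vertex. In the sphere of curvature $\kappa>0$ (radius $1/\sqrt\kappa$, centered at $0$ in $\mathbb{R}^4$) the definition is the same as in $\mathbb{S}^3$, with $F$ in that sphere and $N$ still of unit length. Faces are then circular. With $\mathcal A$ the area of planar quads (a quadratic form) and $\mathcal A(f,f')=\frac14(\mathcal A(f+f')-\mathcal A(f-f'))$ the mixed area of edge-parallel quads, the mean curvature of a face is $H_f=-\mathcal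 A(F(f),N(f))/\mathcal A(F(f))$. The net has constant mean curvature $H$ if $H_f=H$ on all faces, and is minimal if $H_f=0$ on all faces. Discrete conformal metric. A Christoffel dual of $F$ is a net $F^*$ edge-parallel to $F$ with $\mathcal A(F,F^* )=0$ on every face; for constant mean curvature $H\neq0$ one takes $F^*=F+\frac1HN$, for minimal nets $F^*=N$. A discrete conformal metric (coefficient) of $F$ is a nowhere vanishing real function $s$ on $\mathbb{Z}^2$ with $F^*_i-F^*=\frac1{s\,s_i}(F_i-F)$, $i=1,2$; it is defined up to black-white rescaling (multiplication by one constant on the vertices with $m+n$ even and by another on those with $m+n$ odd). Lax matrices. To every edge $((m,n),(m+1,n))$, resp. $((m,n),(m,n+1))$, is attached a matrix $$\mathcal U(\lambda)=\frac1{\alpha(\lambda)}\begin{pmatrix}a&-\lambda u-\lambda^{-1}u^{-1}\\ \lambda u^{-1}+\lambda^{-1}u&\bar a\end{pmatrix},\ \text{ resp. }\ \mathcal V(\lambda)=\frac1{\beta(\lambda)}\begin{pmatrix}b&-i\lambda v+i\lambda^{-1}v^{-1}\\ i\lambda v^{-1}-i\lambda^{-1}v&\bar b\end{pmatrix},\quad |\lambda|=1,$$ with $a,b$ complex and $u,v>0$ independent of $\lambda$, and $\alpha(\lambda),\beta(\lambda)$ real such that the determinants equal $1$; $\alpha$ and $\beta$ coincide on opposite edges of each face, and on each face $\mathcal V'(\lambda)\,\mathcal U(\lambda)=\mathcal U'(\lambda)\,\mathcal V(\lambda)$, where $\mathcal U,\mathcal V$ belong to the edges from the vertex $0$ to $1$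 and from $0$ to $2$, and $\mathcal U',\mathcal V'$ to the opposite edges (from $2$ to $12$ and from $1$ to $12$). A frame is a map $\Phi$ from $\mathbb{Z}^2$ into the loops $\lambda\mapsto\Phi(\lambda)\in SU(2)$, $|\lambda|=1$, with $\Phi(-\lambda)=\sigma_3\Phi(\lambda)\sigma_3$, $\sigma_3=\mathrm{diag}(1,-1)$, such that $\Phi_1=\mathcal U\Phi$ and $\Phi_2=\mathcal V\Phi$.
   Formalization: The immersion formulas for a given F assume s·s_1<0<s·s_2, F_1≠N and F_2≠−N, which these Lax matrices force; in R^3 the mean curvature is claimed only on faces not contained in a line, since on other faces H_f is 0/0. *)

(* Defs.v *)
From HB Require Import structures.
From mathcomp Require Import all_boot all_order all_algebra.
From mathcomp Require Import boolp classical_sets reals topology normedtype.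
From mathcomp Require Import derive realfun trigo.
From mathcomp Require Export complex.

Set Implicit Arguments.
Unset Strict Implicit.
Unset Printing Implicit Defensive.

Import Order.TTheory GRing.Theory Num.Theory.
Import numFieldNormedType.Exports.

Local Open Scope ring_scope.
Local Open Scope complex_scope.

Section Nets.
Variable R : realType.

Definition point := 'rV[R]_4.

Definition net := int -> int -> point.

Definition dot (x y : point) : R := \sum_(i < 4) x 0 i * y 0 i.

Record quad := Quad { q0 : point; q1 : point; q12 : point; q2 : point }.

Definition face (F : net) (m n : int) : quad :=
  Quad (F m n) (F (m + 1) n) (F (m + 1) (n + 1)) (F m (n + 1)).

Definition addq (q q' : quad) : quad :=
  Quad (q0 q + q0 q') (q1 q + q1 q') (q12 q + q12 q') (q2 q + q2 q').

Definition subq (q q' : quad) : quad :=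
  Quad (q0 q - q0 q') (q1 q - q1 q') (q12 q - q12 q') (q2 q - q2 q').

Definition orthonormal2 (e1 e2 : point) : Prop :=
  [/\ dot e1 e1 = 1, dot e2 e2 = 1 & dot e1 e2 = 0].

Definition in_span (e1 e2 x : point) : Prop :=
  exists a b : R, x = a *: e1 + b *: e2.

(* q lies in an affine plane with direction span(e1, e2) *)
Definition in_plane (e1 e2 : point) (q : quad) : Prop :=
  [/\ in_span e1 e2 (q1 q - q0 q), in_span e1 e2 (q12 q - q0 q)
    & in_span e1 e2 (q2 q - q0 q)].

Definition planar (q : quad) : Prop :=
  exists e1 e2 : point, orthonormal2 e1 e2 /\ in_plane e1 e2 q.

Definition collinear (q : quad) : Prop :=
  exists (e : point) (t1 t12 t2 : R),
    [/\ q1 q - q0 q = t1 *: e, q12 q - q0 q = t12 *: e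
      & q2 q - q0 q = t2 *: e].

Definition cross (e1 e2 x y : point) : R :=
  dot x e1 * dot y e2 - dot x e2 * dot y e1.

(* Signed area (shoelace formula) of a quad in a plane with direction
   span(e1, e2), oriented by the orthonormal basis (e1, e2). *)
Definition area (e1 e2 : point) (q : quad) : R :=
  2^-1 * (cross e1 e2 (q0 q) (q1 q) + cross e1 e2 (q1 q) (q12 q)
          + cross e1 e2 (q12 q) (q2 q) + cross e1 e2 (q2 q) (q0 q)).

Definition mixed_area (e1 e2 : point) (q q' : quad) : R :=
  4^-1 * (area e1 e2 (addq q q') - area e1 e2 (subq q q')).

Definition mean_curvature (e1 e2 : point) (q q' : quad) : R :=
  - mixed_area e1 e2 q q' / area e1 e2 q.

(* The quotient H_f is meaningful only for nonzero area, which is part of the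
   condition; faces contained in a line, for which the area vanishes in every
   plane, have no mean curvature and are excluded by [noncollinear_faces]. *)
Definition constant_mean_curvature (H : R) (F N : net) : Prop :=
  forall (m n : int) (e1 e2 : point),
    orthonormal2 e1 e2 -> in_plane e1 e2 (face F m n) ->
    ~ collinear (face F m n) ->
    area e1 e2 (face F m n) != 0 /\
    mean_curvature e1 e2 (face F m n) (face N m n) = H.

Definition minimal (F N : net) : Prop := constant_mean_curvature 0 F N.

Definition noncollinear_faces (F : net) : Prop :=
  forall m n : int, ~ collinear (face F m n).

Definition parallel (x y : point) : Prop :=
  exists p q : R, ((p != 0) || (q != 0)) /\ p *: x = q *: y.

Definition edge_parallel (F N : net) : Prop :=
  forall m n : int,
    parallel (F (m + 1) n - F m n) (N (m + 1) n - N m n) /\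
    parallel (F m (n + 1) - F m n) (N m (n + 1) - N m n).

(* Edges of F have nonzero length; edges of N may vanish. *)
Definition qnet_shape (F N : net) : Prop :=
  [/\ forall m n : int, planar (face F m n) /\ planar (face N m n),
      edge_parallel F N
    & forall m n : int, F (m + 1) n != F m n /\ F m (n + 1) != F m n].

Definition in_R3 (x : point) : Prop := x 0 (inord 3) = 0.

Definition qnet_R3 (F N : net) : Prop :=
  qnet_shape F N /\
  forall m n : int,
    [/\ in_R3 (F m n), in_R3 (N m n) & dot (N m n) (N m n) = 1].

Definition qnet_sphere (kappa : R) (F N : net) : Prop :=
  qnet_shape F N /\
  forall m n : int,
    [/\ dot (F m n) (F m n) = kappa^-1, dot (N m n) (N m n) = 1
      & dot (F m n) (N m n) = 0].

Definition qnet_S3 (F N : net) : Prop := qnet_sphere 1 F N.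

(* only meant for kappa >= 0; kappa = 0 is Euclidean space *)
Definition qnet_curvature (kappa : R) (F N : net) : Prop :=
  if kappa == 0 then qnet_R3 F N else qnet_sphere kappa F N.

(* The Christoffel dual of a net of constant mean curvature H. *)
Definition dual_net (H : R) (F N : net) : net :=
  fun m n => if H == 0 then N m n else F m n + H^-1 *: N m n.

Definition conformal_metric (H : R) (F N : net) (s : int -> int -> R) : Prop :=
  (forall m n : int, s m n != 0) /\
  let F' := dual_net H F N in
  forall m n : int,
    F' (m + 1) n - F' m n
      = (s m n * s (m + 1) n)^-1 *: (F (m + 1) n - F m n) /\
    F' m (n + 1) - F' m n
      = (s m n * s m (n + 1))^-1 *: (F m (n + 1) - F m n).

Definition black_white_equiv (s s' : int -> int -> R) : Prop :=
  exists cb cw : R, [/\ cb != 0, cw != 0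
    & forall m n : int,
        s' m n = (if odd (absz (m + n)) then cw else cb) * s m n].

End Nets.

Section Lax.
Variable R : realType.

Local Notation C := (R[i]).

Definition iC : C := 0 +i* 1.

Definition mx2 (a b c d : C) : 'M[C]_2 :=
  \matrix_(i < 2, j < 2)
    if i == 0 then (if j == 0 then a else b) else (if j == 0 then c else d).

Definition qi : 'M[C]_2 := mx2 0 (- iC) (- iC) 0.
Definition qj : 'M[C]_2 := mx2 0 (- 1) 1 0.
Definition qk : 'M[C]_2 := mx2 (- iC) 0 0 iC.

Definition quat (x : point R) : 'M[C]_2 :=
  (x 0 (inord 0))%:C *: qi + (x 0 (inord 1))%:C *: qj
  + (x 0 (inord 2))%:C *: qk + (x 0 (inord 3))%:C *: 1%:M.

Definition sigma3 : 'M[C]_2 := mx2 1 0 0 (- 1).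

Definition SU2 (X : 'M[C]_2) : Prop :=
  X *m (map_mx conjc X)^T = 1%:M /\ \det X = 1.

Definition expi (t : R) : C := cos t +i* sin t.

(* exp (t k), since k^2 = -1 *)
Definition exp_qk (t : R) : 'M[C]_2 := (cos t)%:C *: 1%:M + (sin t)%:C *: qk.

(* The data at (m, n) of la, lu, lalpha (resp. lb, lv, lbeta) belong to the
   edge from (m, n) to (m + 1, n) (resp. to (m, n + 1)). *)
Record lax_data := LaxData {
  la : int -> int -> C;
  lb : int -> int -> C;
  lu : int -> int -> R;
  lv : int -> int -> R;
  lalpha : int -> int -> C -> R;
  lbeta : int -> int -> C -> R }.

Definition laxU (L : lax_data) (m n : int) (z : C) : 'M[C]_2 :=
  let a := la L m n in let u := (lu L m n)%:C in
  ((lalpha L m n z)^-1)%:C *: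
    mx2 a (- (z * u) - z^-1 * u^-1) (z * u^-1 + z^-1 * u) (conjc a).

Definition laxV (L : lax_data) (m n : int) (z : C) : 'M[C]_2 :=
  let b := lb L m n in let v := (lv L m n)%:C in
  ((lbeta L m n z)^-1)%:C *:
    mx2 b (- (iC * z * v) + iC * z^-1 * v^-1)
        (iC * z * v^-1 - iC * z^-1 * v) (conjc b).

Definition is_lax (L : lax_data) : Prop :=
  (forall m n : int, 0 < lu L m n /\ 0 < lv L m n) /\
  forall (m n : int) (z : C), `|z| = 1 ->
    [/\ \det (laxU L m n z) = 1, \det (laxV L m n z) = 1,
        lalpha L m (n + 1) z = lalpha L m n z,
        lbeta L (m + 1) n z = lbeta L m n z
      & laxV L (m + 1) n z *m laxU L m n z
          = laxU L m (n + 1) z *m laxV L m n z].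

Definition mx_derivable (X : R -> 'M[C]_2) (t : R) : Prop :=
  forall i j : 'I_2,
    derivable (fun g : R => complex.Re (X g i j)) t 1 /\
    derivable (fun g : R => complex.Im (X g i j)) t 1.

Definition mx_derive (X : R -> 'M[C]_2) (t : R) : 'M[C]_2 :=
  \matrix_(i < 2, j < 2)
    (derive1 (fun g : R => complex.Re (X g i j)) t
     +i* derive1 (fun g : R => complex.Im (X g i j)) t).

(* Loops are taken differentiable in the angle of the spectral parameter. *)
Definition is_frame (L : lax_data) (Phi : int -> int -> C -> 'M[C]_2) : Prop :=
  (forall (m n : int) (z : C), `|z| = 1 ->
    [/\ SU2 (Phi m n z), Phi m n (- z) = sigma3 *m Phi m n z *m sigma3,
        Phi (m + 1) n z = laxU L m n z *m Phi m n z
      & Phi m (n + 1) z = laxV L m n z *m Phi m n z]) /\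
  forall (m n : int) (t : R), mx_derivable (fun g => Phi m n (expi g)) t.

Definition S3_immersion (Phi : int -> int -> C -> 'M[C]_2) (F N : net R) : Prop :=
  let z1 := expi (pi / 4) in
  let z2 := expi (- (pi / 4)) in
  let M := exp_qk (pi / 4) in
  forall m n : int,
    quat (F m n) = invmx (Phi m n z1) *m M *m Phi m n z2 /\
    quat (N m n) = - (invmx (Phi m n z1) *m qk *m M *m Phi m n z2).

Definition R3_immersion (Phi : int -> int -> C -> 'M[C]_2) (F N : net R) : Prop :=
  forall m n : int,
    let X := fun g : R => Phi m n (expi g) in
    quat (N m n) = - (invmx (X 0) *m qk *m X 0) /\
    quat (F m n) = - (invmx (X 0) *m mx_derive X 0)
                   - (2^-1 : R)%:C *: quat (N m n).

End Lax.

(* Main.v *)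
(* Write phi = 1/s, up to a black-white rescaling, and scale to H^2 + kappa = 1.
   A net of constant mean curvature H then satisfies
     N_i - N = (phi phi_i - H) (F_i - F)   on every edge,
   and conversely these edge equations, with phi_12 <> phi and phi_1 <> phi_2,
   give planar faces of mean curvature H: closing up N around a face is the
   Moutard equation for phi F, which also shows that phi phi_i |F_i - F|^2 agrees
   on opposite edges.

   Frame the net by unit quaternions, F = kappa^(-1/2) A^-1 M B and
   N = - A^-1 k M B with M = diag(z^*, z), z^2 = H + i kappa^(1/2).  The edge
   equation says exactly that the transition matrices of A and B are the values
   at z and z^* of a matrix [[a, p (c w^* - w)], [.., a^*]] with c = phi phi_i,
   |w| = 1.  Flatness at the two values z, z^* forces flatness for all |w| = 1,
   with determinants that agree on opposite edges, so evaluating at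
   w^2 = H' + i kappa'^(1/2) produces the net of curvatures (H', kappa').  No
   signs enter until the matrices are gauged to the form of the Lax matrices.

   In the Euclidean case w = 1 the edge matrix may vanish, when a = 0 and c = 1.
   This happens along whole strips, across which N is constant and F is replaced
   by const - F - N; the constants only have to avoid countably many values.

   For the converse the signs of alpha(z) and alpha(z^* ) must agree: frames are
   differentiable in the angle, so 1/alpha is continuous and nowhere zero. *)
From mathcomp Require Import all_boot all_order all_algebra.
From mathcomp Require Import ring lra.
From mathcomp Require Import boolp classical_sets cardinality reals topology normedtype.
From mathcomp Require Import lebesgue_measure.
From mathcomp Require Import derive realfun trigo.
Require Import Defs.

Set Implicit Arguments.
Unset Strict Implicit.
Unset Printing Implicit Defensive.

Import Order.TTheory GRing.Theory Num.Theory.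
Import numFieldNormedType.Exports.

Local Open Scope ring_scope.

(** * Sections over the square lattice *)

(** The determinant of an edge matrix is affine in x = Re w^2, and x is the mean curvature of the
    target once H^2 + kappa is scaled to 1. For p <> 0 it is positive when -1 < x < 1, so no target
    of positive curvature is obstructed; it can vanish only at x = 1 or x = -1. The Euclidean target
    meets x = 1 alone, whereas Lax matrices of determinant 1 on the whole circle must survive both
    ends. On a minimal net an edge that degenerates at an end sends F to N or -N, which is what the
    conditions on F_1, N and F_2, -N in the frame statement forbid. The sign conditions on s come
    from u, v > 0: the matrices U and V have c = -1/u^2 and c = 1/v^2. A frame has to take
    prescribed values at the two spectral parameters of the immersion. Two values do not constrain
    the initial loop, so the given net itself is reproduced and not merely a congruent copy. *)

Lemma int_ind_step (P : int -> Prop) :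
  P 0 -> (forall k, P k <-> P (k + 1)) -> forall k, P k.
Proof.
move=> P0 PS; elim=> [//|n /PS|n IH]; first by rewrite -addn1 PoszD.
by apply/PS; rewrite -addn1 PoszD opprD subrK.
Qed.

(** Both steps are equivalences because a property must also travel backwards along each axis; the
    transition maps to which this is applied are invertible. *)
Lemma int2_ind (P : int -> int -> Prop) :
  P 0 0 -> (forall m n, P m n <-> P (m + 1) n) ->
  (forall m n, P m n <-> P m (n + 1)) -> forall m n, P m n.
Proof.
move=> P0 P1 P2 m; apply: int_ind_step => [|n]; last exact: P2.
by move: m; apply: int_ind_step.
Qed.

Lemma int_section (X : Type) (x0 : X) (A A' : int -> X -> X) :
  (forall k x, A' k (A k x) = x) -> (forall k x, A k (A' k x) = x) ->
  exists f : int -> X, f 0 = x0 /\ forall k, f (k + 1) = A k (f k).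
Proof.
move=> AK A'K.
pose fp := fix fp (n : nat) := if n is k.+1 then A k%:Z (fp k) else x0.
pose fn := fix fn (n : nat) :=
  if n is k.+1 then A' (Negz k) (fn k) else x0.
exists (fun k => match k with Posz n => fp n | Negz n => fn n.+1 end).
split=> // -[n|[|n]].
- by rewrite -[Posz n + 1]/(Posz (n + 1)) addn1.
- by rewrite -[Negz 0 + 1]/(0 : int) /= A'K.
- have -> : Negz n.+1 + 1 = Negz n by rewrite !NegzE -[n.+2]addn1 PoszD opprD subrK.
  by rewrite [fn n.+2]/= A'K.
Qed.

(** Integrate along the row n = 0, then up and down each column; flatness carries the row equation
    to the other rows, and going down uses that B is injective. [X] is an arbitrary type because the
    lemma serves for matrices, signs, phases, points with a translation coefficient, and whole
    loops. *)
Lemma flat_section (X : Type) (x0 : X) (A A' B B' : int -> int -> X -> X) :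
  (forall m n x, A' m n (A m n x) = x) ->
  (forall m n x, A m n (A' m n x) = x) ->
  (forall m n x, B' m n (B m n x) = x) ->
  (forall m n x, B m n (B' m n x) = x) ->
  (forall m n x, B (m + 1) n (A m n x) = A m (n + 1) (B m n x)) ->
  exists f : int -> int -> X,
    [/\ f 0 0 = x0, forall m n, f (m + 1) n = A m n (f m n)
      & forall m n, f m (n + 1) = B m n (f m n)].
Proof.
move=> AK A'K BK B'K flat.
have [g [g0 gS]] := @int_section _ x0 (A^~ 0) (A'^~ 0) (AK^~ 0) (A'K^~ 0).
have /choice[f fP] : forall m : int, exists f : int -> X,
    f 0 = g m /\ forall k, f (k + 1) = B m k (f k).
  by move=> m; exact: int_section (BK m) (B'K m).
exists f; split=> [|m n|m n]; rewrite ?(fP m).2 ?(fP 0).1 //.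
move: n; apply: int_ind_step => [|n]; first by rewrite !(fP _).1 gS.
rewrite !(fP _).2 -flat; split=> [->//|E].
by rewrite -[LHS](BK (m + 1)%R n) E BK.
Qed.

(** * Edge equations and planar quads *)

Section Geometry.
Variable R : realType.
Implicit Types (x y z e : point R) (F N : net R) (phi s : int -> int -> R).

Lemma dotC x y : dot x y = dot y x.
Proof. by apply: eq_bigr => i _; rewrite mulrC. Qed.

Lemma dotDl x y z : dot (x + y) z = dot x z + dot y z.
Proof. by rewrite -big_split; apply: eq_bigr => i _; rewrite !mxE mulrDl. Qed.

Lemma dotZl (a : R) x y : dot (a *: x) y = a * dot x y.
Proof. by rewrite mulr_sumr; apply: eq_bigr => i _; rewrite !mxE mulrA. Qed.

Lemma dotNl x y : dot (- x) y = - dot x y.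
Proof. by rewrite -scaleN1r dotZl mulN1r. Qed.

Lemma dotDr x y z : dot z (x + y) = dot z x + dot z y.
Proof. by rewrite dotC dotDl !(dotC _ z). Qed.

Lemma dotZr (a : R) x y : dot y (a *: x) = a * dot y x.
Proof. by rewrite dotC dotZl dotC. Qed.

Lemma dotNr x y : dot y (- x) = - dot y x.
Proof. by rewrite dotC dotNl dotC. Qed.

Definition dotE := (dotDl, dotDr, dotZl, dotZr, dotNl, dotNr).

Lemma dot_ge0 x : 0 <= dot x x.
Proof. by apply: sumr_ge0 => i _; rewrite -expr2 sqr_ge0. Qed.

Lemma dot_eq0 x : (dot x x == 0) = (x == 0).
Proof.
apply/eqP/eqP => [|->]; last by apply: big1 => i _; rewrite mxE mul0r.
move/psumr_eq0P => H; apply/rowP => i; apply/eqP; rewrite mxE -sqrf_eq0 expr2.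
by rewrite H // => j _; rewrite -expr2 sqr_ge0.
Qed.

Lemma dot_gt0 x : x != 0 -> 0 < dot x x.
Proof. by move=> x0; rewrite lt_neqAle dot_ge0 eq_sym dot_eq0 x0. Qed.

Lemma dot4 x y : dot x y = x 0 (inord 0) * y 0 (inord 0)
  + x 0 (inord 1) * y 0 (inord 1) + x 0 (inord 2) * y 0 (inord 2)
  + x 0 (inord 3) * y 0 (inord 3).
Proof.
rewrite /dot !big_ord_recl big_ord0 addr0 !addrA.
by congr (_ + _ + _ + _); congr (_ * _); congr (_ _ _);
   apply/val_inj; rewrite /= inordK.
Qed.

(** The witness is a complex structure on R^4 applied to x. *)
Lemma orthogonal_unit x : dot x x = 1 -> exists y, dot y y = 1 /\ dot x y = 0.
Proof.
pose i0 : 'I_4 := inord 0; pose i1 : 'I_4 := inord 1.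
pose i2 : 'I_4 := inord 2; pose i3 : 'I_4 := inord 3.
pose f (i : 'I_4) : R := match val i with
  | 0%N => - x 0 i1 | 1%N => x 0 i0 | 2%N => - x 0 i3 | _ => x 0 i2 end.
move=> x1; exists (\row_i f i); move: x1.
by rewrite !dot4 !mxE /f /= !inordK //= => <-; split; ring.
Qed.

Lemma scale_unit x : x != 0 -> exists2 e, dot e e = 1 & exists a, x = a *: e.
Proof.
move=> x0; have d0 := dot_gt0 x0.
pose r := Num.sqrt (dot x x); have r0 : r != 0 by rewrite gt_eqF // sqrtr_gt0.
exists (r^-1 *: x); last by exists r; rewrite scalerA mulfV // scale1r.
rewrite !dotE -[dot x x]sqr_sqrtr ?ltW // -/r; field; exact: r0.
Qed.

(** Gram-Schmidt. When y is a multiple of x the basis is completed by any orthogonal unit vector,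
    since planarity asks for a basis even of a degenerate quad. *)
Lemma orthonormal_span x y : x != 0 ->
  exists e1 e2, [/\ orthonormal2 e1 e2, in_span e1 e2 x & in_span e1 e2 y].
Proof.
move=> /scale_unit[e1 e11 [a ->]].
pose y' := y - dot y e1 *: e1.
have ye : dot e1 y' = 0 by rewrite !dotE e11 (dotC e1); ring.
have [y0|/scale_unit[e2 e21 [b yb]]] := eqVneq y' 0.
  have [e2 [e21 e12]] := orthogonal_unit e11.
  exists e1, e2; split; [by []|exists a, 0|exists (dot y e1), 0];
    rewrite scale0r addr0 //.
  by apply/eqP; rewrite -subr_eq0 -/y' y0.
have [b0|b0] := eqVneq b 0.
  have [e3 [e31 e13]] := orthogonal_unit e11.
  exists e1, e3; split; [by []|exists a, 0|exists (dot y e1), 0];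
    rewrite scale0r addr0 //.
  by apply/eqP; rewrite -subr_eq0 -/y' yb b0 scale0r.
exists e1, e2; split; last 2 first.
- by exists a, 0; rewrite scale0r addr0.
- by exists (dot y e1), b; rewrite -yb addrC subrK.
split=> //; apply/(mulfI b0); rewrite mulr0 -ye yb !dotE.
by [].
Qed.

Definition edge_eq (H : R) phi F N := forall m n : int,
  N (m + 1) n - N m n = (phi m n * phi (m + 1) n - H) *: (F (m + 1) n - F m n)
  /\
  N m (n + 1) - N m n = (phi m n * phi m (n + 1) - H) *: (F m (n + 1) - F m n).

Definition generic phi := forall m n : int,
  [/\ phi m n != 0, phi (m + 1) (n + 1) != phi m n
    & phi m (n + 1) != phi (m + 1) n].

Definition edges_neq0 F := forall m n : int,
  F (m + 1) n != F m n /\ F m (n + 1) != F m n.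

(* Closing up [N] around a face gives the Moutard equation for [phi F]. *)
Lemma moutard H phi F N m n : edge_eq H phi F N ->
  (phi (m + 1) (n + 1) * (phi m (n + 1) - phi (m + 1) n))
     *: (F (m + 1) (n + 1) - F m n)
  = (phi (m + 1) (n + 1) - phi m n) *:
     (phi m (n + 1) *: (F m (n + 1) - F m n)
      - phi (m + 1) n *: (F (m + 1) n - F m n)).
Proof.
move=> E; have [E1 E2] := E m n; have [_ E3] := E (m + 1) n.
have [E4 _] := E m (n + 1).
apply/rowP => i; move/rowP/(_ i): E1; move/rowP/(_ i): E2.
move/rowP/(_ i): E3; move/rowP/(_ i): E4; rewrite !mxE => E4 E3 E2 E1.
apply/eqP; rewrite -subr_eq0; apply/eqP.
(* The increments of N around the face cancel; after the edge equations are substituted, the same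
   sum is the difference of the two sides. *)
transitivity ((N m (n + 1) 0 i - N m n 0 i) +
  (N (m + 1) (n + 1) 0 i - N m (n + 1) 0 i) - (N (m + 1) n 0 i - N m n 0 i)
  - (N (m + 1) (n + 1) 0 i - N (m + 1) n 0 i)); last by ring.
by rewrite E1 E2 E3 E4; ring.
Qed.

Section Face.
Variables (H : R) (phi : int -> int -> R) (F N : net R).
Hypotheses (FN : edge_eq H phi F N) (gen : generic phi) (F0 : edges_neq0 F).
Variables m n : int.

Let f0 := phi m n.
Let f1 := phi (m + 1) n.
Let f2 := phi m (n + 1).
Let f3 := phi (m + 1) (n + 1).
Let x := F (m + 1) n - F m n.
Let y := F m (n + 1) - F m n.
Let z := F (m + 1) (n + 1) - F m n.

Let f0_neq0 : f0 != 0. Proof. by case: (gen m n). Qed.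
Let f1_neq0 : f1 != 0. Proof. by case: (gen (m + 1) n). Qed.
Let f2_neq0 : f2 != 0. Proof. by case: (gen m (n + 1)). Qed.
Let f3_neq0 : f3 != 0. Proof. by case: (gen (m + 1) (n + 1)). Qed.
Let f30 : f3 - f0 != 0. Proof. by rewrite subr_eq0; case: (gen m n). Qed.
Let f21 : f2 - f1 != 0. Proof. by rewrite subr_eq0; case: (gen m n). Qed.

Lemma face_diagonal :
  z = ((f3 - f0) * f2 / (f3 * (f2 - f1))) *: y
      - ((f3 - f0) * f1 / (f3 * (f2 - f1))) *: x.
Proof.
have d0 : f3 * (f2 - f1) != 0 by rewrite mulf_neq0.
apply: (scalerI d0); rewrite /z (moutard m n FN) -/f0 -/f1 -/f2 -/f3 -/x -/y.
apply/rowP => i; rewrite !mxE; field.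
by rewrite f21 f3_neq0.
Qed.

Lemma face_normals :
  [/\ N (m + 1) n - N m n = (f0 * f1 - H) *: x,
      N m (n + 1) - N m n = (f0 * f2 - H) *: y
    & N (m + 1) (n + 1) - N m n
      = (f0 * f1 - H) *: x + (f1 * f3 - H) *: (z - x)].
Proof.
have [E1 E2] := FN m n; have [_ E3] := FN (m + 1) n; split=> //.
have -> : z - x = F (m + 1) (n + 1) - F (m + 1) n by rewrite /z /x opprB addrA subrK.
by rewrite -E1 -E3; apply/rowP => i; rewrite !mxE; ring.
Qed.

Lemma face_planar : planar (face F m n) /\ planar (face N m n).
Proof.
have x0 : x != 0 by rewrite subr_eq0; case: (F0 m n).
have [e1 [e2 [oe [a1 [b1 xe]] [a2 [b2 ye]]]]] := orthonormal_span y x0.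
have lin a b c d : a *: (a1 *: e1 + b1 *: e2) + b *: (a2 *: e1 + b2 *: e2)
   + c *: (a1 *: e1 + b1 *: e2) = d -> in_span e1 e2 d.
  move=> <-; exists ((a + c) * a1 + b * a2), ((a + c) * b1 + b * b2).
  by apply/rowP => i; rewrite !mxE; ring.
have [N1 N2 N3] := face_normals.
split; exists e1, e2; split=> //; split=> /=.
- by exists a1, b1.
- rewrite -/z face_diagonal xe ye -scaleNr.
  set u := _ / _; set v := - (_ / _).
  by apply: (@lin v u 0); rewrite scale0r addr0 addrC.
- by exists a2, b2.
- by rewrite N1 xe; apply: (@lin (f0 * f1 - H) 0 0); rewrite !scale0r !addr0.
- rewrite N3 face_diagonal xe ye.
  set u := _ / _; set v := (_ / _); set w := f0 * f1 - H; set t := f1 * f3 - H.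
  apply: (@lin w (t * u) (- t * v - t)).
  by apply/rowP => i; rewrite !mxE; ring.
- by rewrite N2 ye; apply: (@lin 0 (f0 * f2 - H) 0); rewrite !scale0r add0r addr0.
Qed.

(** The diagonal is a combination of the edges x and y, so if their determinant D vanished the whole
    face would lie on a line. Otherwise the area is D (f3 - f0) / (2 f3), nonzero because phi_12 <>
    phi, and the mixed area comes out as -H times it. *)
Lemma face_curvature e1 e2 : orthonormal2 e1 e2 ->
  in_plane e1 e2 (face F m n) -> ~ collinear (face F m n) ->
  area e1 e2 (face F m n) != 0 /\
  mean_curvature e1 e2 (face F m n) (face N m n) = H.
Proof.
move=> [e11 e22 e12] [[x1 [x2 xe]] _ [y1 [y2 ye]]] ncol.
rewrite /= -/x in xe; rewrite /= -/y in ye.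
have x0 : x != 0 by rewrite subr_eq0; case: (F0 m n).
have [N1 N2 N3] := face_normals.
have D : x1 * y2 - x2 * y1 != 0.
  apply/eqP => D; apply: ncol.
  have [t yt] : exists t, y = t *: x.
    have [x10|x10] := eqVneq x1 0; last first.
      exists (y1 / x1); rewrite xe ye; apply/rowP => i; rewrite !mxE.
      have -> : y2 = x2 * y1 / x1 by rewrite -(subr0_eq D); field.
      by field.
    have x20 : x2 != 0.
      by apply: contraNneq x0 => x20; rewrite xe x10 x20 !scale0r addr0.
    exists (y2 / x2); rewrite xe ye x10.
    have -> : y1 = 0.
      by apply: (mulfI x20); rewrite -(subr0_eq D) x10 mul0r mulr0.
    by apply/rowP => i; rewrite !mxE; field.
  exists x, 1, ((f3 - f0) * f2 / (f3 * (f2 - f1)) * t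
      - (f3 - f0) * f1 / (f3 * (f2 - f1))), t.
  split=> /=; rewrite ?scale1r // -/z face_diagonal yt.
  by rewrite scalerA -scalerBl.
have F1 : F (m + 1) n = F m n + (x1 *: e1 + x2 *: e2).
  by rewrite -xe /x subrKC.
have F2 : F m (n + 1) = F m n + (y1 *: e1 + y2 *: e2).
  by rewrite -ye /y subrKC.
have F3 : F (m + 1) (n + 1) = F m n + z by rewrite /z subrKC.
have N1' : N (m + 1) n = N m n + (f0 * f1 - H) *: x by rewrite -N1 subrKC.
have N2' : N m (n + 1) = N m n + (f0 * f2 - H) *: y by rewrite -N2 subrKC.
have N3' : N (m + 1) (n + 1)
   = N m n + ((f0 * f1 - H) *: x + (f1 * f3 - H) *: (z - x)).
  by rewrite -N3 subrKC.
have aE : area e1 e2 (face F m n)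
   = 2^-1 * ((f3 - f0) / f3) * (x1 * y2 - x2 * y1).
  rewrite /area /face /cross /= F1 F2 F3 face_diagonal xe ye !dotE e11 e22.
  rewrite (dotC e2) e12; field.
  by rewrite f3_neq0 f21.
have a0 : area e1 e2 (face F m n) != 0.
  by rewrite aE !mulf_neq0 // ?invr_eq0 ?pnatr_eq0.
split=> //; rewrite /mean_curvature; apply: (mulIf a0); rewrite divfK // aE.
rewrite /mixed_area /area /addq /subq /face /cross /= F1 F2 F3 N1' N2' N3'.
rewrite face_diagonal xe ye !dotE e11 e22 (dotC e2) e12; field.
by rewrite f3_neq0 f21.
Qed.

Lemma sphere_chord (r : R) (v w : point R) : dot v v = r -> dot w w = r ->
  2 * dot v (w - v) + dot (w - v) (w - v) = 0.
Proof. by move=> vr wr; rewrite !dotE wr (dotC w) vr; ring. Qed.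

Variable rho : R.
Hypothesis sph : forall m n : int, dot (F m n) (F m n) = rho.

(** A line through a point of a sphere meets it in at most one further point, so t1 = t2, and t3 is
    either 0 or this same number. The diagonal formula gives t3 = t1 (f3 - f0) / f3, which is
    neither. *)
Lemma face_noncollinear : ~ collinear (face F m n).
Proof.
move=> [e [t1 [t3 [t2 /=]]]] [xe ze ye].
have := sphere_chord (sph m n) (sph (m + 1) n); rewrite xe.
have := sphere_chord (sph m n) (sph (m + 1) (n + 1)); rewrite ze.
have := sphere_chord (sph m n) (sph m (n + 1)); rewrite ye !dotE.
have [x0 y0] := F0 m n.
have e0 : e != 0.
  by apply: contraNneq x0 => e0; rewrite -subr_eq0 xe e0 scaler0.
have t10 : t1 != 0.
  by apply: contraNneq x0 => t0; rewrite -subr_eq0 xe t0 scale0r.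
have t20 : t2 != 0.
  by apply: contraNneq y0 => t0; rewrite -subr_eq0 ye t0 scale0r.
have /lt0r_neq0 d0 := dot_gt0 e0.
move=> E2 E3 E1.
have K t : t != 0 -> 2 * (t * dot (F m n) e) + t * (t * dot e e) = 0 ->
    t = - 2 * dot (F m n) e / dot e e.
  move=> t0 E; apply: (mulIf d0); rewrite divfK //; apply: (mulfI t0).
  by apply/eqP; rewrite -subr_eq0; apply/eqP; rewrite -[RHS]E; ring.
have t21 : t2 = t1 by rewrite (K _ t10 E1) (K _ t20 E2).
have zE := face_diagonal; rewrite /z /x /y xe ye ze t21 -scalerBl in zE.
have {zE} : t3 = (f3 - f0) / f3 * t1.
  apply/eqP; rewrite -subr_eq0; have := e0; apply: contraNT => h.
  have /eqP : (t3 - (f3 - f0) / f3 * t1) *: e = 0.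
    rewrite scalerBl zE; apply/rowP => i; rewrite !mxE; field.
    by rewrite f3_neq0 f21.
  by rewrite scaler_eq0 (negPf h).
have [->/esym/eqP|t30] := eqVneq t3 0.
  by rewrite !mulf_eq0 invr_eq0 (negPf t10) (negPf f30) (negPf f3_neq0).
rewrite (K _ t30 E3) -(K _ t10 E1) => /eqP; rewrite -{1}[t1]mul1r.
rewrite (inj_eq (mulIf t10)) -(inj_eq (mulIf f3_neq0)) divfK // mul1r.
by move=> /eqP E; case/eqP: f0_neq0; move: E; lra.
Qed.

(** On the sphere a chord u from F has |u|^2 = -2 F.u. This expresses |x|^2 and |y|^2 by F.x and
    F.y, and the same relation for the diagonal z then determines x.y; both claims become rational
    identities in these two numbers. *)
Lemma face_label :
  f0 * f1 * dot x x
    = f2 * f3 * dot (F (m + 1) (n + 1) - F m (n + 1))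
                    (F (m + 1) (n + 1) - F m (n + 1)) /\
  f0 * f2 * dot y y
    = f1 * f3 * dot (F (m + 1) (n + 1) - F (m + 1) n)
                    (F (m + 1) (n + 1) - F (m + 1) n).
Proof.
have -> : F (m + 1) (n + 1) - F (m + 1) n = z - x by rewrite /z /x opprB addrA subrK.
have -> : F (m + 1) (n + 1) - F m (n + 1) = z - y by rewrite /z /y opprB addrA subrK.
have Ex := sphere_chord (sph m n) (sph (m + 1) n); rewrite -/x in Ex.
have Ez := sphere_chord (sph m n) (sph (m + 1) (n + 1)); rewrite -/z in Ez.
have Ey := sphere_chord (sph m n) (sph m (n + 1)); rewrite -/y in Ey.
have zE := face_diagonal.
move: (x) (y) (z) zE Ex Ey Ez => u v t zE Ex Ey Ez.
have dxy : dot v u = dot u v by exact: dotC.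
have {}Ex : dot u u = - 2 * dot (F m n) u by apply/eqP; rewrite -subr_eq0 -Ex; apply/eqP; ring.
have {}Ey : dot v v = - 2 * dot (F m n) v by apply/eqP; rewrite -subr_eq0 -Ey; apply/eqP; ring.
rewrite {}zE !dotE dxy Ex Ey in Ez *.
set X := dot (F m n) u in Ez *; set Y := dot (F m n) v in Ez *.
set W := dot u v in Ez *.
pose mu := (f3 - f0) / (f2 - f1).
have mu0 : mu != 0 by rewrite mulf_neq0 ?invr_eq0.
have {}Ez : 2 * mu * f1 * f2 * W = - 2 * f2 * (mu * f2 - f3) * Y
   - 2 * f1 * (mu * f1 + f3) * X.
  apply/eqP; rewrite -subr_eq0; apply/eqP; apply: (mulfI mu0); rewrite mulr0.
  have f33 : - f3 ^+ 2 != 0 by rewrite oppr_eq0 expf_neq0.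
  rewrite -[RHS](mulr0 (- f3 ^+ 2)) -Ez /mu; field.
  by rewrite f3_neq0 f21.
have WE : W = (- 2 * f2 * (mu * f2 - f3) * Y - 2 * f1 * (mu * f1 + f3) * X)
   / (2 * mu * f1 * f2).
  by rewrite -Ez; field; rewrite mu0 f1_neq0 f2_neq0.
rewrite WE /mu; split; field;
by rewrite f1_neq0 f2_neq0 f3_neq0 f21 ?f30.
Qed.

End Face.
End Geometry.

(** * Edge equations versus Q-nets with a conformal metric *)

Section Reconstruction.
Variable R : realType.
Implicit Types (F N : net R) (phi s : int -> int -> R).

Lemma edge_eq_qnet (H : R) phi F N :
  edge_eq H phi F N -> generic phi -> edges_neq0 F ->
  qnet_shape F N /\ constant_mean_curvature H F N.
Proof.
move=> FN gen F0; split=> [|m n e1 e2]; last exact: face_curvature.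
split=> // m n; first exact: (face_planar FN gen F0 m n).
have [E1 E2] := FN m n.
split.
- exists (phi m n * phi (m + 1) n - H), 1.
  by rewrite oner_eq0 orbT scale1r -E1.
- exists (phi m n * phi m (n + 1) - H), 1.
  by rewrite oner_eq0 orbT scale1r -E2.
Qed.

(** The factor by which 1/(s s_i) must be multiplied to become phi phi_i, uniformly for the two
    forms of the Christoffel dual. *)
Definition dual_factor (H : R) : R := if H == 0 then 1 else H.

Lemma dual_factor_neq0 H : dual_factor H != 0.
Proof. by rewrite /dual_factor; case: (eqVneq H 0) => [_|//]; rewrite oner_eq0. Qed.

Definition metric_product (h : R) s phi := forall m n : int,
  phi m n * phi (m + 1) n = h * (s m n * s (m + 1) n)^-1 /\
  phi m n * phi m (n + 1) = h * (s m n * s m (n + 1))^-1.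

(** Each edge joins vertices of opposite parity, so this multiplies every edge product by exactly t.
    Unlike a uniform factor sqrt t it also allows t < 0, as happens for negative H. *)
Definition black_white (t : R) (m n : int) : R :=
  if odd (absz (m + n)) then t else 1.

Lemma odd_absz_succ (k : int) : odd (absz (k + 1)) = ~~ odd (absz k).
Proof.
case: k => [n|[|n]] //; first by rewrite -PoszD addn1.
have -> : Negz n.+1 + 1 = Negz n by rewrite !NegzE -[n.+2]addn1 PoszD opprD subrK.
by rewrite /= !negbK.
Qed.

Lemma black_whiteM t m n :
  black_white t m n * black_white t (m + 1) n = t /\
  black_white t m n * black_white t m (n + 1) = t.
Proof.
rewrite /black_white -!addrA (addrC 1) !addrA odd_absz_succ.
by case: (odd _); rewrite ?mulr1 ?mul1r.
Qed.

Lemma black_white_neq0 t m n : t != 0 -> black_white t m n != 0.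
Proof. by rewrite /black_white; case: ifP => [//|_ _]; rewrite oner_eq0. Qed.

Lemma metric_product_black_white h s :
  metric_product h s (fun m n => black_white h m n * (s m n)^-1).
Proof.
by move=> m n; have [b1 b2] := black_whiteM h m n;
   split; rewrite mulrACA -invfM (b1, b2).
Qed.

Lemma conformal_metric_edge_eq (H : R) phi s F N :
  (forall m n, s m n != 0) -> metric_product (dual_factor H) s phi ->
  conformal_metric H F N s <-> edge_eq H phi F N.
Proof.
move=> s0 P.
have dualE m n m' n' c : dual_net H F N m' n' - dual_net H F N m n
    = c *: (F m' n' - F m n) <->
    N m' n' - N m n = (dual_factor H * c - H) *: (F m' n' - F m n).
  rewrite /dual_net /dual_factor; case: eqVneq => [->|H0].
    by rewrite mul1r subr0.
  split=> [E|E].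
    apply: (scalerI (invr_neq0 H0)).
    transitivity (c *: (F m' n' - F m n) - (F m' n' - F m n)).
      by rewrite -E; apply/rowP => i; rewrite !mxE; ring.
    by apply/rowP => i; rewrite !mxE; field.
  transitivity ((F m' n' - F m n) + H^-1 *: (N m' n' - N m n)).
    by apply/rowP => i; rewrite !mxE; ring.
  by rewrite E; apply/rowP => i; rewrite !mxE; field.
split=> [[_ E] m n|E].
  have [E1 E2] := E m n; have [-> ->] := P m n.
  by split; apply/dualE.
split=> [|F' m n]; [by []|have [E1 E2] := E m n; have [P1 P2] := P m n].
by split; apply/dualE; rewrite -(P1, P2).
Qed.

(** If phi_12 = phi and phi_1 = phi_2 hold together, the face of N is a homothetic image of that of
    F with ratio phi phi_1 - H, and mean curvature H would force phi phi_1 = 0. If just one of them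
    holds, the Moutard equation makes two opposite vertices coincide and the area vanishes. *)
Lemma cmc_generic (H : R) phi F N :
  (forall m n, planar (face F m n)) -> noncollinear_faces F ->
  constant_mean_curvature H F N -> (forall m n, phi m n != 0) ->
  edge_eq H phi F N -> generic phi.
Proof.
move=> pl ncol cmc phi0 E m n.
have [e1 [e2 [oe ip]]] := pl m n.
have [a0 mc] := cmc m n e1 e2 oe ip (ncol m n).
have M := moutard m n E.
have both : phi (m + 1) (n + 1) = phi m n -> phi m (n + 1) <> phi (m + 1) n.
  move=> f30 f21; have [E1 E2] := E m n; have [_ E3] := E (m + 1) n.
  rewrite f30 f21 in E1 E2 E3; rewrite (mulrC (phi (m + 1) n)) in E3.
  set k := _ - H in E1 E2 E3.
  have N1 : N (m + 1) n = N m n + k *: (F (m + 1) n - F m n).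
    by rewrite -E1 subrKC.
  have N2 : N m (n + 1) = N m n + k *: (F m (n + 1) - F m n).
    by rewrite -E2 subrKC.
  have N3 : N (m + 1) (n + 1) = N m n + k *: (F (m + 1) (n + 1) - F m n).
    rewrite -[LHS](subrKC (N (m + 1) n)) E3 N1.
    by apply/rowP => i; rewrite !mxE; ring.
  have MA : mixed_area e1 e2 (face F m n) (face N m n)
      = k * area e1 e2 (face F m n).
    by rewrite /mixed_area /area /cross /= N1 N2 N3 !dotE; field.
  move: mc; rewrite /mean_curvature MA -mulNr mulfK // opprB => mc.
  have /eqP : phi m n * phi (m + 1) n = 0 by move: mc; lra.
  by rewrite mulf_eq0 (negPf (phi0 _ _)) (negPf (phi0 _ _)).
split=> //; apply/eqP.
  move=> f30; have /eqP f21 := both f30.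
  move: M; rewrite f30 subrr scale0r => /eqP; rewrite scaler_eq0 mulf_eq0.
  rewrite (negPf (phi0 _ _)) !subr_eq0 (negPf f21) /= => /eqP F3.
  by case/eqP: a0; rewrite /area /cross /= F3; ring.
move=> f21.
have f30 : phi (m + 1) (n + 1) != phi m n by apply/eqP => /both.
move: M; rewrite f21 subrr mulr0 scale0r -scalerBr => /esym/eqP.
rewrite !scaler_eq0 subr_eq0 (negPf f30) (negPf (phi0 _ _)) /=.
rewrite subr_eq0 (inj_eq (@addIr _ _)) => /eqP F2.
by case/eqP: a0; rewrite /area /cross /= F2; ring.
Qed.

End Reconstruction.

(** * Quaternions as complex matrices *)

Section Conjugation.
Variable R : rcfType.
Implicit Types a b : R[i].

Lemma conjcD a b : conjc (a + b) = conjc a + conjc b. Proof. exact: rmorphD. Qed.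
Lemma conjcN a : conjc (- a) = - conjc a. Proof. exact: rmorphN. Qed.
Lemma conjcM a b : conjc (a * b) = conjc a * conjc b. Proof. exact: rmorphM. Qed.

Lemma rcD (x y : R) : (x + y)%:C%C = x%:C%C + y%:C%C. Proof. exact: rmorphD. Qed.
Lemma rcN (x : R) : (- x)%:C%C = - x%:C%C. Proof. exact: rmorphN. Qed.
Lemma rcB (x y : R) : (x - y)%:C%C = x%:C%C - y%:C%C. Proof. exact: rmorphB. Qed.
Lemma rcM (x y : R) : (x * y)%:C%C = x%:C%C * y%:C%C. Proof. exact: rmorphM. Qed.
Lemma rcX (x : R) n : (x ^+ n)%:C%C = x%:C%C ^+ n. Proof. exact: rmorphXn. Qed.
Lemma rcV (x : R) : (x^-1)%:C%C = (x%:C%C)^-1. Proof. exact: fmorphV. Qed.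
Lemma rc1 : (1 : R)%:C%C = 1. Proof. by []. Qed.
Lemma rc_nat n : (n%:R : R)%:C%C = n%:R. Proof. exact: rmorph_nat. Qed.

Definition rcE := (rcD, rcN, rcM, rcX, rcV, rc1, rc_nat).

Definition conjcE := (conjcD, conjcN, conjcM, @conjcK R, @conjc_real R,
  @conjc0 R, @conjc1 R, @conjc_inv R).

End Conjugation.

Section Quaternions.
Variable R : realType.
Local Notation C := (R[i]).
Implicit Types (a b p q : C) (X Y : 'M[C]_2) (x y : point R).

Lemma eq_mx2 (a b c d a' b' c' d' : C) :
  a = a' -> b = b' -> c = c' -> d = d' -> mx2 a b c d = mx2 a' b' c' d'.
Proof. by move=> -> -> -> ->. Qed.

Lemma mx2_eta X : X = mx2 (X 0 0) (X 0 1) (X 1 0) (X 1 1).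
Proof.
apply/matrixP => -[[|[|//]] hi] [[|[|//]] hj]; rewrite !mxE /=;
  by congr (X _ _); apply/val_inj.
Qed.

Lemma mx2E (a b c d : C) :
  ((mx2 a b c d 0 0 = a) * (mx2 a b c d 0 1 = b)) *
  ((mx2 a b c d 1 0 = c) * (mx2 a b c d 1 1 = d)).
Proof. by rewrite !mxE. Qed.

Lemma mx2M (a b c d a' b' c' d' : C) :
  mx2 a b c d *m mx2 a' b' c' d'
  = mx2 (a * a' + b * c') (a * b' + b * d') (c * a' + d * c') (c * b' + d * d').
Proof.
by rewrite [LHS]mx2_eta; apply: eq_mx2; rewrite mxE !big_ord_recl big_ord0 addr0;
   rewrite !mxE.
Qed.

Lemma mx2D (a b c d a' b' c' d' : C) :
  mx2 a b c d + mx2 a' b' c' d' = mx2 (a + a') (b + b') (c + c') (d + d').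
Proof. by rewrite [LHS]mx2_eta; apply: eq_mx2; rewrite !mxE. Qed.

Lemma mx2N (a b c d : C) : - mx2 a b c d = mx2 (- a) (- b) (- c) (- d).
Proof. by rewrite [LHS]mx2_eta; apply: eq_mx2; rewrite !mxE. Qed.

Lemma mx2Z (k a b c d : C) :
  k *: mx2 a b c d = mx2 (k * a) (k * b) (k * c) (k * d).
Proof. by rewrite [LHS]mx2_eta; apply: eq_mx2; rewrite !mxE. Qed.

Lemma mx2_scalar (k : C) : k%:M = mx2 k 0 0 k.
Proof. by rewrite [LHS]mx2_eta; apply: eq_mx2; rewrite !mxE. Qed.

Lemma mx2_det (a b c d : C) : \det (mx2 a b c d) = a * d - b * c.
Proof.
rewrite (expand_det_row _ 0) !big_ord_recl big_ord0 addr0 /cofactor !det_mx11.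
by rewrite !mxE /= expr0 expr1 mul1r mulN1r mulrN.
Qed.


(** The general quaternion as a pair of complex numbers; matrix identities between quaternions
    reduce to two complex ones. *)
Definition qm (a p : C) : 'M[C]_2 := mx2 a p (- conjc p) (conjc a).

Lemma qm_inj a p b q : qm a p = qm b q -> a = b /\ p = q.
Proof. by move=> E; split; [move/matrixP/(_ 0 0): E|move/matrixP/(_ 0 1): E]; rewrite !mx2E. Qed.

Lemma eq_qm a p b q : a = b -> p = q -> qm a p = qm b q.
Proof. by move=> -> ->. Qed.

Lemma qmM a p b q :
  qm a p *m qm b q = qm (a * b - p * conjc q) (a * q + p * conjc b).
Proof. by rewrite mx2M; apply: eq_mx2; rewrite ?conjcE; ring. Qed.

Lemma qmD a p b q : qm a p + qm b q = qm (a + b) (p + q).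
Proof. by rewrite mx2D; apply: eq_mx2; rewrite ?conjcE; ring. Qed.

Lemma qmN a p : - qm a p = qm (- a) (- p).
Proof. by rewrite mx2N; apply: eq_mx2; rewrite ?conjcE; ring. Qed.

Lemma qmB a p b q : qm a p - qm b q = qm (a - b) (p - q).
Proof. by rewrite qmN qmD. Qed.

Lemma qmZ (k : R) a p : (k%:C)%C *: qm a p = qm (k%:C%C * a) (k%:C%C * p).
Proof. by rewrite mx2Z; apply: eq_mx2; rewrite ?conjcE; ring. Qed.

Lemma qm_scalar (k : R) : (k%:C%C)%:M = qm k%:C%C 0.
Proof. by rewrite mx2_scalar; apply: eq_mx2; rewrite ?conjcE ?oppr0. Qed.

Lemma qm1 : 1%:M = qm 1 0.
Proof. exact: (qm_scalar 1). Qed.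

Lemma qm0 : 0 = qm 0 0.
Proof. by rewrite [LHS]mx2_eta; apply: eq_mx2; rewrite !mxE ?conjcE ?oppr0. Qed.

Lemma qm_det a p : \det (qm a p) = a * conjc a + p * conjc p.
Proof. by rewrite mx2_det mulrN opprK. Qed.

(** Quaternionic conjugation, and on SU(2) the inverse. *)
Definition qad X : 'M[C]_2 := (map_mx (@conjc R) X)^T.

Lemma qad_qm a p : qad (qm a p) = qm (conjc a) (- p).
Proof.
by rewrite [LHS]mx2_eta; apply: eq_mx2; rewrite !mxE /= ?conjcE ?opprK.
Qed.

Lemma qadM X Y : qad (X *m Y) = qad Y *m qad X.
Proof. by rewrite /qad map_mxM trmx_mul. Qed.

Lemma qadK X : qad (qad X) = X.
Proof. by apply/matrixP => i j; rewrite !mxE conjcK. Qed.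

Lemma qadN X : qad (- X) = - qad X.
Proof. by apply/matrixP => i j; rewrite !mxE conjcN. Qed.

Lemma qadD X Y : qad (X + Y) = qad X + qad Y.
Proof. by apply/matrixP => i j; rewrite !mxE conjcD. Qed.

Lemma qadZ (k : R) X : qad (k%:C%C *: X) = k%:C%C *: qad X.
Proof. by apply/matrixP => i j; rewrite !mxE conjcM conjc_real. Qed.

Definition unit_norm a p := a * conjc a + p * conjc p = 1.

Lemma SU2P X : SU2 X <-> exists a p, X = qm a p /\ unit_norm a p.
Proof.
split=> [[XX dX]|[a [p [-> ap]]]]; last first.
  rewrite /SU2 -/(qad _) qad_qm qmM qm_det ap qm1; split=> //.
  by apply: eq_qm; rewrite ?conjcE -?ap; ring.
rewrite (mx2_eta X); move: (X 0 0) (X 0 1) (X 1 0) (X 1 1) (mx2_eta X) => a b c d.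
move=> EX; rewrite {X}EX -/(qad _) in XX dX *; rewrite mx2_det in dX.
have YX : mx2 d (- b) (- c) a *m mx2 a b c d = 1%:M.
  by rewrite mx2M mx2_scalar; apply: eq_mx2; rewrite -?dX; ring.
have E : qad (mx2 a b c d) = mx2 d (- b) (- c) a.
  by rewrite -[LHS]mul1mx -YX -mulmxA XX mulmx1.
have Ed : conjc a = d by move/matrixP/(_ 0 0): E; rewrite !mxE.
have Ec : conjc b = - c by move/matrixP/(_ 1 0): E; rewrite !mxE.
exists a, b; split; first by rewrite /qm Ec Ed opprK.
by rewrite /unit_norm Ec Ed -dX; ring.
Qed.

Section SU2.
Variables (X : 'M[C]_2) (SX : SU2 X).

Lemma SU2_qadr : X *m qad X = 1%:M. Proof. by case: SX. Qed.

Lemma SU2_qadl : qad X *m X = 1%:M.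
Proof. exact/mulmx1C/SU2_qadr. Qed.

Lemma SU2_unitmx : X \in unitmx.
Proof. by case: SX => _; rewrite unitmxE => ->; rewrite unitr1. Qed.

Lemma SU2_invmx : invmx X = qad X.
Proof. by rewrite -[RHS](mulKmx SU2_unitmx) SU2_qadr mulmx1. Qed.

Lemma SU2_qad : SU2 (qad X).
Proof.
move/SU2P: SX => [a [p [-> ap]]]; rewrite qad_qm; apply/SU2P.
exists (conjc a), (- p); split=> //; rewrite /unit_norm -ap.
by rewrite ?conjcE; ring.
Qed.

End SU2.

Lemma SU2M X Y : SU2 X -> SU2 Y -> SU2 (X *m Y).
Proof.
move=> SX SY; split; last by case: SX => _ dX; case: SY => _ dY; rewrite det_mulmx dX dY mulr1.
by rewrite -/(qad _) qadM mulmxA -(mulmxA X) (SU2_qadr SY) mulmx1 (SU2_qadr SX).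
Qed.

Lemma SU2_qm a p : unit_norm a p -> SU2 (qm a p).
Proof. by move=> ap; apply/SU2P; exists a, p. Qed.

Definition is_quat X := exists a p, X = qm a p.

Lemma is_quat_qm a p : is_quat (qm a p). Proof. by exists a, p. Qed.

Lemma SU2_is_quat X : SU2 X -> is_quat X.
Proof. by move/SU2P => [a [p [-> _]]]; exists a, p. Qed.

Lemma is_quatM X Y : is_quat X -> is_quat Y -> is_quat (X *m Y).
Proof. by move=> [a [p ->]] [b [q ->]]; rewrite qmM; exact: is_quat_qm. Qed.

Lemma is_quatD X Y : is_quat X -> is_quat Y -> is_quat (X + Y).
Proof. by move=> [a [p ->]] [b [q ->]]; rewrite qmD; exact: is_quat_qm. Qed.

Lemma is_quatN X : is_quat X -> is_quat (- X).
Proof. by move=> [a [p ->]]; rewrite qmN; exact: is_quat_qm. Qed.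

Lemma is_quatZ (k : R) X : is_quat X -> is_quat (k%:C%C *: X).
Proof. by move=> [a [p ->]]; rewrite qmZ; exact: is_quat_qm. Qed.

Lemma is_quat_qad X : is_quat X -> is_quat (qad X).
Proof. by move=> [a [p ->]]; rewrite qad_qm; exact: is_quat_qm. Qed.

Lemma is_quat_frame A B a p : SU2 A -> SU2 B ->
  is_quat (qad A *m qm a p *m B).
Proof.
move=> SA SB; apply: is_quatM; last exact: SU2_is_quat.
by apply: is_quatM; [exact/is_quat_qad/SU2_is_quat|exact: is_quat_qm].
Qed.

Lemma quatE x : quat x = qm (x 0 (inord 3) +i* - x 0 (inord 2))%C
                            (- x 0 (inord 1) +i* - x 0 (inord 0))%C.
Proof.
rewrite /quat /qi /qj /qk mx2_scalar !mx2Z !mx2D; apply: eq_mx2;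
by apply/eqP; rewrite eq_complex /=; apply/andP; split; apply/eqP; ring.
Qed.

Definition qpoint X : point R := \row_(i < 4)
  match val i with
  | 0%N => - complex.Im (X 0 1) | 1%N => - complex.Re (X 0 1)
  | 2%N => - complex.Im (X 0 0) | _ => complex.Re (X 0 0) end.

Lemma qpointK X : is_quat X -> quat (qpoint X) = X.
Proof.
move=> [a [p ->]]; rewrite quatE !mxE /= !inordK //= !opprK.
by case: a p => ? ? [? ?].
Qed.

Lemma quatK x : qpoint (quat x) = x.
Proof.
apply/rowP => i; rewrite mxE quatE !mx2E /= !opprK.
by case: i => [[|[|[|[|//]]]] hi] /=; congr (x _ _); apply/val_inj; rewrite /= inordK.
Qed.

Lemma quat_inj : injective (@quat R).
Proof. exact: can_inj quatK. Qed.

Lemma quat_is_quat x : is_quat (quat x).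
Proof. by rewrite quatE; exact: is_quat_qm. Qed.

Lemma quatD x y : quat (x + y) = quat x + quat y.
Proof.
rewrite !quatE qmD !mxE; apply: eq_qm; apply/eqP; rewrite eq_complex /=;
by apply/andP; split; apply/eqP; ring.
Qed.

Lemma quatZ (k : R) x : quat (k *: x) = k%:C%C *: quat x.
Proof.
rewrite !quatE qmZ !mxE; apply: eq_qm; apply/eqP; rewrite eq_complex /=;
by apply/andP; split; apply/eqP; ring.
Qed.

Lemma quatN x : quat (- x) = - quat x.
Proof. by rewrite -scaleN1r quatZ rmorphN1 scaleN1r. Qed.

Lemma quatB x y : quat (x - y) = quat x - quat y.
Proof. by rewrite quatD quatN. Qed.

Lemma quat0 : quat (0 : point R) = 0.
Proof. by rewrite -(scale0r 0) quatZ scale0r. Qed.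

Lemma quat_eq0 x : (quat x == 0) = (x == 0).
Proof. by rewrite -quat0 (inj_eq quat_inj). Qed.

Lemma dot_quat x y :
  quat x *m qad (quat y) + quat y *m qad (quat x) = ((2 * dot x y)%:C%C)%:M.
Proof.
rewrite qm_scalar !quatE !qad_qm !qmM qmD dot4; apply: eq_qm; apply/eqP;
by rewrite eq_complex /=; apply/andP; split; apply/eqP; ring.
Qed.

Lemma quat_det x : \det (quat x) = (dot x x)%:C%C.
Proof.
rewrite quatE qm_det dot4; apply/eqP.
by rewrite eq_complex /=; apply/andP; split; apply/eqP; ring.
Qed.

Lemma scalar2_inj (k l : R) : ((2 * k)%:C%C)%:M = ((2 * l)%:C%C)%:M :> 'M[C]_2 -> k = l.
Proof.
by rewrite !qm_scalar => /qm_inj[] /(congr1 (@complex.Re R)) /= /mulfI -> //;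
   rewrite pnatr_eq0.
Qed.

Lemma dot_quat_eq x y (k : R) :
  quat x *m qad (quat y) + quat y *m qad (quat x) = ((2 * k)%:C%C)%:M ->
  dot x y = k.
Proof. by rewrite dot_quat => /scalar2_inj. Qed.

Lemma in_R3_qad x : qad (quat x) = - quat x -> in_R3 x.
Proof.
rewrite quatE qad_qm qmN => /qm_inj[] /(congr1 (@complex.Re R)) /= E _.
by rewrite /in_R3; move: E; lra.
Qed.

End Quaternions.

(** * Frames of nets in the sphere *)

Section Frames.
Variable R : realType.
Local Notation C := (R[i]).
Local Notation iC := (iC R).
Implicit Types (a b p q d e : C) (X Y A B U D : 'M[C]_2) (x y F N : point R).

Lemma iC2 : iC * iC = -1.
Proof. by apply/eqP; rewrite eq_complex /=; apply/andP; split; apply/eqP; ring. Qed.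

Lemma conj_iC : conjc iC = - iC.
Proof. by apply/eqP; rewrite eq_complex /= oppr0 !eqxx. Qed.

Lemma iC_neq0 : iC != 0.
Proof. by rewrite eq_complex /= oner_eq0 andbF. Qed.

Lemma qkE : qk R = qm (- iC) 0.
Proof. by apply: eq_mx2; rewrite ?conjcE ?conj_iC ?opprK ?oppr0. Qed.

Lemma real_eq0 (k : R) : (k%:C%C == 0 :> C) = (k == 0).
Proof. by rewrite eq_complex /= eqxx andbT. Qed.

Lemma eq_conj_real (a : C) : conjc a = a -> a = (complex.Re a)%:C%C.
Proof. by case: a => x y [] E; apply/eqP; rewrite eq_complex /= eqxx; apply/eqP; lra. Qed.

Lemma eq_conj_imag (a : C) : conjc a = - a -> a = iC * (complex.Im a)%:C%C.
Proof.
case: a => x y [] E; apply/eqP; rewrite eq_complex /=.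
by apply/andP; split; apply/eqP; lra.
Qed.

Lemma normc2 (a : C) : a * conjc a = (complex.Re (a * conjc a))%:C%C.
Proof. by apply: eq_conj_real; rewrite !conjcE mulrC. Qed.

(** The squared modulus as an element of [R]; the norm of [R[i]] takes its values in [R[i]]. *)
Definition sqn (a : C) : R := complex.Re (a * conjc a).

Lemma sqnE a : (sqn a)%:C%C = a * conjc a. Proof. by rewrite -normc2. Qed.

Lemma sqn_ge0 a : 0 <= sqn a.
Proof. by case: a => x y; rewrite /sqn /= mulrN opprK addr_ge0 // -expr2 sqr_ge0. Qed.

Lemma sqn_eq0 a : (sqn a == 0) = (a == 0).
Proof. by rewrite -real_eq0 sqnE mulf_eq0 conjc_eq0 orbb. Qed.

Lemma sqn_gt0 a : a != 0 -> 0 < sqn a.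
Proof. by move=> a0; rewrite lt_neqAle sqn_ge0 eq_sym sqn_eq0 a0. Qed.

Lemma dot_frame A B x y a p b q : SU2 A -> SU2 B ->
  quat x = qad A *m qm a p *m B -> quat y = qad A *m qm b q *m B ->
  dot x y = complex.Re (a * conjc b + p * conjc q).
Proof.
move=> SA SB Ex Ey; apply: dot_quat_eq.
have K X Y : qad A *m X *m B *m qad (qad A *m Y *m B) = qad A *m (X *m qad Y) *m A.
  rewrite !qadM qadK !mulmxA -(mulmxA _ B) (SU2_qadr SB) mulmx1.
  by [].
rewrite Ex Ey !K -mulmxDl -mulmxDr !qad_qm !qmM qmD !conjcE.
set c := _ + _ * conjc q; set X := qm _ _.
have -> : X = ((2 * complex.Re c)%:C%C)%:M.
  rewrite qm_scalar /X; apply: eq_qm; last by rewrite ?conjcE; ring.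
  have -> : (2 * complex.Re c)%:C%C = c + conjc c :> C.
    by rewrite addcJ rcM rc_nat.
  by rewrite /c !conjcE; ring.
by rewrite mul_mx_scalar -scalemxAl (SU2_qadl SA) scalemx1.
Qed.

(** An increment along an edge is governed by [D *m U' - U *m D] alone, so equations between
    increments turn into equations between entries of the transition matrices. *)
Lemma frame_diff A B U U' D : SU2 U ->
  qad (U *m A) *m D *m (U' *m B) - qad A *m D *m B
  = qad (U *m A) *m (D *m U' - U *m D) *m B.
Proof.
move=> SU; rewrite mulmxBr mulmxBl !mulmxA; congr (_ - _).
by rewrite qadM -!mulmxA (mulmxA (qad U)) (SU2_qadl SU) mul1mx.
Qed.

(** With J = [qm iC 0] and J^2 = X^2 = -1, the quaternion 1 - J X satisfies J (1 - J X) = J + X = (1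
    - J X) X, and its squared norm is 2 + 2t. It vanishes only for X = -J, where [qm 0 1] does the
    job. *)
Lemma unit_rotation X : SU2 X -> qad X = - X ->
  exists A, SU2 A /\ qad A *m qm iC 0 *m A = X.
Proof.
move=> /SU2P[b [p [-> bp]]]; rewrite qad_qm qmN => /qm_inj[Eb _].
have [t bt] : exists t : R, b = iC * t%:C%C.
  by exists (complex.Im b); exact: eq_conj_imag.
have tp : t ^+ 2 + sqn p = 1.
  have : ((t ^+ 2 + sqn p)%:C%C : C) = 1.
    rewrite rcD rcX sqnE -bp bt !conjcE conj_iC.
    transitivity (- (iC * iC) * t%:C%C ^+ 2 + p * conjc p); last by ring.
    by rewrite iC2 opprK mul1r.
  by move/(congr1 (@complex.Re R)).
suff [A [SA EA]] : exists A, SU2 A /\ qm iC 0 *m A = A *m qm b p.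
  by exists A; split=> //; rewrite -mulmxA EA mulmxA (SU2_qadl SA) mul1mx.
have [t1|t1] := eqVneq (1 + t) 0.
  have t1' : t = -1 by move: t1; lra.
  have p0 : p = 0.
    by apply/eqP; rewrite -sqn_eq0; apply/eqP; move: tp; rewrite t1'; lra.
  exists (qm 0 1); split.
    by apply: SU2_qm; rewrite /unit_norm !conjcE; ring.
  rewrite !qmM bt p0 t1' rmorphN1; apply: eq_qm; rewrite !conjcE ?conj_iC; ring.
have tp2 : (1 + t) ^+ 2 + sqn p = 2 + 2 * t.
  by transitivity (1 + 2 * t + (t ^+ 2 + sqn p)); [|rewrite tp]; ring.
have t0 : 0 < 2 + 2 * t.
  have := sqn_ge0 p; have : 0 <= (1 + t) ^+ 2 by exact: sqr_ge0.
  by rewrite -tp2 => h1 h2; rewrite lt_neqAle; apply/andP; split;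
    [apply: contraNneq t1; rewrite tp2 => t2; apply/eqP; lra|lra].
pose sg := Num.sqrt (2 + 2 * t); have sg0 : sg != 0 by rewrite gt_eqF // sqrtr_gt0.
have sg2 : sg * sg = 2 + 2 * t by rewrite -expr2 sqr_sqrtr // ltW.
exists ((sg^-1)%:C%C *: qm (1 + t)%:C%C (- iC * p)); split.
  rewrite qmZ; apply: SU2_qm; rewrite /unit_norm !conjcE conj_iC.
  transitivity ((sg^-1 * sg^-1 * ((1 + t) ^+ 2 + sqn p))%:C%C : C).
    rewrite [RHS]rcM [X in _ = _ * X]rcD rcX sqnE rcM.
    transitivity ((sg^-1)%:C%C * (sg^-1)%:C%C * ((1 + t)%:C%C ^+ 2
      + (- (iC * iC)) * (p * conjc p)) : C); first by ring.
    by rewrite iC2 opprK mul1r.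
  have -> : (1 + t) ^+ 2 + sqn p = sg * sg by rewrite sg2 tp2.
  by rewrite [X in (X%:C)%C](_ : _ = 1) //; field.
rewrite -scalemxAr -scalemxAl; congr (_ *: _); rewrite !qmM; apply: eq_qm.
  have E : p * conjc p = 1 - t%:C%C ^+ 2.
    by rewrite -sqnE -[1]/(1%:C)%C -tp rcD rcX; ring.
  transitivity (iC * (1 + t%:C%C)); first by rewrite rcD rc1; ring.
  transitivity (iC * (1 + t%:C%C) * t%:C%C + iC * (p * conjc p)); last first.
    by rewrite bt rcD rc1; ring.
  by rewrite E; ring.
rewrite bt !conjcE conj_iC rcD rc1.
transitivity (- (iC * iC) * p); first by ring.
transitivity ((1 + t%:C%C) * p + iC * iC * p * t%:C%C); last by ring.
by rewrite iC2; ring.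
Qed.

Section SphereFrame.
Variables (z : C) (H k : R).
Hypotheses (z1 : z * conjc z = 1) (z2 : z * z = H%:C%C + iC * k%:C%C).
Hypothesis k0 : k != 0.

(** Here [k] is a square root of the curvature, and [iC * conjc z] is the first entry of -k M for M
    = diag(z^*, z). *)
Definition sphere_frame A B F N :=
  quat F = qad A *m qm ((k^-1)%:C%C * conjc z) 0 *m B /\
  quat N = qad A *m qm (iC * conjc z) 0 *m B.

Definition weight (c : R) : C := c%:C%C * conjc z - z.

Lemma conj_weight c : conjc (weight c) = c%:C%C * z - conjc z.
Proof. by rewrite /weight !conjcE. Qed.

Let zb2 : conjc z * conjc z = H%:C%C - iC * k%:C%C.
Proof. by rewrite -conjcM z2 !conjcE conj_iC mulNr. Qed.

Lemma weight_norm c : weight c * conjc (weight c) = (c ^+ 2 + 1 - 2 * c * H)%:C%C.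
Proof.
rewrite conj_weight /weight.
transitivity (c%:C%C ^+ 2 * (z * conjc z) + z * conjc z - c%:C%C * (z * z)
   - c%:C%C * (conjc z * conjc z)); first by ring.
by rewrite z1 z2 zb2 !(rcB, rcE); ring.
Qed.

Lemma weight_neq0 c : weight c != 0.
Proof.
apply/eqP => w0; have : z * weight c = 0 by rewrite w0 mulr0.
have -> : z * weight c = c%:C%C * (z * conjc z) - z * z by rewrite /weight; ring.
rewrite z1 z2 => /(congr1 (@complex.Im R)) /=; rewrite !(mul0r, mulr0, mul1r, addr0, add0r).
by move=> E; case/eqP: k0; move: E; lra.
Qed.

Lemma frame_norms A B F N : SU2 A -> SU2 B -> sphere_frame A B F N ->
  [/\ dot F F = (k ^+ 2)^-1, dot N N = 1 & dot F N = 0].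
Proof.
move=> SA SB [EF EN]; rewrite (dot_frame SA SB EF EF) (dot_frame SA SB EN EN).
rewrite (dot_frame SA SB EF EN) !conjcE conj_iC ?mulr0 ?mul0r ?addr0.
have K (u v : C) : u * conjc z * (v * z) = u * v.
  by transitivity (u * v * (z * conjc z)); [ring|rewrite z1 mulr1].
rewrite !K mulrN iC2 opprK; split=> //=; [by field|by ring].
Qed.

Section Edge.
Variables (A B U U' : 'M[C]_2) (F N F' N' : point R) (a p : C) (c : R).
Hypotheses (SA : SU2 A) (SB : SU2 B) (SU : SU2 U) (SU' : SU2 U').
Hypotheses (FN : sphere_frame A B F N)
  (FN' : sphere_frame (U *m A) (U' *m B) F' N').
Hypotheses (UE : U = qm a (p * weight c)) (UE' : U' = qm a (p * conjc (weight c))).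

(** The factor 1/k of F cancels against z^2 - z^{*2} = 2ik. Hence the middle matrix involves neither
    c nor k, and it still makes sense in the Euclidean limit k = 0. *)
Lemma sphere_edge : quat (F' - F) = qad (U *m A) *m qm 0 (2 * iC * p) *m B.
Proof.
have [EF _] := FN; have [EF' _] := FN'.
rewrite quatB EF EF' (frame_diff _ _ _ _ SU); congr (_ *m _ *m _).
rewrite UE UE' !qmM qmB; apply: eq_qm; rewrite /weight ?conjcE.
  by ring.
transitivity ((k^-1)%:C%C * p * (z * z - conjc z * conjc z)); first by ring.
rewrite z2 zb2; transitivity ((k^-1 * k)%:C%C * (2 * iC * p)).
  by rewrite rcM; ring.
by rewrite mulVf // mul1r.
Qed.

Lemma sphere_edge_normal : N' - N = (c - H) *: (F' - F).
Proof.
apply: quat_inj; rewrite quatZ sphere_edge.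
have [_ EN] := FN; have [_ EN'] := FN'.
rewrite quatB EN EN' (frame_diff _ _ _ _ SU) scalemxAl scalemxAr; congr (_ *m _ *m _).
rewrite UE UE' !qmM qmB qmZ; apply: eq_qm; rewrite /weight ?conjcE ?conj_iC.
  by ring.
transitivity (iC * p * (2 * c%:C%C * (z * conjc z) - z * z - conjc z * conjc z)).
  by ring.
by rewrite z1 z2 zb2 rcB; ring.
Qed.

Lemma sphere_edge_length : dot (F' - F) (F' - F) = 4 * sqn p.
Proof.
have SUA := SU2M SU SA.
rewrite (dot_frame SUA SB sphere_edge sphere_edge) mul0r add0r.
have -> : 2 * iC * p * conjc (2 * iC * p) = (4 * sqn p)%:C%C; last by [].
rewrite !conjcE conj_iC rcM rc_nat sqnE.
transitivity (4 * (- (iC * iC)) * (p * conjc p)); first by ring.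
by rewrite iC2; ring.
Qed.

Lemma sphere_edge_neq : p != 0 -> F' != F.
Proof.
by move=> p0; rewrite -subr_eq0 -dot_eq0 sphere_edge_length mulf_neq0 ?sqn_eq0
  ?pnatr_eq0.
Qed.

End Edge.

(** The edge equation says that N - (c - H) F takes the same value at both ends. In the frame this
    combination is the diagonal quaternion D with entry -[weight c]/k, so D U' = U D. Comparing
    entries, the diagonals of U and U' agree and the off-diagonal entries are in the ratio of
    [weight c] to its conjugate. *)
Lemma sphere_edge_lax A B A' B' F N F' N' c :
  SU2 A -> SU2 B -> SU2 A' -> SU2 B' ->
  sphere_frame A B F N -> sphere_frame A' B' F' N' ->
  N' - N = (c - H) *: (F' - F) ->
  exists a p, [/\ A' = qm a (p * weight c) *m A,
    B' = qm a (p * conjc (weight c)) *m B,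
    SU2 (qm a (p * weight c)) & SU2 (qm a (p * conjc (weight c)))].
Proof.
move=> SA SB SA' SB' [EF EN] [EF' EN'] E.
have SU := SU2M SA' (SU2_qad SA); have SU' := SU2M SB' (SU2_qad SB).
have EA : A' = A' *m qad A *m A by rewrite -mulmxA (SU2_qadl SA) mulmx1.
have EB : B' = B' *m qad B *m B by rewrite -mulmxA (SU2_qadl SB) mulmx1.
move: EA EB SU SU'; set U := A' *m qad A; set U' := B' *m qad B.
move=> EA EB SU SU'; have w0 := weight_neq0 c.
have kw : iC * conjc z - (c - H)%:C%C * ((k^-1)%:C%C * conjc z)
    = - (k^-1)%:C%C * weight c.
  have kk : iC = (k^-1)%:C%C * (iC * k%:C%C).
    transitivity ((k^-1 * k)%:C%C * iC); last by rewrite rcM; ring.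
    by rewrite mulVf // mul1r.
  rewrite {1}kk /weight rcB.
  transitivity ((k^-1)%:C%C * (conjc z * (H%:C%C + iC * k%:C%C) - c%:C%C * conjc z)).
    by ring.
  rewrite -z2; transitivity ((k^-1)%:C%C * (z * (z * conjc z) - c%:C%C * conjc z)).
    by ring.
  by rewrite z1; ring.
pose D := qm (- (k^-1)%:C%C * weight c) 0.
have DE (X Y : 'M[C]_2) x y : quat x = qad X *m qm ((k^-1)%:C%C * conjc z) 0 *m Y ->
    quat y = qad X *m qm (iC * conjc z) 0 *m Y ->
    quat (y - (c - H) *: x) = qad X *m D *m Y.
  move=> Ex Ey; rewrite quatB quatZ Ex Ey scalemxAl scalemxAr -mulmxBl -mulmxBr.
  by congr (_ *m _ *m _); rewrite qmZ qmB kw mulr0 subr0.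
have {E} E : N' - (c - H) *: F' = N - (c - H) *: F.
  apply/eqP; rewrite -subr_eq0 opprB addrACA addrC [- _ + _]addrC addrACA.
  rewrite -[X in X == 0](_ : (N' - N) - (c - H) *: (F' - F) = _).
    by rewrite E subrr.
  by apply/rowP => i; rewrite !mxE; ring.
have := congr1 (@quat R) E; rewrite (DE _ _ _ _ EF EN) (DE _ _ _ _ EF' EN').
rewrite {1}EA {1}EB => /eqP; rewrite -subr_eq0 frame_diff // -EA => /eqP Z.
have {Z} : D *m U' - U *m D = 0.
  have := congr1 (fun X => A' *m X *m qad B) Z.
  rewrite mulmx0 mul0mx !mulmxA (SU2_qadr SA') mul1mx -mulmxA (SU2_qadr SB).
  by rewrite mulmx1.
move: EA EB SU SU' => EA EB /[dup] SU /SU2P[a [p [UE _]]] /[dup] SU' /SU2P[b [q [UE' _]]].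
rewrite UE UE' !qmM qmB qm0 => /qm_inj[Ea Ep].
have kw0 : - (k^-1)%:C%C * weight c != 0.
  by rewrite mulf_neq0 // oppr_eq0 real_eq0 invr_eq0.
have ab : a = b.
  apply: (mulfI kw0); apply/esym/eqP; rewrite -subr_eq0; apply/eqP.
  by rewrite -[RHS]Ea !conjcE; ring.
have pq : p * conjc (weight c) = weight c * q.
  have : (k^-1)%:C%C != 0 :> C by rewrite real_eq0 invr_eq0.
  move/mulfI; apply; apply/eqP; rewrite -subr_eq0; apply/eqP.
  by rewrite -[RHS]Ep !conjcE; ring.
exists a, (p / weight c).
have -> : p / weight c * weight c = p by field.
have -> : p / weight c * conjc (weight c) = q by rewrite mulrAC pq; field.
by split; rewrite -?UE // ab -UE'.
Qed.

(** Since F and N are orthogonal, N (kF)^{-1} is a unit imaginary quaternion. A rotates the axis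
    [qm iC 0] to it, and B is then determined by the equation for F. *)
Lemma sphere_frame_exists F N :
  dot F F = (k ^+ 2)^-1 -> dot N N = 1 -> dot F N = 0 ->
  exists A B, [/\ SU2 A, SU2 B & sphere_frame A B F N].
Proof.
move=> dF dN dFN.
have unit_SU2 x : dot x x = 1 -> SU2 (quat x).
  move=> x1; split; last by rewrite quat_det x1.
  have := dot_quat x x; rewrite x1 -/(qad _) -mulr2n mulr1 -scaler_nat.
  move=> /(congr1 (fun X => (2^-1 : C) *: X)).
  rewrite scalerA mulVf ?pnatr_eq0 // scale1r => ->.
  by rewrite rc_nat scale_scalar_mx mulVf // pnatr_eq0.
have SN := unit_SU2 _ dN.
have Sf : SU2 (quat (k *: F)) by apply: unit_SU2; rewrite !dotE dF; field.
have EN : qad (quat N *m qad (quat (k *: F))) = - (quat N *m qad (quat (k *: F))).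
  rewrite qadM qadK; apply/eqP; rewrite -addr_eq0 dot_quat dotZl dFN mulr0 mulr0.
  by rewrite (_ : 0%:C%C = 0) // raddf0.
have [A [SA EA]] := unit_rotation (SU2M SN (SU2_qad Sf)) EN.
have Sz : SU2 (qm z 0) by apply: SU2_qm; rewrite /unit_norm mul0r addr0.
exists A, (qm z 0 *m A *m quat (k *: F)); split=> //.
  by apply: SU2M => //; apply: SU2M.
have K (u : C) : qm (u * conjc z) 0 *m qm z 0 = qm u 0.
  rewrite qmM; apply: eq_qm; rewrite ?conjcE; last by ring.
  by transitivity (u * (z * conjc z)); [ring|rewrite z1 mulr1].
split; rewrite !mulmxA -(mulmxA (qad A)) K.
  rewrite -(qm_scalar k^-1) mul_mx_scalar -scalemxAl.
  by rewrite (SU2_qadl SA) -scalemxAl mul1mx quatZ scalerA -rcM mulVf // scale1r.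
by rewrite EA -mulmxA (SU2_qadl Sf) mulmx1.
Qed.

End SphereFrame.
End Frames.

(** * Edge matrices and their flatness for every spectral parameter *)

Section LaxSystems.
Variable R : realType.
Local Notation C := (R[i]).
Local Notation iC := (iC R).
Implicit Types (phi : int -> int -> R) (a p b q : int -> int -> C).

Lemma SU2_section (X0 : 'M[C]_2) (U V : int -> int -> 'M[C]_2) :
  SU2 X0 -> (forall m n, SU2 (U m n)) -> (forall m n, SU2 (V m n)) ->
  (forall m n, V (m + 1) n *m U m n = U m (n + 1) *m V m n) ->
  exists Phi : int -> int -> 'M[C]_2,
    [/\ Phi 0 0 = X0, forall m n, SU2 (Phi m n),
        forall m n, Phi (m + 1) n = U m n *m Phi m n
      & forall m n, Phi m (n + 1) = V m n *m Phi m n].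
Proof.
move=> SX SU SV flat.
have K (X Y : 'M[C]_2) : SU2 X -> qad X *m (X *m Y) = Y.
  by move=> S; rewrite mulmxA (SU2_qadl S) mul1mx.
have K' (X Y : 'M[C]_2) : SU2 X -> X *m (qad X *m Y) = Y.
  by move=> S; rewrite mulmxA (SU2_qadr S) mul1mx.
have [f [f0 f1 f2]] := @flat_section _ X0 (fun m n => mulmx (U m n))
  (fun m n => mulmx (qad (U m n))) (fun m n => mulmx (V m n))
  (fun m n => mulmx (qad (V m n))) (fun m n X => K _ X (SU m n))
  (fun m n X => K' _ X (SU m n)) (fun m n X => K _ X (SV m n))
  (fun m n X => K' _ X (SV m n))
  (fun m n X => etrans (mulmxA _ _ _) (etrans (congr1 (mulmx^~ X) (flat m n))
     (esym (mulmxA _ _ _)))).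
exists f; split=> //; apply: int2_ind => [|m n|m n]; first by rewrite f0.
- rewrite f1; split=> [|S]; first exact: SU2M.
  by rewrite -[f m n](K (U m n)) //; apply: SU2M => //; exact: SU2_qad.
- rewrite f2; split=> [|S]; first exact: SU2M.
  by rewrite -[f m n](K (V m n)) //; apply: SU2M => //; exact: SU2_qad.
Qed.

Lemma unit_sqrt (x y : R) : x ^+ 2 + y ^+ 2 = 1 ->
  exists z : C, z * conjc z = 1 /\ z * z = x%:C%C + iC * y%:C%C.
Proof.
move=> xy; pose z : C := sqrtc (x%:C%C + iC * y%:C%C).
have zz : z * z = x%:C%C + iC * y%:C%C by rewrite -expr2 sqr_sqrtc.
exists z; split=> //; rewrite -sqnE.
have : sqn z ^+ 2 = 1.
  have : ((sqn z ^+ 2)%:C%C : C) = 1.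
    rewrite rcX sqnE exprMn (expr2 z) (expr2 (conjc z)) -conjcM zz !conjcE conj_iC.
    transitivity (x%:C%C ^+ 2 - iC * iC * y%:C%C ^+ 2); first by ring.
    by rewrite iC2 mulN1r opprK -!rcX -rcD xy.
  by move/(congr1 (@complex.Re R)).
by move/eqP; rewrite sqrf_eq1 => /orP[/eqP->//|/eqP E]; have := sqn_ge0 z;
   rewrite E ler0N1.
Qed.

(** The determinant of [lax_edge z a p c] for a unit z with Re z^2 = x; it is affine in x. *)
Definition edge_norm (a p : C) (c x : R) : R :=
  sqn a + sqn p * (c ^+ 2 + 1 - 2 * c * x).

Definition lax_edge (z : C) (a p : C) (c : R) : 'M[C]_2 := qm a (p * weight z c).

Lemma edge_normE (z a p : C) (c x y : R) :
  z * conjc z = 1 -> z * z = x%:C%C + iC * y%:C%C ->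
  a * conjc a + p * weight z c * conjc (p * weight z c) = (edge_norm a p c x)%:C%C.
Proof.
move=> z1 z2; rewrite conjcM.
transitivity (a * conjc a + p * conjc p * (weight z c * conjc (weight z c))).
  by ring.
by rewrite (weight_norm z1 z2) -!sqnE -rcM -rcD.
Qed.

Lemma edge_norm_gt0 (a p : C) (c x : R) : p != 0 -> x ^+ 2 < 1 ->
  0 < edge_norm a p c x.
Proof.
move=> p0 x1; apply: ltr_wpDl; first exact: sqn_ge0.
apply: mulr_gt0; first exact: sqn_gt0.
have -> : c ^+ 2 + 1 - 2 * c * x = (c - x) ^+ 2 + (1 - x ^+ 2) by ring.
by apply: ltr_wpDl; [exact: sqr_ge0|rewrite subr_gt0].
Qed.

(* The part of the Lax representation that does not involve the spectral
   parameter: [edge_norm] is a determinant, whose coefficients as a polynomial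
   in [x] are the last four equations. *)
Record lax_system phi a p b q : Prop := LaxSystem {
  lax_p : forall m n, p m n != 0;
  lax_q : forall m n, q m n != 0;
  lax_cross : forall m n,
    q (m + 1) n * conjc (p m n) * (phi (m + 1) n)%:C%C
    = p m (n + 1) * conjc (q m n) * (phi m (n + 1))%:C%C;
  lax_diag : forall m n,
    b (m + 1) n * a m n - a m (n + 1) * b m n
    = q (m + 1) n * conjc (p m n) *
        (phi (m + 1) n ^+ 2 * phi m n * phi (m + 1) (n + 1) + 1)%:C%C
      - p m (n + 1) * conjc (q m n) *
        (phi m (n + 1) ^+ 2 * phi m n * phi (m + 1) (n + 1) + 1)%:C%C;
  lax_off1 : forall m n,
    b (m + 1) n * p m n + q (m + 1) n * conjc (a m n)
    = a m (n + 1) * q m n + p m (n + 1) * conjc (b m n);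
  lax_off2 : forall m n,
    b (m + 1) n * p m n * (phi m n * phi (m + 1) n)%:C%C
      + q (m + 1) n * conjc (a m n) * (phi (m + 1) n * phi (m + 1) (n + 1))%:C%C
    = a m (n + 1) * q m n * (phi m n * phi m (n + 1))%:C%C
      + p m (n + 1) * conjc (b m n) * (phi m (n + 1) * phi (m + 1) (n + 1))%:C%C;
  lax_label_p : forall m n,
    phi m n * phi (m + 1) n * sqn (p m n)
    = phi m (n + 1) * phi (m + 1) (n + 1) * sqn (p m (n + 1));
  lax_label_q : forall m n,
    phi m n * phi m (n + 1) * sqn (q m n)
    = phi (m + 1) n * phi (m + 1) (n + 1) * sqn (q (m + 1) n);
  lax_norm_p : forall m n,
    edge_norm (a m n) (p m n) (phi m n * phi (m + 1) n) 0
    = edge_norm (a m (n + 1)) (p m (n + 1))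
        (phi m (n + 1) * phi (m + 1) (n + 1)) 0;
  lax_norm_q : forall m n,
    edge_norm (b m n) (q m n) (phi m n * phi m (n + 1)) 0
    = edge_norm (b (m + 1) n) (q (m + 1) n)
        (phi (m + 1) n * phi (m + 1) (n + 1)) 0 }.

Section Flatness.
Variables (phi : int -> int -> R) (a p b q : int -> int -> C).
Hypothesis L : lax_system phi a p b q.

Lemma lax_flat (z : C) m n : z * conjc z = 1 ->
  lax_edge z (b (m + 1) n) (q (m + 1) n) (phi (m + 1) n * phi (m + 1) (n + 1))
    *m lax_edge z (a m n) (p m n) (phi m n * phi (m + 1) n)
  = lax_edge z (a m (n + 1)) (p m (n + 1)) (phi m (n + 1) * phi (m + 1) (n + 1))
    *m lax_edge z (b m n) (q m n) (phi m n * phi m (n + 1)).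
Proof.
move=> z1; have L1 := lax_cross L m n; have L2 := lax_diag L m n.
have L3 := lax_off1 L m n; have L4 := lax_off2 L m n.
rewrite /lax_edge !qmM /weight; apply: eq_qm; rewrite ?conjcE; last first.
  apply/eqP; rewrite -subr_eq0; apply/eqP.
  transitivity (conjc z * (b (m + 1) n * p m n * (phi m n * phi (m + 1) n)%:C%C
    + q (m + 1) n * conjc (a m n) * (phi (m + 1) n * phi (m + 1) (n + 1))%:C%C)
    - z * (b (m + 1) n * p m n + q (m + 1) n * conjc (a m n))
    - (conjc z * (a m (n + 1) * q m n * (phi m n * phi m (n + 1))%:C%C
      + p m (n + 1) * conjc (b m n) * (phi m (n + 1) * phi (m + 1) (n + 1))%:C%C)
    - z * (a m (n + 1) * q m n + p m (n + 1) * conjc (b m n)))); first by ring.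
  by rewrite L3 L4 subrr.
apply/eqP; rewrite -subr_eq0; apply/eqP.
(* The z^2 and z^{*2} terms of the diagonal entry carry the same factor, the cross relation; what
   remains is [lax_diag] once z z^* = 1. *)
pose y : C := (phi (m + 1) (n + 1))%:C%C * (conjc z * conjc z) + (phi m n)%:C%C * (z * z).
transitivity ((b (m + 1) n * a m n - a m (n + 1) * b m n)
  - (q (m + 1) n * conjc (p m n) *
        ((phi (m + 1) n ^+ 2 * phi m n * phi (m + 1) (n + 1))%:C%C * (z * conjc z) + z * conjc z)
      - p m (n + 1) * conjc (q m n) *
        ((phi m (n + 1) ^+ 2 * phi m n * phi (m + 1) (n + 1))%:C%C * (z * conjc z) + z * conjc z))
  + y * (q (m + 1) n * conjc (p m n) * (phi (m + 1) n)%:C%C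
         - p m (n + 1) * conjc (q m n) * (phi m (n + 1))%:C%C)).
  by rewrite /y !rcE; ring.
by rewrite L1 subrr mulr0 addr0 L2 z1 !mulr1 !rcD !rc1 subrr.
Qed.

(** An affine function of x is fixed by its value at 0 and its slope; the slopes are the labels phi
    phi_i |p|^2 up to the factor -2. *)
Lemma lax_norm (x : R) m n :
  edge_norm (a m (n + 1)) (p m (n + 1)) (phi m (n + 1) * phi (m + 1) (n + 1)) x
  = edge_norm (a m n) (p m n) (phi m n * phi (m + 1) n) x /\
  edge_norm (b (m + 1) n) (q (m + 1) n) (phi (m + 1) n * phi (m + 1) (n + 1)) x
  = edge_norm (b m n) (q m n) (phi m n * phi m (n + 1)) x.
Proof.
have K u v c : edge_norm u v c x = edge_norm u v c 0 - 2 * x * (c * sqn v).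
  by rewrite /edge_norm; ring.
by rewrite !K (lax_norm_p L m n) (lax_norm_q L m n) (lax_label_p L m n)
  (lax_label_q L m n).
Qed.

End Flatness.

Section LaxOfFrame.
Variables (z : C) (H k : R).
Hypotheses (z1 : z * conjc z = 1) (z2 : z * z = H%:C%C + iC * k%:C%C).
Hypothesis k0 : k != 0.
Variables (phi : int -> int -> R) (F N : net R) (A B : int -> int -> 'M[C]_2).
Hypotheses (SA : forall m n, SU2 (A m n)) (SB : forall m n, SU2 (B m n)).
Hypothesis AB : forall m n, sphere_frame z k (A m n) (B m n) (F m n) (N m n).
Hypotheses (FN : edge_eq H phi F N) (gen : generic phi) (F0 : edges_neq0 F).

Let zb2 : conjc z * conjc z = H%:C%C - iC * k%:C%C.
Proof. by rewrite -conjcM z2 !conjcE conj_iC mulNr. Qed.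

Let dz : z * z - conjc z * conjc z != 0.
Proof.
rewrite z2 zb2 opprB addrCA addrAC subrr add0r.
rewrite -[X in X != 0](_ : 2 * (iC * k%:C%C) = _); last by ring.
by rewrite !mulf_neq0 ?iC_neq0 ?real_eq0 // pnatr_eq0.
Qed.

(** The frames A and B give flatness at z and at z^*. Because z^2 - z^{*2} = 2ik is nonzero, these
    two instances separate the Laurent coefficients. The labels are the geometric ones of
    [face_label], as squared edge lengths are 4 |p|^2. *)
Lemma lax_system_exists : exists a p b q, [/\ lax_system phi a p b q,
  forall m n, let c := phi m n * phi (m + 1) n in
    [/\ A (m + 1) n = lax_edge z (a m n) (p m n) c *m A m n,
        B (m + 1) n = lax_edge (conjc z) (a m n) (p m n) c *m B m n
      & edge_norm (a m n) (p m n) c H = 1]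
  & forall m n, let c := phi m n * phi m (n + 1) in
    [/\ A m (n + 1) = lax_edge z (b m n) (q m n) c *m A m n,
        B m (n + 1) = lax_edge (conjc z) (b m n) (q m n) c *m B m n
      & edge_norm (b m n) (q m n) c H = 1]].
Proof.
have W c : weight (conjc z) c = conjc (weight z c).
  by rewrite conj_weight /weight conjcK.
have edge m n m' n' c : F m' n' != F m n ->
    N m' n' - N m n = (c - H) *: (F m' n' - F m n) ->
    exists ap : C * C, [/\ A m' n' = lax_edge z ap.1 ap.2 c *m A m n,
      B m' n' = lax_edge (conjc z) ap.1 ap.2 c *m B m n, ap.2 != 0,
      edge_norm ap.1 ap.2 c H = 1
    & dot (F m' n' - F m n) (F m' n' - F m n) = 4 * sqn ap.2].
  move=> FF E.
  have [u [v [EA EB SU SU']]] := sphere_edge_lax z1 z2 k0 (SA m n) (SB m n)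
    (SA m' n') (SB m' n') (AB m n) (AB m' n') E.
  have AB' := AB m' n'; rewrite EA EB in AB'.
  have EL := sphere_edge_length z2 k0 (SA m n) (SB m n) SU (AB m n) AB'
    erefl erefl.
  exists (u, v); split=> //=; rewrite /lax_edge ?W //.
    apply/eqP => v0; case/eqP: FF; apply/eqP; rewrite -subr_eq0 -dot_eq0 EL v0.
    by rewrite mulf_eq0 sqn_eq0 eqxx orbT.
  by case: SU => _; rewrite qm_det (edge_normE _ _ _ z1 z2) => /(congr1 (@complex.Re R)).
have /choice[ap apP] : forall mn : int * int, exists ap : C * C,
    let: (m, n) := mn in let c := phi m n * phi (m + 1) n in
    [/\ A (m + 1) n = lax_edge z ap.1 ap.2 c *m A m n,
      B (m + 1) n = lax_edge (conjc z) ap.1 ap.2 c *m B m n, ap.2 != 0,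
      edge_norm ap.1 ap.2 c H = 1
    & dot (F (m + 1) n - F m n) (F (m + 1) n - F m n) = 4 * sqn ap.2].
  by move=> [m n]; apply: edge; [case: (F0 m n)|case: (FN m n)].
have /choice[bq bqP] : forall mn : int * int, exists bq : C * C,
    let: (m, n) := mn in let c := phi m n * phi m (n + 1) in
    [/\ A m (n + 1) = lax_edge z bq.1 bq.2 c *m A m n,
      B m (n + 1) = lax_edge (conjc z) bq.1 bq.2 c *m B m n, bq.2 != 0,
      edge_norm bq.1 bq.2 c H = 1
    & dot (F m (n + 1) - F m n) (F m (n + 1) - F m n) = 4 * sqn bq.2].
  by move=> [m n]; apply: edge; [case: (F0 m n)|case: (FN m n)].
exists (fun m n => (ap (m, n)).1), (fun m n => (ap (m, n)).2).
exists (fun m n => (bq (m, n)).1), (fun m n => (bq (m, n)).2).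
split=> [|m n|m n]; [|by have [] := apP (m, n)|by have [] := bqP (m, n)].
have lab_p m n : phi m n * phi (m + 1) n * sqn (ap (m, n)).2
    = phi m (n + 1) * phi (m + 1) (n + 1) * sqn (ap (m, n + 1)).2.
  have [lab _] := face_label FN gen m n (fun m n => let: And3 e _ _ :=
    frame_norms z1 k0 (SA m n) (SB m n) (AB m n) in e).
  have [_ _ _ _ d1] := apP (m, n); have [_ _ _ _ d2] := apP (m, n + 1).
  by rewrite d1 d2 in lab; move: lab; lra.
have lab_q m n : phi m n * phi m (n + 1) * sqn (bq (m, n)).2
    = phi (m + 1) n * phi (m + 1) (n + 1) * sqn (bq (m + 1, n)).2.
  have [_ lab] := face_label FN gen m n (fun m n => let: And3 e _ _ :=
    frame_norms z1 k0 (SA m n) (SB m n) (AB m n) in e).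
  have [_ _ _ _ d1] := bqP (m, n); have [_ _ _ _ d2] := bqP (m + 1, n).
  by rewrite d1 d2 in lab; move: lab; lra.
have flat m n (y : C) (X : int -> int -> 'M[C]_2) :
   (forall m n, SU2 (X m n)) ->
   (forall m n, X (m + 1) n = lax_edge y (ap (m, n)).1 (ap (m, n)).2
      (phi m n * phi (m + 1) n) *m X m n) ->
   (forall m n, X m (n + 1) = lax_edge y (bq (m, n)).1 (bq (m, n)).2
      (phi m n * phi m (n + 1)) *m X m n) ->
   lax_edge y (bq (m + 1, n)).1 (bq (m + 1, n)).2 (phi (m + 1) n * phi (m + 1) (n + 1))
    *m lax_edge y (ap (m, n)).1 (ap (m, n)).2 (phi m n * phi (m + 1) n)
  = lax_edge y (ap (m, n + 1)).1 (ap (m, n + 1)).2 (phi m (n + 1) * phi (m + 1) (n + 1))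
    *m lax_edge y (bq (m, n)).1 (bq (m, n)).2 (phi m n * phi m (n + 1)).
  move=> SX X1 X2; have := X2 (m + 1) n; rewrite X1 (X1 m n) X2 !mulmxA.
  move=> /(congr1 (mulmx^~ (qad (X m n)))).
  by rewrite -!mulmxA !(SU2_qadr (SX m n)) !mulmx1 => ->.
have flatA m n := flat m n _ _ SA (fun m n => let: And5 e _ _ _ _ := apP (m, n) in e)
   (fun m n => let: And5 e _ _ _ _ := bqP (m, n) in e).
have flatB m n := flat m n _ _ SB (fun m n => let: And5 _ e _ _ _ := apP (m, n) in e)
   (fun m n => let: And5 _ e _ _ _ := bqP (m, n) in e).
(* At x = H every determinant is 1, the transition matrices being in SU(2); equal labels then
   transport the equality to x = 0. *)
have K u v c : edge_norm u v c 0 = edge_norm u v c H + 2 * H * (c * sqn v).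
  by rewrite /edge_norm; ring.
suff face_eqs m n :
  [/\ (bq (m + 1, n)).2 * conjc (ap (m, n)).2 * (phi (m + 1) n)%:C%C
      = (ap (m, n + 1)).2 * conjc (bq (m, n)).2 * (phi m (n + 1))%:C%C,
     (bq (m + 1, n)).1 * (ap (m, n)).1 - (ap (m, n + 1)).1 * (bq (m, n)).1
      = (bq (m + 1, n)).2 * conjc (ap (m, n)).2 *
        (phi (m + 1) n ^+ 2 * phi m n * phi (m + 1) (n + 1) + 1)%:C%C
      - (ap (m, n + 1)).2 * conjc (bq (m, n)).2 *
        (phi m (n + 1) ^+ 2 * phi m n * phi (m + 1) (n + 1) + 1)%:C%C,
     (bq (m + 1, n)).1 * (ap (m, n)).2 + (bq (m + 1, n)).2 * conjc (ap (m, n)).1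
     = (ap (m, n + 1)).1 * (bq (m, n)).2 + (ap (m, n + 1)).2 * conjc (bq (m, n)).1
   & (bq (m + 1, n)).1 * (ap (m, n)).2 * (phi m n * phi (m + 1) n)%:C%C
      + (bq (m + 1, n)).2 * conjc (ap (m, n)).1 * (phi (m + 1) n * phi (m + 1) (n + 1))%:C%C
    = (ap (m, n + 1)).1 * (bq (m, n)).2 * (phi m n * phi m (n + 1))%:C%C
      + (ap (m, n + 1)).2 * conjc (bq (m, n)).1 * (phi m (n + 1) * phi (m + 1) (n + 1))%:C%C].
  split=> //.
  - by move=> m n; have [] := apP (m, n).
  - by move=> m n; have [] := bqP (m, n).
  - by move=> m n; have [] := face_eqs m n.
  - by move=> m n; have [] := face_eqs m n.
  - by move=> m n; have [] := face_eqs m n.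
  - by move=> m n; have [] := face_eqs m n.
  - move=> m n; rewrite !K lab_p.
    by have [_ _ _ -> _] := apP (m, n); have [_ _ _ -> _] := apP (m, n + 1).
  - move=> m n; rewrite !K lab_q.
    by have [_ _ _ -> _] := bqP (m, n); have [_ _ _ -> _] := bqP (m + 1, n).
have := flatA m n; have := flatB m n; rewrite /lax_edge !qmM /weight.
have f30 : (phi (m + 1) (n + 1) - phi m n)%:C%C != 0 :> C.
  by rewrite real_eq0 subr_eq0; case: (gen m n).
move: (ap (m, n)) (bq (m, n)) (ap (m, n + 1)) (bq (m + 1, n)).
move=> [a p] [b q] [a' p'] [b' q'] /=.
move: (phi m n) (phi (m + 1) n) (phi m (n + 1)) (phi (m + 1) (n + 1)) f30.
move=> f0 f1 f2 f3 f30.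
move=> /qm_inj[B1 B2] /qm_inj[A1 A2]; rewrite !conjcE !rcM in A1 A2 B1 B2.
(* Up to sign, [O1] and [O2] are the coefficients of z and z^* in the off-diagonal defect. *)
pose O1 := b' * p + q' * conjc a - (a' * q + p' * conjc b).
pose O2 := b' * p * (f0%:C%C * f1%:C%C) + q' * conjc a * (f1%:C%C * f3%:C%C)
   - (a' * q * (f0%:C%C * f2%:C%C) + p' * conjc b * (f2%:C%C * f3%:C%C)).
have O2A : O2 * conjc z - O1 * z = 0.
  by move/eqP: A2; rewrite -subr_eq0 => /eqP <-; rewrite /O1 /O2; ring.
have O2B : O2 * z - O1 * conjc z = 0.
  by move/eqP: B2; rewrite -subr_eq0 => /eqP <-; rewrite /O1 /O2; ring.
have {O2A O2B} [E1 E2] : O1 = 0 /\ O2 = 0.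
  split; apply: (mulfI dz); rewrite mulr0.
    transitivity ((O2 * z - O1 * conjc z) * conjc z - (O2 * conjc z - O1 * z) * z).
      by ring.
    by rewrite O2A O2B !mul0r subrr.
  transitivity ((O2 * z - O1 * conjc z) * z - (O2 * conjc z - O1 * z) * conjc z).
    by ring.
  by rewrite O2A O2B !mul0r subrr.
(* The diagonal defects at z and z^* differ by (f3 - f0) (z^2 - z^{*2}) times this relation, up to
   sign; this is where phi_12 <> phi is used. *)
have X12 : q' * conjc p * f1%:C%C = p' * conjc q * f2%:C%C.
  apply: (mulfI f30); apply: (mulfI dz); rewrite rcB.
  apply/eqP; rewrite -subr_eq0; apply/eqP.
  move/eqP: A1; rewrite -subr_eq0 => /eqP A1.
  move/eqP: B1; rewrite -subr_eq0 => /eqP B1.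
  by rewrite -[RHS](subrr 0) -{1}B1 -A1; ring.
split=> //; last 2 first.
- by apply/eqP; rewrite -subr_eq0 -[X in X == _]/O1 E1.
- by rewrite !rcM; apply/eqP; rewrite -subr_eq0 -[X in X == _]/O2 E2.
apply/eqP; rewrite -subr_eq0; apply/eqP.
move/eqP: A1; rewrite -subr_eq0 => /eqP A1.
pose y : C := f3%:C%C * (conjc z * conjc z) + f0%:C%C * (z * z).
transitivity (b' * a - a' * b - (q' * conjc p * (f1%:C%C ^+ 2 * f0%:C%C * f3%:C%C
     * (z * conjc z) + z * conjc z) -
   p' * conjc q * (f2%:C%C ^+ 2 * f0%:C%C * f3%:C%C * (z * conjc z) + z * conjc z))).
  by rewrite z1 !rcE !mulr1.
transitivity (b' * a - a' * b - (q' * conjc p * (f1%:C%C ^+ 2 * f0%:C%C * f3%:C%C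
     * (z * conjc z) + z * conjc z) -
   p' * conjc q * (f2%:C%C ^+ 2 * f0%:C%C * f3%:C%C * (z * conjc z) + z * conjc z))
  + y * (q' * conjc p * f1%:C%C - p' * conjc q * f2%:C%C)).
  by rewrite X12 subrr mulr0 addr0.
by rewrite -[RHS]A1 /y; ring.
Qed.

End LaxOfFrame.

End LaxSystems.

(** * Spherical nets with prescribed edge data *)

Section SphereTarget.
Variable R : realType.
Local Notation C := (R[i]).
Local Notation iC := (iC R).

Definition edge_scale (a p : C) (c x : R) : R := (Num.sqrt (edge_norm a p c x))^-1.

Lemma lax_edgeZ (z : C) (k : R) (a p : C) (c : R) :
  k%:C%C *: lax_edge z a p c = lax_edge z (k%:C%C * a) (k%:C%C * p) c.
Proof. by rewrite /lax_edge qmZ mulrA. Qed.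

Lemma edge_scale_SU2 (z a p : C) (c x y : R) :
  z * conjc z = 1 -> z * z = x%:C%C + iC * y%:C%C -> 0 < edge_norm a p c x ->
  SU2 ((edge_scale a p c x)%:C%C *: lax_edge z a p c).
Proof.
move=> z1 z2 n0; rewrite /edge_scale; set r := Num.sqrt _.
have r0 : r != 0 by rewrite gt_eqF // sqrtr_gt0.
rewrite /lax_edge qmZ; apply: SU2_qm; rewrite /unit_norm.
have -> : (r^-1)%:C%C * a * conjc ((r^-1)%:C%C * a) + (r^-1)%:C%C * (p * weight z c)
   * conjc ((r^-1)%:C%C * (p * weight z c)) = (r^-1 * r^-1)%:C%C *
   (a * conjc a + p * weight z c * conjc (p * weight z c)).
  by rewrite !(conjcM _ (_ * weight z c)) !(conjcM _ a) conjc_real rcM; ring.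
rewrite (edge_normE _ _ _ z1 z2) -rcM -[edge_norm _ _ _ _]sqr_sqrtr ?ltW // -/r.
by rewrite [X in (X%:C)%C](_ : _ = 1) //; field.
Qed.

Lemma edge_scale_neq0 (a p : C) (c x : R) : 0 < edge_norm a p c x ->
  edge_scale a p c x != 0.
Proof. by move=> n0; rewrite invr_eq0 gt_eqF // sqrtr_gt0. Qed.

Variables (phi : int -> int -> R) (a p b q : int -> int -> C).
Hypothesis L : lax_system phi a p b q.

Lemma scaled_flat (z : C) (x : R) m n : z * conjc z = 1 ->
  ((edge_scale (b (m + 1) n) (q (m + 1) n) (phi (m + 1) n * phi (m + 1) (n + 1)) x)%:C%C
   *: lax_edge z (b (m + 1) n) (q (m + 1) n) (phi (m + 1) n * phi (m + 1) (n + 1)))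
    *m ((edge_scale (a m n) (p m n) (phi m n * phi (m + 1) n) x)%:C%C
   *: lax_edge z (a m n) (p m n) (phi m n * phi (m + 1) n))
  = ((edge_scale (a m (n + 1)) (p m (n + 1)) (phi m (n + 1) * phi (m + 1) (n + 1)) x)%:C%C
   *: lax_edge z (a m (n + 1)) (p m (n + 1)) (phi m (n + 1) * phi (m + 1) (n + 1)))
    *m ((edge_scale (b m n) (q m n) (phi m n * phi m (n + 1)) x)%:C%C
   *: lax_edge z (b m n) (q m n) (phi m n * phi m (n + 1))).
Proof.
move=> z1; rewrite /edge_scale; have [-> ->] := lax_norm L x m n.
rewrite -!scalemxAl -!scalemxAr !scalerA (lax_flat L m n z1).
by rewrite mulrC.
Qed.

Lemma lawson_sphere (H k : R) : H ^+ 2 + k ^+ 2 = 1 -> k != 0 ->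
  exists F N : net R,
  [/\ forall m n, [/\ dot (F m n) (F m n) = (k ^+ 2)^-1, dot (N m n) (N m n) = 1
        & dot (F m n) (N m n) = 0],
      edge_eq H phi F N & edges_neq0 F].
Proof.
move=> Hk k0; have [z [z1 z2]] := unit_sqrt Hk.
have zb1 : conjc z * conjc (conjc z) = 1 by rewrite conjcK mulrC.
(* Replacing z by z^* changes k to -k but keeps x = H, so both frames use the same normalising
   factors. *)
have zb2 : conjc z * conjc z = H%:C%C + iC * (- k)%:C%C.
  by rewrite -conjcM z2 !conjcE conj_iC rcN; ring.
have W c : weight (conjc z) c = conjc (weight z c).
  by rewrite conj_weight /weight conjcK.
have H1 : H ^+ 2 < 1 by rewrite -Hk ltrDl lt_neqAle sqr_ge0 eq_sym sqrf_eq0 k0.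
have n1 m n := edge_norm_gt0 (a m n) (phi m n * phi (m + 1) n) (lax_p L m n) H1.
have n2 m n := edge_norm_gt0 (b m n) (phi m n * phi m (n + 1)) (lax_q L m n) H1.
have S1 : SU2 (1%:M : 'M[C]_2).
  by rewrite qm1; apply: SU2_qm; rewrite /unit_norm !conjcE; ring.
have [A [_ SA A1 A2]] := SU2_section S1
  (fun m n => edge_scale_SU2 z1 z2 (n1 m n))
  (fun m n => edge_scale_SU2 z1 z2 (n2 m n)) (fun m n => scaled_flat H m n z1).
have [B [_ SB B1 B2]] := SU2_section S1
  (fun m n => edge_scale_SU2 zb1 zb2 (n1 m n))
  (fun m n => edge_scale_SU2 zb1 zb2 (n2 m n)) (fun m n => scaled_flat H m n zb1).
pose F : net R := fun m n =>
  qpoint (qad (A m n) *m qm ((k^-1)%:C%C * conjc z) 0 *m B m n).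
pose N : net R := fun m n =>
  qpoint (qad (A m n) *m qm (iC * conjc z) 0 *m B m n).
have AB m n : sphere_frame z k (A m n) (B m n) (F m n) (N m n).
  by split; rewrite qpointK //; exact: is_quat_frame.
have edge m n m' n' u v c : 0 < edge_norm u v c H -> v != 0 ->
   A m' n' = ((edge_scale u v c H)%:C%C *: lax_edge z u v c) *m A m n ->
   B m' n' = ((edge_scale u v c H)%:C%C *: lax_edge (conjc z) u v c) *m B m n ->
   N m' n' - N m n = (c - H) *: (F m' n' - F m n) /\ F m' n' != F m n.
  move=> g0 v0 EA EB; have AB' := AB m' n'; rewrite EA EB in AB'.
  have SU := edge_scale_SU2 z1 z2 g0; have s0 := edge_scale_neq0 g0.
  move: AB' SU; rewrite !lax_edgeZ /lax_edge W => AB' SU; split.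
    exact: (sphere_edge_normal z1 z2 k0 SU (AB m n) AB' erefl erefl).
  apply: (sphere_edge_neq z2 k0 (SA m n) (SB m n) SU (AB m n) AB' erefl erefl).
  by rewrite mulf_neq0 // real_eq0.
exists F, N; split=> m n; first exact: (frame_norms z1 k0 (SA m n) (SB m n)).
  split; first by have [] := edge _ _ _ _ _ _ _ (n1 m n) (lax_p L m n) (A1 m n) (B1 m n).
  by have [] := edge _ _ _ _ _ _ _ (n2 m n) (lax_q L m n) (A2 m n) (B2 m n).
split; first by have [] := edge _ _ _ _ _ _ _ (n1 m n) (lax_p L m n) (A1 m n) (B1 m n).
by have [] := edge _ _ _ _ _ _ _ (n2 m n) (lax_q L m n) (A2 m n) (B2 m n).
Qed.

End SphereTarget.

(** * Nets in Euclidean space *)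

(** Otherwise [0, 1] would be countable and hence of Lebesgue measure 0. *)
Lemma avoid_countable (R : realType) (T : countType) (f : T -> R) :
  exists t, forall x, f x <> t.
Proof.
apply: contrapT => /forallNP H.
have cnt : countable ([set` `[0%R, 1%R]] : set R).
  apply: (@sub_countable _ _ _ (range f)).
    apply: subset_card_le => t _; apply: contrapT => nt; apply: (H t) => x fx.
    by apply: nt; exists x.
  exact: (card_le_trans (card_image_le _ _) (countableP _)).
have := countable_lebesgue_measure0 cnt; rewrite lebesgue_measure_itv /=.
rewrite constructive_ereal.lte_fin ltr01 /=.
move=> /(congr1 (@constructive_ereal.fine R)) /= /eqP.
by rewrite subr0 oner_eq0.
Qed.

Section EuclideanEdges.
Variable R : realType.
Local Notation C := (R[i]).
Local Notation iC := (iC R).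
Implicit Types (A B U V X Y : 'M[C]_2) (u v : C) (c e : R).

Lemma weight1 c : weight (1 : C) c = (c - 1)%:C%C.
Proof. by rewrite /weight conjc1 mulr1 rcB. Qed.

Lemma edge_norm1 u v c : edge_norm u v c 1 = sqn u + sqn v * (c - 1) ^+ 2.
Proof. by rewrite /edge_norm; ring. Qed.

Lemma edge_norm1_ge0 u v c : 0 <= edge_norm u v c 1.
Proof.
rewrite edge_norm1; apply: addr_ge0; first exact: sqn_ge0.
by apply: mulr_ge0; [exact: sqn_ge0|exact: sqr_ge0].
Qed.

Lemma edge_norm1_eq0 u v c : v != 0 -> edge_norm u v c 1 = 0 -> u = 0 /\ c = 1.
Proof.
move=> v0; rewrite edge_norm1 => /eqP.
have h : 0 <= sqn v * (c - 1) ^+ 2.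
  by apply: mulr_ge0; [exact: sqn_ge0|exact: sqr_ge0].
rewrite paddr_eq0 ?sqn_ge0 // mulf_eq0 !sqn_eq0 (negPf v0) /=.
by rewrite sqrf_eq0 subr_eq0 => /andP[/eqP -> /eqP ->].
Qed.

(* The Lax matrix at spectral parameter 1; where it vanishes, its
   renormalised limit. *)
Definition euclid_edge u v c : 'M[C]_2 :=
  if edge_norm u v c 1 == 0 then ((Num.sqrt (sqn v))^-1)%:C%C *: qm 0 (iC * v)
  else (edge_scale u v c 1)%:C%C *: lax_edge 1 u v c.

Lemma euclid_edge_SU2 u v c : v != 0 -> SU2 (euclid_edge u v c).
Proof.
move=> v0; rewrite /euclid_edge; case: eqVneq => [_|n0].
  rewrite qmZ; apply: SU2_qm; rewrite /unit_norm !conjcE conj_iC.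
  set r := Num.sqrt _.
  have r0 : r != 0 by rewrite gt_eqF // sqrtr_gt0 sqn_gt0.
  have rr : v * conjc v = (r ^+ 2)%:C%C by rewrite sqr_sqrtr ?sqn_ge0 // sqnE.
  transitivity ((r^-1 * r^-1)%:C%C * (- (iC * iC)) * (v * conjc v)).
    by rewrite rcM; ring.
  rewrite iC2 rr opprK mulr1 -rcM [X in (X%:C)%C](_ : _ = 1) //; field.
  exact: r0.
apply: (@edge_scale_SU2 _ 1 _ _ _ 1 0).
- by rewrite conjc1 mulr1.
- by rewrite !mulr1 mulr0 addr0.
- by rewrite lt_neqAle eq_sym n0 edge_norm1_ge0.
Qed.

(** The increment of N is divisible by c - 1, and the quotient is taken as the edge of F. It is the
    limit of [sphere_edge] for A = B and stays meaningful when c = 1. The sign of the normal is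
    carried by e. *)
Lemma euclid_normal_step A U u v c e : SU2 U -> U = lax_edge 1 u v c ->
  qad (U *m A) *m qm (e%:C%C * iC) 0 *m (U *m A)
    - qad A *m qm (e%:C%C * iC) 0 *m A
  = (c - 1)%:C%C *: (qad (U *m A) *m qm 0 (2 * iC * e%:C%C * v) *m A).
Proof.
move=> SU UE; rewrite (frame_diff _ _ _ _ SU) scalemxAl scalemxAr.
congr (_ *m _ *m _); rewrite UE /lax_edge weight1 !qmM qmB qmZ.
by apply: eq_qm; rewrite ?conjcE ?conj_iC; ring.
Qed.

(** Off-diagonal quaternions anticommute with [qm iC 0], so N stays constant if e changes sign. *)
Lemma euclid_normal_sing A U v e : SU2 U -> U = qm 0 (iC * v) ->
  qad (U *m A) *m qm ((- e)%:C%C * iC) 0 *m (U *m A)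
  = qad A *m qm (e%:C%C * iC) 0 *m A.
Proof.
move=> SU UE; rewrite qadM -!mulmxA; congr (_ *m _); rewrite !mulmxA; congr (_ *m _).
have -> : qm (e%:C%C * iC) 0 = qad U *m (U *m qm (e%:C%C * iC) 0).
  by rewrite mulmxA (SU2_qadl SU) mul1mx.
rewrite -mulmxA; congr (_ *m _); rewrite UE !qmM.
by apply: eq_qm; rewrite ?conjcE ?conj_iC ?rcN; ring.
Qed.

Lemma euclid_edge_imag A U u v c e : SU2 U -> U = lax_edge 1 u v c ->
  let X := qad (U *m A) *m qm 0 (2 * iC * e%:C%C * v) *m A in qad X = - X.
Proof.
move=> SU UE /=; rewrite !qadM !qadK -mulNmx -mulmxN -!mulmxA; congr (_ *m _).
rewrite !mulmxA; congr (_ *m _).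
rewrite UE /lax_edge weight1 !qad_qm qmN !qmM.
by apply: eq_qm; rewrite ?conjcE ?conj_iC; ring.
Qed.

Lemma two_steps A U V X Y : SU2 V ->
  qad (U *m A) *m X *m A + qad (V *m (U *m A)) *m Y *m (U *m A)
  = qad (V *m (U *m A)) *m (V *m X + Y *m U) *m A.
Proof.
move=> SV; rewrite mulmxDr mulmxDl; congr (_ + _); last by rewrite !mulmxA.
by rewrite !qadM -!mulmxA (mulmxA (qad V)) (SU2_qadl SV) mul1mx.
Qed.

(** Closing of the edges of F around a regular face, read in the frame. The diagonal entry is a
    multiple of the cross relation, the off-diagonal one of [lax_off1]. *)
Lemma euclid_closing (a p b q a' p' b' q' : C) (f0 f1 f2 f3 r t e : R) :
  q' * conjc p * f1%:C%C = p' * conjc q * f2%:C%C ->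
  b' * p + q' * conjc a = a' * q + p' * conjc b ->
  (t%:C%C *: lax_edge 1 b' q' (f1 * f3)) *m qm 0 (2 * iC * e%:C%C * (r%:C%C * p))
  + qm 0 (2 * iC * e%:C%C * (t%:C%C * q')) *m (r%:C%C *: lax_edge 1 a p (f0 * f1))
  = (r%:C%C *: lax_edge 1 a' p' (f2 * f3)) *m qm 0 (2 * iC * e%:C%C * (t%:C%C * q))
  + qm 0 (2 * iC * e%:C%C * (r%:C%C * p')) *m (t%:C%C *: lax_edge 1 b q (f0 * f2)).
Proof.
move=> E1 E2; rewrite !lax_edgeZ /lax_edge !weight1 !qmM !qmD.
apply: eq_qm; rewrite ?conjcE ?conj_iC; apply/eqP; rewrite -subr_eq0; apply/eqP.
  transitivity (2 * iC * e%:C%C * t%:C%C * r%:C%C * (f3%:C%C - f0%:C%C) *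
    (q' * conjc p * f1%:C%C - p' * conjc q * f2%:C%C)).
    by rewrite !(rcB, rcE); ring.
  by rewrite E1 subrr mulr0.
transitivity (2 * iC * e%:C%C * t%:C%C * r%:C%C *
   (b' * p + q' * conjc a - (a' * q + p' * conjc b))); first by ring.
by rewrite E2 subrr mulr0.
Qed.

Lemma sing_flat (a p a' p' q q' : C) (f0 f1 f2 f3 : R) : f1 != 0 ->
  q' * conjc p * f1%:C%C = p' * conjc q * f2%:C%C -> q' * conjc a = a' * q ->
  f0 * f2 = 1 -> f1 * f3 = 1 ->
  qm 0 (iC * q') *m lax_edge 1 a p (f0 * f1)
  = lax_edge 1 a' p' (f2 * f3) *m qm 0 (iC * q).
Proof.
move=> f10 E1 E2 f02 f13; rewrite /lax_edge !weight1 !qmM.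
apply: eq_qm; rewrite ?conjcE ?conj_iC; last first.
  by transitivity (iC * (q' * conjc a)); [ring|rewrite E2; ring].
have f1C : f1%:C%C != 0 :> C by rewrite real_eq0.
apply: (mulfI f1C).
transitivity (- iC * (f0 * f1 - 1)%:C%C * (q' * conjc p * f1%:C%C)); first by ring.
rewrite E1; transitivity (iC * (p' * conjc q) * (- (f0 * f2 * f1 - f2))%:C%C).
  by rewrite !(rcB, rcE); ring.
rewrite f02; transitivity (iC * (p' * conjc q) * (f2 * (f1 * f3) - f1)%:C%C).
  by rewrite f13 mul1r mulr1 opprB.
by rewrite !(rcB, rcE); ring.
Qed.

(** Across a singular strip an edge d of F turns into -c d. This agrees with F -> const - F - N,
    because the increment of N along that edge is (c - 1) d. *)
Lemma sing_closing (p p' q q' : C) (f0 f1 f2 r t e : R) :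
  q' * conjc p * f1%:C%C = p' * conjc q * f2%:C%C -> f0 * f2 = 1 ->
  qm 0 (2 * iC * (- e)%:C%C * (r%:C%C * p')) *m (t%:C%C *: qm 0 (iC * q))
  = (- (f0 * f1))%:C%C *: ((t%:C%C *: qm 0 (iC * q'))
     *m qm 0 (2 * iC * e%:C%C * (r%:C%C * p))).
Proof.
move=> E f02; rewrite !qmZ !qmM qmZ; apply: eq_qm; rewrite ?conjcE ?conj_iC; last by ring.
transitivity (2 * (- (iC * iC)) * e%:C%C * r%:C%C * t%:C%C * (f0 * f2)%:C%C * (p' * conjc q)).
  by rewrite f02 rcN; ring.
transitivity (2 * (- (iC * iC)) * e%:C%C * r%:C%C * t%:C%C * f0%:C%C *
   (p' * conjc q * f2%:C%C)); first by rewrite rcM; ring.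
by rewrite -E rcN rcM; ring.
Qed.

End EuclideanEdges.

Section EuclideanTarget.
Variable R : realType.
Local Notation C := (R[i]).
Local Notation iC := (iC R).
Variables (phi : int -> int -> R) (a p b q : int -> int -> C).
Hypotheses (L : lax_system phi a p b q) (gen : generic phi).

Let c1 m n := phi m n * phi (m + 1) n.
Let c2 m n := phi m n * phi m (n + 1).
Let s1 m n := edge_norm (a m n) (p m n) (c1 m n) 1 == 0.
Let s2 m n := edge_norm (b m n) (q m n) (c2 m n) 1 == 0.
Let U m n := euclid_edge (a m n) (p m n) (c1 m n).
Let V m n := euclid_edge (b m n) (q m n) (c2 m n).

Let s1_shift m n : s1 m (n + 1) = s1 m n.
Proof. by rewrite /s1 /c1; have [-> _] := lax_norm L 1 m n. Qed.

Let s2_shift m n : s2 (m + 1) n = s2 m n.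
Proof. by rewrite /s2 /c2; have [_ ->] := lax_norm L 1 m n. Qed.

Let s1P m n : s1 m n -> a m n = 0 /\ c1 m n = 1.
Proof. by move=> /eqP E; exact: (edge_norm1_eq0 (lax_p L m n) E). Qed.

Let s2P m n : s2 m n -> b m n = 0 /\ c2 m n = 1.
Proof. by move=> /eqP E; exact: (edge_norm1_eq0 (lax_q L m n) E). Qed.

Let not_both m n : s1 m n -> s2 m n -> False.
Proof.
move=> /s1P[_ E1] /s2P[_ E2]; have [f0 _ /eqP] := gen m n; apply.
by apply: (mulfI f0); rewrite -/(c1 m n) -/(c2 m n) E1 E2.
Qed.

Let flatUV m n : V (m + 1) n *m U m n = U m (n + 1) *m V m n.
Proof.
have cross := lax_cross L m n; have off := lax_off1 L m n.
rewrite /U /V /euclid_edge -/(s1 m n) -/(s1 m (n + 1)) -/(s2 m n) -/(s2 (m + 1) n).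
rewrite s1_shift s2_shift.
have [h1|h1] := boolP (s1 m n); have [h2|h2] := boolP (s2 m n).
- by case: (not_both h1 h2).
- have [a0 cE] := s1P h1.
  have [a0' cE'] : a m (n + 1) = 0 /\ c1 m (n + 1) = 1.
    by apply: s1P; rewrite s1_shift.
  have -> : sqn (p m (n + 1)) = sqn (p m n).
    have := lax_label_p L m n; rewrite -/(c1 m n) -/(c1 m (n + 1)) cE cE'.
    by rewrite !mul1r.
  rewrite /edge_scale /c2; have [_ ->] := lax_norm L 1 m n.
  rewrite -!scalemxAl -!scalemxAr !scalerA mulrC; congr (_ *: _); symmetry.
  apply: sing_flat cE cE'.
  + by case: (gen m (n + 1)).
  + by rewrite cross.
  + by move: off; rewrite a0 a0' conjc0 mulr0 mul0r addr0 add0r => ->.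
- have [b0 cE] := s2P h2.
  have [b0' cE'] : b (m + 1) n = 0 /\ c2 (m + 1) n = 1.
    by apply: s2P; rewrite s2_shift.
  have -> : sqn (q (m + 1) n) = sqn (q m n).
    have := lax_label_q L m n; rewrite -/(c2 m n) -/(c2 (m + 1) n) cE cE'.
    by rewrite !mul1r.
  rewrite /edge_scale /c1; have [-> _] := lax_norm L 1 m n.
  rewrite -!scalemxAl -!scalemxAr !scalerA mulrC; congr (_ *: _).
  apply: sing_flat cE cE'.
  + by case: (gen (m + 1) n).
  + by rewrite cross.
  + by move: off; rewrite b0 b0' conjc0 mulr0 mul0r addr0 add0r => ->.
- by apply: scaled_flat; rewrite ?conjc1 ?mulr1.
Qed.

Lemma lawson_euclid : exists F N : net R,
  [/\ forall m n, [/\ in_R3 (F m n), in_R3 (N m n) & dot (N m n) (N m n) = 1],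
      edge_eq 1 phi F N & edges_neq0 F].
Proof.
have SU m n : SU2 (U m n) by exact/euclid_edge_SU2/(lax_p L).
have SV m n : SU2 (V m n) by exact/euclid_edge_SU2/(lax_q L).
have S1 : SU2 (1%:M : 'M[C]_2).
  by rewrite qm1; apply: SU2_qm; rewrite /unit_norm !conjcE; ring.
have [Phi [_ SPhi Phi1 Phi2]] := SU2_section S1 SU SV flatUV.
pose sg (s : bool) : R := if s then -1 else 1.
have sgK s x : sg s * (sg s * x) = x.
  by rewrite /sg mulrA; case: s; rewrite ?mulrNN !mulr1 mul1r.
(* The sign that compensates the anticommutation on singular edges; each step is its own inverse. *)
have [eps [eps0 eps1 eps2]] := @flat_section _ (1 : R)
  (fun m n x => sg (s1 m n) * x) (fun m n x => sg (s1 m n) * x)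
  (fun m n x => sg (s2 m n) * x) (fun m n x => sg (s2 m n) * x)
  (fun m n => sgK _) (fun m n => sgK _) (fun m n => sgK _) (fun m n => sgK _)
  (fun m n x => etrans (mulrCA _ _ _)
     (f_equal2 (fun s t => sg s * (sg t * x)) (esym (s1_shift m n)) (s2_shift m n))).
have epsq : forall m n, eps m n ^+ 2 = 1.
  apply: int2_ind => [|m n|m n]; first by rewrite eps0 expr1n.
    by rewrite eps1 exprMn /sg; case: (s1 m n); rewrite ?sqrrN expr1n mul1r.
  by rewrite eps2 exprMn /sg; case: (s2 m n); rewrite ?sqrrN expr1n mul1r.
have eps_neq0 m n : eps m n != 0.
  by rewrite -sqrf_eq0 epsq oner_eq0.
have [N quatN'] : exists N : net R, forall m n,
    quat (N m n) = qad (Phi m n) *m qm ((eps m n)%:C%C * iC) 0 *m Phi m n.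
  exists (fun m n => qpoint (qad (Phi m n) *m qm ((eps m n)%:C%C * iC) 0 *m Phi m n)).
  by move=> m n; rewrite qpointK //; exact: is_quat_frame.
have [d quatd] : exists d : int -> int -> int -> int -> C -> C -> R -> point R,
  forall m n m' n' u v c, quat (d m n m' n' u v c) = qad (Phi m' n') *m
  qm 0 (2 * iC * (eps m n)%:C%C * ((edge_scale u v c 1)%:C%C * v)) *m Phi m n.
  exists (fun m n m' n' u v c => qpoint (qad (Phi m' n') *m
  qm 0 (2 * iC * (eps m n)%:C%C * ((edge_scale u v c 1)%:C%C * v)) *m Phi m n)).
  by move=> *; rewrite qpointK //; exact: is_quat_frame.
have reg m n m' n' (u v : C) c : v != 0 -> edge_norm u v c 1 != 0 ->
   Phi m' n' = euclid_edge u v c *m Phi m n -> eps m' n' = eps m n ->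
   [/\ N m' n' - N m n = (c - 1) *: d m n m' n' u v c,
       in_R3 (d m n m' n' u v c) & d m n m' n' u v c != 0].
  move=> v0 n0 EP ee; have SE := euclid_edge_SU2 u c v0.
  have EE : euclid_edge u v c = lax_edge 1 ((edge_scale u v c 1)%:C%C * u)
     ((edge_scale u v c 1)%:C%C * v) c.
    by rewrite /euclid_edge (negPf n0) lax_edgeZ.
  split.
  - apply: quat_inj; rewrite quatB quatZ quatd (quatN' m' n') (quatN' m n) ee EP.
    exact: euclid_normal_step SE EE.
  - by apply: in_R3_qad; rewrite quatd EP; exact: euclid_edge_imag SE EE.
  - have SP' := SPhi m' n'.
    rewrite -dot_eq0 (dot_frame SP' (SPhi m n) (quatd _ _ _ _ _ _ _) (quatd _ _ _ _ _ _ _)).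
    rewrite mul0r add0r -/(sqn _) sqn_eq0 !mulf_neq0 ?iC_neq0 ?real_eq0 ?pnatr_eq0 //.
    by apply: edge_scale_neq0; rewrite lt_neqAle eq_sym n0 edge_norm1_ge0.
have sing m n m' n' (u v : C) c : v != 0 -> edge_norm u v c 1 == 0 ->
   Phi m' n' = euclid_edge u v c *m Phi m n -> eps m' n' = - eps m n ->
   N m' n' = N m n.
  move=> v0 n0 EP ee; have SE := euclid_edge_SU2 u c v0.
  apply: quat_inj; rewrite (quatN' m' n') (quatN' m n) EP ee; apply: (euclid_normal_sing _ _ SE
    (v := ((Num.sqrt (sqn v))^-1)%:C%C * v)).
  by rewrite /euclid_edge n0 qmZ; apply: eq_qm; ring.
have eps1r m n : ~~ s1 m n -> eps (m + 1) n = eps m n.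
  by move=> h; rewrite eps1 /sg (negPf h) mul1r.
have eps2r m n : ~~ s2 m n -> eps m (n + 1) = eps m n.
  by move=> h; rewrite eps2 /sg (negPf h) mul1r.
have eps1s m n : s1 m n -> eps (m + 1) n = - eps m n.
  by move=> h; rewrite eps1 /sg h mulN1r.
have eps2s m n : s2 m n -> eps m (n + 1) = - eps m n.
  by move=> h; rewrite eps2 /sg h mulN1r.
pose d1 m n := d m n (m + 1) n (a m n) (p m n) (c1 m n).
pose d2 m n := d m n m (n + 1) (b m n) (q m n) (c2 m n).
have reg1 m n (h : ~~ s1 m n) := reg _ _ _ _ _ _ _ (lax_p L m n) h (Phi1 m n) (eps1r _ _ h).
have reg2 m n (h : ~~ s2 m n) := reg _ _ _ _ _ _ _ (lax_q L m n) h (Phi2 m n) (eps2r _ _ h).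
have sing1 m n (h : s1 m n) := sing _ _ _ _ _ _ _ (lax_p L m n) h (Phi1 m n) (eps1s _ _ h).
have sing2 m n (h : s2 m n) := sing _ _ _ _ _ _ _ (lax_q L m n) h (Phi2 m n) (eps2s _ _ h).
have quat_d1 m n : quat (d1 m n) = qad (V (m + 1) n *m (U m n *m Phi m n)) *m
   (V (m + 1) n *m qm 0 (2 * iC * (eps m n)%:C%C *
     ((edge_scale (a m n) (p m n) (c1 m n) 1)%:C%C * p m n))) *m Phi m n.
  have := @two_steps _ (Phi m n) (U m n) (V (m + 1) n) (qm 0 (2 * iC * (eps m n)%:C%C *
     ((edge_scale (a m n) (p m n) (c1 m n) 1)%:C%C * p m n))) 0 (SV _ _).
  by rewrite mulmx0 !mul0mx !addr0 => <-; rewrite -Phi1 quatd.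
have quat_d2 m n : quat (d2 m n) = qad (U m (n + 1) *m (V m n *m Phi m n)) *m
   (U m (n + 1) *m qm 0 (2 * iC * (eps m n)%:C%C *
     ((edge_scale (b m n) (q m n) (c2 m n) 1)%:C%C * q m n))) *m Phi m n.
  have := @two_steps _ (Phi m n) (V m n) (U m (n + 1)) (qm 0 (2 * iC * (eps m n)%:C%C *
     ((edge_scale (b m n) (q m n) (c2 m n) 1)%:C%C * q m n))) 0 (SU _ _).
  by rewrite mulmx0 !mul0mx !addr0 => <-; rewrite -Phi2 quatd.
have scale1 m n : edge_scale (a m (n + 1)) (p m (n + 1)) (c1 m (n + 1)) 1
   = edge_scale (a m n) (p m n) (c1 m n) 1.
  by rewrite /edge_scale /c1; have [-> _] := lax_norm L 1 m n.
have scale2 m n : edge_scale (b (m + 1) n) (q (m + 1) n) (c2 (m + 1) n) 1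
   = edge_scale (b m n) (q m n) (c2 m n) 1.
  by rewrite /edge_scale /c2; have [_ ->] := lax_norm L 1 m n.
have P12 m n : Phi (m + 1) (n + 1) = V (m + 1) n *m (U m n *m Phi m n).
  by rewrite Phi2 Phi1.
have P21 m n : Phi (m + 1) (n + 1) = U m (n + 1) *m (V m n *m Phi m n).
  by rewrite Phi1 Phi2.
have close_rr m n : ~~ s1 m n -> ~~ s2 m n ->
    d1 m n + d2 (m + 1) n = d2 m n + d1 m (n + 1).
  move=> h1 h2; apply: quat_inj; rewrite (quatD (d1 m n)) (quatD (d2 m n)).
  rewrite /d1 /d2 !quatd.
  rewrite scale1 scale2 (eps1r _ _ h1) (eps2r _ _ h2).
  rewrite {1}(P12 m n) {1}(P21 m n) (Phi1 m n) (Phi2 m n).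
  have T1 := two_steps (Phi m n) (U m n) _ _ (SV (m + 1) n).
  have T2 := two_steps (Phi m n) (V m n) _ _ (SU m (n + 1)).
  apply: (etrans (T1 _ _)); apply: (etrans _ (esym (T2 _ _))).
  rewrite -(P12 m n) -(P21 m n); apply: (congr1 (fun X => _ *m X *m _)).
  rewrite /U /V /euclid_edge -/(s1 m n) -/(s1 m (n + 1)) -/(s2 m n) -/(s2 (m + 1) n).
  rewrite s1_shift s2_shift (negPf h1) (negPf h2) scale1 scale2.
  exact: (euclid_closing _ _ _ _ _ (lax_cross L m n) (lax_off1 L m n)).
have close_s2 m n : s2 m n -> d1 m (n + 1) = - c1 m n *: d1 m n.
  move=> h; have [_ cE] := s2P h; apply: quat_inj; rewrite quatZ (quat_d1 m n) /d1 quatd.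
  rewrite scale1 (eps2s _ _ h) (P12 m n) (Phi2 m n).
  rewrite scalemxAl scalemxAr (mulmxA _ (V m n)) -(mulmxA (qad _)).
  congr (_ *m _ *m _).
  have [_ cE'] : b (m + 1) n = 0 /\ c2 (m + 1) n = 1.
    by apply: s2P; rewrite s2_shift.
  have qq : sqn (q (m + 1) n) = sqn (q m n).
    have := lax_label_q L m n; rewrite -/(c2 m n) -/(c2 (m + 1) n) cE cE'.
    by rewrite !mul1r.
  rewrite /V /euclid_edge -/(s2 m n) -/(s2 (m + 1) n) s2_shift h qq.
  exact: sing_closing (lax_cross L m n) cE.
have close_s1 m n : s1 m n -> d2 (m + 1) n = - c2 m n *: d2 m n.
  move=> h; have [_ cE] := s1P h; apply: quat_inj; rewrite quatZ (quat_d2 m n) /d2 quatd.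
  rewrite scale2 (eps1s _ _ h) (P21 m n) (Phi1 m n).
  rewrite scalemxAl scalemxAr (mulmxA _ (U m n)) -(mulmxA (qad _)).
  congr (_ *m _ *m _).
  have [_ cE'] : a m (n + 1) = 0 /\ c1 m (n + 1) = 1.
    by apply: s1P; rewrite s1_shift.
  have pp : sqn (p m (n + 1)) = sqn (p m n).
    have := lax_label_p L m n; rewrite -/(c1 m n) -/(c1 m (n + 1)) cE cE'.
    by rewrite !mul1r.
  rewrite /U /euclid_edge -/(s1 m n) -/(s1 m (n + 1)) s1_shift h pp.
  exact: sing_closing (esym (lax_cross L m n)) cE.
(* A pair (g, y) stands for the point g + y T with T an undetermined translation. A singular edge
   sends it to T - (g + y T) - N, that is to (-g - N, 1 - y), and a regular edge adds w to g. One T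
   for all strips thus suffices, and it is chosen after integration. *)
pose step (s : bool) (w N0 : point R) (x : point R * R) : point R * R :=
  if s then (- x.1 - N0, 1 - x.2) else (x.1 + w, x.2).
pose step' (s : bool) (w N0 : point R) (x : point R * R) : point R * R :=
  if s then (- x.1 - N0, 1 - x.2) else (x.1 - w, x.2).
have stepK s w N0 x : step' s w N0 (step s w N0 x) = x.
  case: x => x y; rewrite /step /step'; case: s => /=; last by rewrite addrK.
  by rewrite opprB opprK addrAC subrr add0r opprB addrC subrK.
have stepK' s w N0 x : step s w N0 (step' s w N0 x) = x.
  case: x => x y; rewrite /step /step'; case: s => /=; last by rewrite subrK.
  by rewrite opprB opprK addrAC subrr add0r opprB addrC subrK.
have flatG m n x : step (s2 (m + 1) n) (d2 (m + 1) n) (N (m + 1) n)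
      (step (s1 m n) (d1 m n) (N m n) x)
    = step (s1 m (n + 1)) (d1 m (n + 1)) (N m (n + 1))
      (step (s2 m n) (d2 m n) (N m n) x).
  move: x => [x y]; rewrite /step s1_shift s2_shift.
  have [h1|h1] := boolP (s1 m n); have [h2|h2] := boolP (s2 m n).
  - by case: (not_both h1 h2).
  - have [EN _ _] := reg2 _ _ h2; rewrite /= close_s1 //; congr (_, _).
    rewrite -[N m (n + 1)](subrK (N m n)) EN -/(d2 m n).
    by apply/rowP => i; rewrite !mxE; ring.
  - have [EN _ _] := reg1 _ _ h1; rewrite /= close_s2 //; congr (_, _).
    rewrite -[N (m + 1) n](subrK (N m n)) EN -/(d1 m n).
    by apply/rowP => i; rewrite !mxE; ring.
  - by rewrite /= -(addrA x) close_rr // addrA.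
have [G [G0 G1 G2]] := @flat_section _ ((0 : point R), (0 : R))
  (fun m n => step (s1 m n) (d1 m n) (N m n)) (fun m n => step' (s1 m n) (d1 m n) (N m n))
  (fun m n => step (s2 m n) (d2 m n) (N m n)) (fun m n => step' (s2 m n) (d2 m n) (N m n))
  (fun m n => stepK _ _ _) (fun m n => stepK' _ _ _)
  (fun m n => stepK _ _ _) (fun m n => stepK' _ _ _) flatG.
have N3 m n : in_R3 (N m n).
  apply: in_R3_qad; rewrite (quatN' m n) !qadM qadK -mulNmx -mulmxN mulmxA.
  by congr (_ *m _ *m _); rewrite qad_qm qmN !conjcE conj_iC mulrN.
have NN m n : dot (N m n) (N m n) = 1.
  rewrite (dot_frame (SPhi m n) (SPhi m n) (quatN' m n) (quatN' m n)).
  rewrite mul0r addr0 !conjcE conj_iC.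
  have -> : (eps m n)%:C%C * iC * ((eps m n)%:C%C * - iC) = (eps m n ^+ 2)%:C%C.
    transitivity (- (iC * iC) * ((eps m n)%:C%C * (eps m n)%:C%C)); first by ring.
    by rewrite iC2 opprK mul1r -rcM.
  by rewrite epsq.
have G3 : forall m n, in_R3 (G m n).1.
  apply: int2_ind => [|m n|m n]; first by rewrite G0 /in_R3 mxE.
    rewrite G1 /step; have := N3 m n; have [h|h] := boolP (s1 m n).
      by rewrite /in_R3 !mxE /=; split; lra.
    by have [_] := reg1 _ _ h; rewrite -/(d1 m n) /in_R3 !mxE /=; split; lra.
  rewrite G2 /step; have := N3 m n; have [h|h] := boolP (s2 m n).
    by rewrite /in_R3 !mxE /=; split; lra.
  by have [_] := reg2 _ _ h; rewrite -/(d2 m n) /in_R3 !mxE /=; split; lra.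
(* The map y -> 1 - y changes the sign of 1 - 2y, so this number stays 1 or -1 and T never drops out
   of a singular edge. *)
have beta m n : 1 - 2 * (G m n).2 != 0.
  rewrite -sqrf_eq0; suff -> : (1 - 2 * (G m n).2) ^+ 2 = 1 by rewrite oner_eq0.
  move: m n; apply: int2_ind => [|m n|m n]; first by rewrite G0 mulr0 subr0 expr1n.
    rewrite G1 /step; case: (s1 m n) => //=.
    have -> : 1 - 2 * (1 - (G m n).2) = - (1 - 2 * (G m n).2) by ring.
    by rewrite sqrrN.
  rewrite G2 /step; case: (s2 m n) => //=.
  have -> : 1 - 2 * (1 - (G m n).2) = - (1 - 2 * (G m n).2) by ring.
  by rewrite sqrrN.
(* With T = t e0, a singular edge has length zero only if its first coordinate vanishes, which
   excludes one value of t per vertex. Since e0 lies in R^3, so does the net. *)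
have [t tP] := avoid_countable (fun mn : int * int =>
  (2 * (G mn.1 mn.2).1 0 (inord 0) + N mn.1 mn.2 0 (inord 0)) / (1 - 2 * (G mn.1 mn.2).2)).
pose e0 : point R := \row_(i < 4) (i == inord 0)%:R.
pose F : net R := fun m n => (G m n).1 + ((G m n).2 * t) *: e0.
have F_reg m n m' n' w : G m' n' = step false w (N m n) (G m n) ->
   F m' n' - F m n = w.
  by rewrite /F => -> /=; apply/rowP => i; rewrite !mxE; ring.
have F_sing m n m' n' w : G m' n' = step true w (N m n) (G m n) ->
   F m' n' != F m n.
  rewrite /F => -> /=; apply/eqP => /rowP/(_ (inord 0)); rewrite !mxE eqxx /= !mulr1 => E.
  apply: (tP (m, n)) => /=; apply: (mulIf (beta m n)); rewrite divfK ?beta //.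
  by move: E; lra.
exists F, N; split=> m n.
- split=> //; rewrite /in_R3 !mxE; have := G3 m n; rewrite /in_R3 => ->.
  have -> : (inord 3 == inord 0 :> 'I_4) = false.
    by apply/eqP => /(congr1 val); rewrite /= !inordK.
  by rewrite mulr0 addr0.
- split.
    have [h|h] := boolP (s1 m n).
      have [_ cE] := s1P h; rewrite -/(c1 m n) cE subrr scale0r.
      by rewrite (sing1 _ _ h) subrr.
    have [-> _ _] := reg1 _ _ h; congr (_ *: _).
    by rewrite (F_reg m n _ _ (d1 m n)) // G1 (negPf h).
  have [h|h] := boolP (s2 m n).
    have [_ cE] := s2P h; rewrite -/(c2 m n) cE subrr scale0r.
    by rewrite (sing2 _ _ h) subrr.
  have [-> _ _] := reg2 _ _ h; congr (_ *: _).
  by rewrite (F_reg m n _ _ (d2 m n)) // G2 (negPf h).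
- split.
    have [h|h] := boolP (s1 m n); first by apply: (F_sing _ _ _ _ 0); rewrite G1 h.
    have [_ _ dn0] := reg1 _ _ h.
    by rewrite -subr_eq0 (F_reg m n _ _ (d1 m n)) // G1 (negPf h).
  have [h|h] := boolP (s2 m n); first by apply: (F_sing _ _ _ _ 0); rewrite G2 h.
  have [_ _ dn0] := reg2 _ _ h.
  by rewrite -subr_eq0 (F_reg m n _ _ (d2 m n)) // G2 (negPf h).
Qed.

End EuclideanTarget.

(** * The correspondence between curvatures *)

Section Correspondence.
Variable R : realType.
Local Notation C := (R[i]).
Implicit Types (F N : net R) (phi s : int -> int -> R).

Lemma sphere_lax (H k : R) phi F N : H ^+ 2 + k ^+ 2 = 1 -> k != 0 ->
  (forall m n, [/\ dot (F m n) (F m n) = (k ^+ 2)^-1, dot (N m n) (N m n) = 1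
     & dot (F m n) (N m n) = 0]) ->
  edge_eq H phi F N -> generic phi -> edges_neq0 F ->
  exists a p b q, lax_system phi a p b q.
Proof.
move=> Hk k0 nrm FN gen F0; have [z [z1 z2]] := unit_sqrt Hk.
have /choice[AB ABP] : forall mn : int * int, exists AB : 'M[C]_2 * 'M[C]_2,
   [/\ SU2 AB.1, SU2 AB.2 & sphere_frame z k AB.1 AB.2 (F mn.1 mn.2) (N mn.1 mn.2)].
  move=> [m n]; have [dF dN dFN] := nrm m n.
  have [A [B AB]] := sphere_frame_exists z1 k0 dF dN dFN.
  by exists (A, B).
have [a [p [b [q [L _ _]]]]] := lax_system_exists z1 z2 k0
  (A := fun m n => (AB (m, n)).1) (B := fun m n => (AB (m, n)).2)
  (fun m n => let: And3 e _ _ := ABP (m, n) in e)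
  (fun m n => let: And3 _ e _ := ABP (m, n) in e)
  (fun m n => let: And3 _ _ e := ABP (m, n) in e) FN gen F0.
by exists a, p, b, q.
Qed.

Lemma metric_product_inv s : metric_product 1 s (fun m n => (s m n)^-1).
Proof. by move=> m n; rewrite !mul1r !invfM. Qed.

Lemma minimal_to_cmc1 F N s :
  qnet_S3 F N -> noncollinear_faces F -> minimal F N -> conformal_metric 0 F N s ->
  exists F' N' : net R, [/\ qnet_R3 F' N', constant_mean_curvature 1 F' N'
    & conformal_metric 1 F' N' s].
Proof.
move=> [[pl _ F0] nrm] ncol cmc cm; have [s0 _] := cm.
have d0 : dual_factor (0 : R) = 1 by rewrite /dual_factor eqxx.
have d1 : dual_factor (1 : R) = 1 by rewrite /dual_factor oner_eq0.
have mp := metric_product_inv s.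
have FN : edge_eq 0 (fun m n => (s m n)^-1) F N.
  by apply/(conformal_metric_edge_eq (s := s)) => //; rewrite d0.
have gen : generic (fun m n => (s m n)^-1).
  by apply: cmc_generic FN => // m n; [case: (pl m n)|rewrite invr_eq0].
have [|||a [p [b [q L]]]] := @sphere_lax 0 1 _ F N _ _ _ FN gen F0.
- by rewrite expr0n add0r expr1n.
- exact: oner_neq0.
- by move=> m n; rewrite expr1n; exact: nrm.
have [F' [N' [R3 FN' F0']]] := lawson_euclid L gen.
have [sh cmc'] := edge_eq_qnet FN' gen F0'.
exists F', N'; split=> //.
by apply/(conformal_metric_edge_eq (phi := fun m n => (s m n)^-1)) => //; rewrite d1.
Qed.

Lemma edge_eq_scale (H t : R) phi psi F N : t != 0 ->
  (forall m n, psi m n * psi (m + 1) n = t^-1 * (phi m n * phi (m + 1) n) /\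
               psi m n * psi m (n + 1) = t^-1 * (phi m n * phi m (n + 1))) ->
  edge_eq H phi F N ->
  edge_eq (H / t) psi (fun m n => t *: F m n) N.
Proof.
move=> t0 P E m n; have [-> ->] := P m n; have [-> ->] := E m n.
by split; apply/rowP => i; rewrite !mxE; field.
Qed.

Lemma edges_neq0_scale (t : R) F : t != 0 -> edges_neq0 F ->
  edges_neq0 (fun m n => t *: F m n).
Proof. by move=> t0 F0 m n; have [h1 h2] := F0 m n; rewrite !(inj_eq (scalerI t0)). Qed.

Lemma generic_black_white (t : R) phi : t != 0 -> generic phi ->
  generic (fun m n => black_white t m n * phi m n).
Proof.
move=> t0 gen m n; have [h1 h2 h3] := gen m n.
have b0 := black_white_neq0 m n t0; have b1 := black_white_neq0 (m + 1) n t0.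
have bE : black_white t (m + 1) (n + 1) = black_white t m n.
  rewrite /black_white (_ : m + 1 + (n + 1) = m + n + 1 + 1); last by ring.
  by rewrite !odd_absz_succ negbK.
have bE' : black_white t m (n + 1) = black_white t (m + 1) n.
  by rewrite /black_white addrA addrAC.
by rewrite bE bE' !(inj_eq (mulfI _)) // mulf_neq0.
Qed.

Lemma black_white_mulM (t : R) phi m n :
  black_white t m n * phi m n * (black_white t (m + 1) n * phi (m + 1) n)
   = t * (phi m n * phi (m + 1) n) /\
  black_white t m n * phi m n * (black_white t m (n + 1) * phi m (n + 1))
   = t * (phi m n * phi m (n + 1)).
Proof.
have [b1 b2] := black_whiteM t m n.
by split; rewrite mulrACA (b1, b2).
Qed.

Lemma black_white_equivM (t : R) s : t != 0 ->
  black_white_equiv s (fun m n => black_white t m n * s m n).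
Proof. by move=> t0; exists 1, t; rewrite oner_neq0. Qed.

(** Scaling F by r = sqrt(H^2 + kappa) divides the mean curvature by r and makes the invariant 1;
    the target is scaled back. Each rescaling is matched on phi by a black-white factor, so only
    edge products have to be followed. *)
Lemma lawson (H kappa H' kappa' : R) F N s :
  0 < kappa -> 0 <= kappa' -> H ^+ 2 + kappa = H' ^+ 2 + kappa' ->
  qnet_sphere kappa F N -> noncollinear_faces F ->
  constant_mean_curvature H F N -> conformal_metric H F N s ->
  exists (F' N' : net R) (s' : int -> int -> R),
    [/\ qnet_curvature kappa' F' N', 0 < kappa' -> noncollinear_faces F',
        constant_mean_curvature H' F' N', conformal_metric H' F' N' s'
      & black_white_equiv s s'].
Proof.
move=> k_gt0 k'_ge0 HK [[pl _ F0] nrm] ncol cmc cm; have [s0 _] := cm.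
pose phi m n := black_white (dual_factor H) m n * (s m n)^-1.
have mp : metric_product (dual_factor H) s phi by exact: metric_product_black_white.
have phi0 m n : phi m n != 0.
  by rewrite mulf_neq0 ?invr_eq0 // black_white_neq0 // dual_factor_neq0.
have FN : edge_eq H phi F N by exact/(conformal_metric_edge_eq _ _ s0 mp).
have gen : generic phi.
  by apply: cmc_generic FN => // m n; case: (pl m n).
pose K := H ^+ 2 + kappa; have K0 : 0 < K by rewrite ltr_wpDl ?sqr_ge0.
pose r := Num.sqrt K; have r_gt0 : 0 < r by rewrite sqrtr_gt0.
have r0 : r != 0 by rewrite gt_eqF.
have rr : r ^+ 2 = K by rewrite sqr_sqrtr // ltW.
pose psi m n := black_white r^-1 m n * phi m n.
have ri0 : r^-1 != 0 by rewrite invr_eq0.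
have FN' : edge_eq (H / r) psi (fun m n => r *: F m n) N.
  by apply: (edge_eq_scale r0) FN => m n; exact: black_white_mulM.
have gen' : generic psi by exact: generic_black_white.
pose k := Num.sqrt kappa / r.
have k0 : k != 0 by rewrite mulf_neq0 // gt_eqF // sqrtr_gt0.
have kk : k ^+ 2 = kappa / K by rewrite exprMn sqr_sqrtr ?ltW // exprVn rr.
have K0' : K != 0 by rewrite gt_eqF.
have Hk : (H / r) ^+ 2 + k ^+ 2 = 1.
  by rewrite kk exprMn exprVn rr -mulrDl mulfV.
have nrm' m n : [/\ dot (r *: F m n) (r *: F m n) = (k ^+ 2)^-1,
    dot (N m n) (N m n) = 1 & dot (r *: F m n) (N m n) = 0].
  have [e1 e2 e3] := nrm m n; rewrite !dotE e1 e2 e3 mulr0; split=> //.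
  by rewrite kk mulrA -expr2 rr invfM invrK mulrC.
have [a [p [b [q L]]]] := sphere_lax Hk k0 nrm' FN' gen' (edges_neq0_scale r0 F0).
have dH := dual_factor_neq0 H; have dH' := dual_factor_neq0 H'.
have [k'0|k'0] := eqVneq kappa' 0.
  have H'2 : H' ^+ 2 = K by rewrite /K HK k'0 addr0.
  have H'0 : H' != 0 by rewrite -sqrf_eq0 H'2 gt_eqF.
  have [G [M [R3 GM G0]]] := lawson_euclid L gen'.
  (* In the Euclidean case H'^2 = r^2, and scaling by 1/H' instead of 1/r also covers H' < 0. The
     constant [u] is what turns the product H'/r times [dual_factor H] into H' for the new
     metric. *)
  pose u := r / dual_factor H.
  have u0 : u != 0 by rewrite mulf_neq0 // invr_eq0.
  pose chi m n := black_white H' m n * psi m n.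
  have H'i0 : H'^-1 != 0 by rewrite invr_eq0.
  have GM' : edge_eq H' chi (fun m n => H'^-1 *: G m n) M.
    have := edge_eq_scale (psi := chi) H'i0 _ GM; rewrite mul1r invrK.
    by apply=> m n; exact: black_white_mulM.
  have G0' := edges_neq0_scale H'i0 G0.
  have gchi : generic chi by exact: generic_black_white.
  have [sh cmc'] := edge_eq_qnet GM' gchi G0'.
  exists (fun m n => H'^-1 *: G m n), M, (fun m n => black_white u m n * s m n).
  split=> //.
  - rewrite /qnet_curvature k'0 eqxx; split=> // m n; have [e1 e2 e3] := R3 m n.
    by split=> //; rewrite /in_R3 mxE (e1 : _ = 0) mulr0.
  - by rewrite k'0 ltxx.
  - apply/(conformal_metric_edge_eq (phi := chi)) => // [m n|m n].
      by rewrite mulf_neq0 // black_white_neq0.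
    rewrite /dual_factor (negPf H'0); have [-> ->] := black_white_mulM H' psi m n.
    have [-> ->] := black_white_mulM r^-1 phi m n; have [-> ->] := mp m n.
    have [-> ->] := black_white_mulM u s m n.
    by rewrite /u; split; field; rewrite ?s0 ?dH ?r0.
  - exact: black_white_equivM.
have k'_gt0 : 0 < kappa' by rewrite lt_neqAle eq_sym k'0.
pose k' := Num.sqrt kappa' / r.
have k'n0 : k' != 0 by rewrite mulf_neq0 // gt_eqF // sqrtr_gt0.
have kk' : k' ^+ 2 = kappa' / K by rewrite exprMn sqr_sqrtr ?ltW // exprVn rr.
have Hk' : (H' / r) ^+ 2 + k' ^+ 2 = 1.
  by rewrite kk' exprMn exprVn rr -mulrDl -HK mulfV.
have [G [M [S3 GM G0]]] := lawson_sphere L Hk' k'n0.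
pose chi m n := black_white r m n * psi m n.
have GM' : edge_eq H' chi (fun m n => r^-1 *: G m n) M.
  have := edge_eq_scale (psi := chi) ri0 _ GM; rewrite invrK divfK //.
  by apply=> m n; exact: black_white_mulM.
have G0' := edges_neq0_scale ri0 G0.
have gchi : generic chi by exact: generic_black_white.
have [sh cmc'] := edge_eq_qnet GM' gchi G0'.
have nrm2 m n : [/\ dot (r^-1 *: G m n) (r^-1 *: G m n) = kappa'^-1,
    dot (M m n) (M m n) = 1 & dot (r^-1 *: G m n) (M m n) = 0].
  have [e1 e2 e3] := S3 m n; rewrite !dotE e1 e2 e3 mulr0; split=> //.
  by rewrite kk' -rr; field; rewrite r0 k'0.
(* The factors r and 1/r cancel on edge products, so only the normalisations of the two Christoffel
   duals differ. *)
pose u := dual_factor H' / dual_factor H.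
have u0 : u != 0 by rewrite mulf_neq0 // invr_eq0.
exists (fun m n => r^-1 *: G m n), M, (fun m n => black_white u m n * s m n).
split=> //.
- by rewrite /qnet_curvature (negPf k'0); split.
- move=> _ m n; apply: (face_noncollinear GM' gchi G0' (rho := kappa'^-1)).
  by move=> m' n'; case: (nrm2 m' n').
- apply/(conformal_metric_edge_eq (phi := chi)) => // [m n|m n].
    by rewrite mulf_neq0 // black_white_neq0.
  have [-> ->] := black_white_mulM r psi m n.
  have [-> ->] := black_white_mulM r^-1 phi m n; have [-> ->] := mp m n.
  have [-> ->] := black_white_mulM u s m n.
  by rewrite /u; split; field; rewrite ?s0 ?dH ?dH' ?r0.
- exact: black_white_equivM.
Qed.

End Correspondence.

(** * Immersion formulas *)

Section Derivatives.
Variable R : realType.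
Local Notation C := (R[i]).
Local Notation iC := (iC R).
Implicit Types (f k : R -> R) (F G : R -> C) (t : R).

Lemma eq_rder f k t (df dk : R) : is_derive t 1 f df -> f =1 k -> df = dk ->
  is_derive t 1 k dk.
Proof. by move=> h /funext <- <-. Qed.

Lemma rderD f k t (df dk : R) : is_derive t 1 f df -> is_derive t 1 k dk ->
  is_derive t 1 (fun x => f x + k x) (df + dk).
Proof. by move=> hf hg; exact: is_deriveD. Qed.

Lemma rderN f t (df : R) : is_derive t 1 f df -> is_derive t 1 (fun x => - f x) (- df).
Proof. by move=> hf; exact: is_deriveN. Qed.

Lemma rderM f k t (df dk : R) : is_derive t 1 f df -> is_derive t 1 k dk ->
  is_derive t 1 (fun x => f x * k x) (df * k t + f t * dk).
Proof.
move=> hf hg; apply: (is_derive_eq (is_deriveM _ _)).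
by rewrite addrC /GRing.scale /= mulrC [X in _ + X]mulrC.
Qed.

Definition cder F t (dF : C) :=
  is_derive t (1 : R) (fun g : R => complex.Re (F g) : R) (complex.Re dF : R) /\
  is_derive t (1 : R) (fun g : R => complex.Im (F g) : R) (complex.Im dF : R).

Lemma cder_eq F G t dF dG : cder F t dF -> F =1 G -> dF = dG -> cder G t dG.
Proof. by move=> h /funext <- <-. Qed.

Lemma cder_cst (k : C) t : cder (fun=> k) t 0.
Proof. by split; exact: is_derive_cst. Qed.

Lemma cderD F G t dF dG : cder F t dF -> cder G t dG ->
  cder (fun x => F x + G x) t (dF + dG).
Proof.
move=> [f1 f2] [g1 g2]; split.
- apply: (eq_rder (rderD f1 g1)) => [x|].
    by case: (F x) (G x) => ? ? [].
  by case: dF dG {f1 f2 g1 g2} => ? ? [].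
- apply: (eq_rder (rderD f2 g2)) => [x|].
    by case: (F x) (G x) => ? ? [].
  by case: dF dG {f1 f2 g1 g2} => ? ? [].
Qed.

Lemma cderM F G t dF dG : cder F t dF -> cder G t dG ->
  cder (fun x => F x * G x) t (dF * G t + F t * dG).
Proof.
move=> [f1 f2] [g1 g2]; split.
- apply: (eq_rder (rderD (rderM f1 g1) (rderN (rderM f2 g2)))) => [x|].
    by case: (F x) (G x) => ? ? [].
  by case: dF dG (F t) (G t) {f1 f2 g1 g2} => ? ? [? ?] [? ?] [? ?] /=; ring.
- apply: (eq_rder (rderD (rderM f1 g2) (rderM f2 g1))) => [x|].
    by case: (F x) (G x) => ? ? [].
  by case: dF dG (F t) (G t) {f1 f2 g1 g2} => ? ? [? ?] [? ?] [? ?] /=; ring.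
Qed.

Lemma cderZ (k : C) F t dF : cder F t dF -> cder (fun x => k * F x) t (k * dF).
Proof.
move=> h; apply: (cder_eq (cderM (cder_cst k t) h)) => //.
by rewrite mul0r add0r.
Qed.

Lemma cder_conj F t dF : cder F t dF -> cder (fun x => conjc (F x)) t (conjc dF).
Proof.
move=> [f1 f2]; split.
- by apply: (eq_rder f1) => [x|]; [case: (F x)|case: dF {f1 f2}].
- by apply: (eq_rder (rderN f2)) => [x|]; [case: (F x)|case: dF {f1 f2}].
Qed.

Lemma cderN F t dF : cder F t dF -> cder (fun x => - F x) t (- dF).
Proof.
by move=> h; apply: (cder_eq (cderZ (-1) h)) => [x|]; rewrite mulN1r.
Qed.

Lemma cder_real f t (df : R) : is_derive t 1 f df -> cder (fun x => (f x)%:C%C) t df%:C%C.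
Proof. by move=> h; split=> //=; exact: is_derive_cst. Qed.

Lemma cder_unique F t dF dF' : cder F t dF -> cder F t dF' -> dF = dF'.
Proof.
move=> [f1 f2] [g1 g2]; apply/eqP; rewrite eq_complex.
rewrite -(@derive_val _ _ _ _ _ _ _ f1) -(@derive_val _ _ _ _ _ _ _ f2).
by rewrite (@derive_val _ _ _ _ _ _ _ g1) (@derive_val _ _ _ _ _ _ _ g2) !eqxx.
Qed.

Lemma cder_expi t : cder (@expi R) t (iC * expi t).
Proof.
split=> /=.
- by apply: (is_derive_eq (is_derive_cos t)); ring.
- by apply: (is_derive_eq (is_derive_sin t)); ring.
Qed.

Lemma mx_derivableP (X : R -> 'M[C]_2) t : mx_derivable X t <->
  forall i j, exists d, cder (fun g => X g i j) t d.
Proof.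
split=> [h i j|h i j].
  have [h1 h2] := h i j.
  by exists ('D_1 (fun g => complex.Re (X g i j)) t
    +i* 'D_1 (fun g => complex.Im (X g i j)) t)%C; split; exact/derivableP.
by have [d [h1 h2]] := h i j; split; exact: ex_derive.
Qed.

Lemma mx_deriveE (X : R -> 'M[C]_2) t i j d :
  cder (fun g => X g i j) t d -> mx_derive X t i j = d.
Proof.
move=> [h1 h2]; rewrite mxE !derive1E.
rewrite (@derive_val _ _ _ _ _ _ _ h1) (@derive_val _ _ _ _ _ _ _ h2).
by case: d {h1 h2}.
Qed.

Lemma mx_derive_qm (f h : R -> C) t df dh : cder f t df -> cder h t dh ->
  mx_derive (fun g => qm (f g) (h g)) t = qm df dh.
Proof.
move=> cf ch; rewrite [LHS]mx2_eta; apply: eq_mx2; apply: mx_deriveE.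
- by apply: (cder_eq cf) => // g; rewrite mx2E.
- by apply: (cder_eq ch) => // g; rewrite mx2E.
- by apply: (cder_eq (cderN (cder_conj ch))) => // g; rewrite mx2E.
- by apply: (cder_eq (cder_conj cf)) => // g; rewrite mx2E.
Qed.

Lemma expi_norm t : expi t * conjc (expi t) = 1.
Proof.
apply/eqP; rewrite eq_complex /= mulrN opprK -!expr2 cos2Dsin2 eqxx /=.
by apply/eqP; ring.
Qed.

Lemma expi_sqr t : expi t * expi t = (cos t ^+ 2 - sin t ^+ 2)%:C%C
   + iC * (2 * cos t * sin t)%:C%C.
Proof.
by apply/eqP; rewrite eq_complex /=; apply/andP; split; apply/eqP; ring.
Qed.

Lemma expi0 : expi 0 = 1 :> C.
Proof. by rewrite /expi cos0 sin0. Qed.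

Lemma expiN t : expi (- t) = conjc (expi t).
Proof. by rewrite /expi cosN sinN. Qed.

Lemma cos_sin_pi4 : cos (pi / 4) ^+ 2 - sin (pi / 4) ^+ 2 = 0 :> R /\
  2 * cos (pi / 4) * sin (pi / 4) = 1 :> R.
Proof.
have h : cos (pi / 4 + pi / 4) = 0 :> R /\ sin (pi / 4 + pi / 4) = 1 :> R.
  by rewrite (_ : pi / 4 + pi / 4 = pi / 2 :> R); [rewrite cos_pihalf sin_pihalf|field].
rewrite cosD sinD in h; have [h1 h2] := h.
by split; [rewrite -[RHS]h1|rewrite -[RHS]h2]; ring.
Qed.

Lemma expi_pi4 : expi (pi / 4) * expi (pi / 4) = 0%:C%C + iC * 1%:C%C :> C.
Proof. by rewrite expi_sqr; have [-> ->] := cos_sin_pi4. Qed.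

Section LoopEdge.
Variables (X Y : R -> 'M[C]_2) (a p : C) (c : R) (rho : R -> R).
Hypotheses (SX : forall g, SU2 (X g)) (SY : forall g, SU2 (Y g)).
Hypotheses (dX : forall t, mx_derivable X t) (dY : forall t, mx_derivable Y t).
Hypothesis XY : forall g, Y g = ((rho g)%:C%C *: lax_edge (expi g) a p c) *m X g.

Let D (g : R) := edge_norm a p c (cos g ^+ 2 - sin g ^+ 2).

Let rhoD g : rho g ^+ 2 * D g = 1.
Proof.
have [_ dY1] := SY g; have [_ dX1] := SX g.
move: dY1; rewrite XY det_mulmx dX1 mulr1 /lax_edge qmZ qm_det.
rewrite !(conjcM (rho g)%:C%C) conjc_real => E.
have : ((rho g ^+ 2 * D g)%:C%C : C) = 1.
  rewrite rcM rcX /D -(edge_normE a p c (expi_norm g) (expi_sqr g)) -[RHS]E.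
  by ring.
by move/(congr1 (@complex.Re R)).
Qed.

Let rho_neq0 g : rho g != 0.
Proof.
by apply/eqP => r0; have := rhoD g; rewrite r0 expr0n mul0r => /esym/eqP;
   rewrite oner_eq0.
Qed.

Let D_neq0 g : D g != 0.
Proof.
by apply/eqP => r0; have := rhoD g; rewrite r0 mulr0 => /esym/eqP; rewrite oner_eq0.
Qed.

Let cX i j t : exists d, cder (fun g => X g i j) t d.
Proof. exact: (mx_derivableP X t).1. Qed.

Let cY i j t : exists d, cder (fun g => Y g i j) t d.
Proof. exact: (mx_derivableP Y t).1. Qed.

Let XE g : X g = qm (X g 0 0) (X g 0 1).
Proof. by have /SU2P[f [h [-> _]]] := SX g; rewrite !mx2E. Qed.

Let YE g : Y g = qm (Y g 0 0) (Y g 0 1).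
Proof. by have /SU2P[f [h [-> _]]] := SY g; rewrite !mx2E. Qed.

Lemma cder_weight t : cder (fun g => weight (expi g) c) t
  (- iC * (c%:C%C * conjc (expi t) + expi t)).
Proof.
have := cderD (cderZ c%:C%C (cder_conj (cder_expi t))) (cderN (cder_expi t)).
by move/cder_eq; apply=> //; rewrite conjcM conj_iC; ring.
Qed.

Lemma derivable_norm t : is_derive t 1 D (8 * c * sqn p * cos t * sin t).
Proof.
have hc := is_derive_cos t; have hs := is_derive_sin t.
have k u : is_derive t 1 (fun=> u : R) (0 : R) by exact: is_derive_cst.
have h := rderD (k (sqn a)) (rderM (k (sqn p)) (rderD (k (c ^+ 2 + 1))
  (rderN (rderM (k (2 * c)) (rderD (rderM hc hc) (rderN (rderM hs hs))))))).
apply: (is_derive_eq h) => /=; ring.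
Qed.

(** No regularity of [rho] is given. But Y X^{-1} = [rho] times the edge matrix, and pairing this
    with the edge matrix yields [rho] D as a polynomial in differentiable entries, where D is the
    nowhere vanishing determinant. *)
Lemma derivable_rho t : derivable rho t 1.
Proof.
have rhoE g : rho g = complex.Re ((Y g 0 0 * conjc (X g 0 0)
     + Y g 0 1 * conjc (X g 0 1)) * conjc a
    + (Y g 0 1 * X g 0 0 - Y g 0 0 * X g 0 1)
       * conjc (p * weight (expi g) c)) * (D g)^-1.
  have E : Y g *m qad (X g) = (rho g)%:C%C *: lax_edge (expi g) a p c.
    by rewrite XY -mulmxA (SU2_qadr (SX g)) mulmx1.
  move: E; rewrite {1}XE {1}YE qad_qm qmM /lax_edge qmZ.
  move=> /qm_inj[E1 E2]; apply: (mulIf (D_neq0 g)); rewrite divfK //.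
  set y := complex.Re _; suff : ((rho g * D g)%:C%C : C) = y%:C%C by move/(congr1 (@complex.Re R)).
  rewrite /y; set yc := _ + _ * conjc (p * _).
  have -> : yc = (rho g * D g)%:C%C; last by [].
  rewrite /yc rcM /D -(edge_normE a p c (expi_norm g) (expi_sqr g)).
  have -> : Y g 0 0 * conjc (X g 0 0) + Y g 0 1 * conjc (X g 0 1) = (rho g)%:C%C * a.
    by rewrite -E1 conjcN; ring.
  have -> : Y g 0 1 * X g 0 0 - Y g 0 0 * X g 0 1 = (rho g)%:C%C * (p * weight (expi g) c).
    by rewrite -E2 conjcK; ring.
  by ring.
have [y0 hy0] := cY 0 0 t; have [y1 hy1] := cY 0 1 t.
have [x0 hx0] := cX 0 0 t; have [x1 hx1] := cX 0 1 t.
have [h _] := cderD (cderM (cderD (cderM hy0 (cder_conj hx0))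
  (cderM hy1 (cder_conj hx1))) (cder_cst (conjc a) t))
  (cderM (cderD (cderM hy1 hx0) (cderN (cderM hy0 hx1)))
    (cder_conj (cderZ p (cder_weight t)))).
rewrite (funext rhoE).
have hD := is_deriveV (D_neq0 t) (derivable_norm t).
by have [] := rderM h hD.
Qed.

(** Differentiate [rho]^2 D = 1: the derivative of D carries a factor sin, so the normalisation does
    not contribute to the immersion formula at 0. *)
Lemma rho_derive0 : is_derive (0 : R) 1 rho 0.
Proof.
have h := derivableP (@derivable_rho 0); set d := 'D_1 rho 0 in h.
have := rderM (rderM h h) (derivable_norm 0).
rewrite (_ : (fun x => _) = fun=> 1); last first.
  by apply/funext => g; rewrite -(rhoD g) expr2.
move=> /(@derive_val _ _ _ _ _ _ _).
rewrite derive_cst sin0 !mulr0 addr0 => E.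
apply: (eq_rder h) => //.
have /mulfI : 2 * rho 0 * D 0 != 0 by rewrite !mulf_neq0 ?pnatr_eq0.
by apply; rewrite mulr0 [RHS]E; ring.
Qed.

Lemma rho_pi4 : rho (pi / 4) = rho (- (pi / 4)).
Proof.
have D4 : D (pi / 4) = D (- (pi / 4)) by rewrite /D cosN sinN sqrrN.
have : rho (pi / 4) ^+ 2 == rho (- (pi / 4)) ^+ 2.
  by apply/eqP/(mulIf (D_neq0 (pi / 4))); rewrite rhoD D4 rhoD.
rewrite eqf_sqr => /orP[/eqP //|/eqP E].
have p0 : 0 <= pi / 4 :> R by rewrite divr_ge0 // pi_ge0.
have cont : {within `[- (pi / 4), pi / 4], continuous rho}%classic.
  apply: continuous_subspaceT => x.
  by apply: differentiable_continuous; exact/derivable1_diffP/derivable_rho.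
have le : - (pi / 4) <= pi / 4 :> R by lra.
have [|g _ /eqP] := @IVT _ rho _ _ 0 le cont; last by rewrite (negPf (rho_neq0 g)).
rewrite E; set y := rho _; rewrite ge_min le_max !oppr_ge0 !oppr_le0.
by have [h|h] := leP y 0; rewrite ?h ?(ltW h) ?orbT.
Qed.

(** For Y = U X the logarithmic derivatives differ by Y^{-1} U' X. At 0 only the weight of U varies,
    with derivative -i (c + 1). *)
Lemma loop_edge_derive :
  qad (Y 0) *m mx_derive Y 0 - qad (X 0) *m mx_derive X 0
  = qad (Y 0) *m qm 0 (- iC * ((rho 0)%:C%C * p) * (c + 1)%:C%C) *m X 0.
Proof.
have [x0 hx0] := cX 0 0 0; have [x1 hx1] := cX 0 1 0.
have dXE : mx_derive X 0 = qm x0 x1 by rewrite (funext XE); exact: mx_derive_qm.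
have hr := cder_real rho_derive0; have hw := cder_weight 0.
have hA := cderM hr (cder_cst a 0); have hB := cderM hr (cderZ p hw).
pose A g : C := (rho g)%:C%C * a; pose B g : C := (rho g)%:C%C * (p * weight (expi g) c).
have YE' : Y = fun g => qm (A g * X g 0 0 - B g * conjc (X g 0 1))
    (A g * X g 0 1 + B g * conjc (X g 0 0)).
  by apply/funext => g; rewrite XY {1}XE /lax_edge qmZ qmM.
have dYE : mx_derive Y 0 = ((rho 0)%:C%C *: lax_edge (expi 0) a p c) *m mx_derive X 0
   + qm 0 (- iC * ((rho 0)%:C%C * p) * (c + 1)%:C%C) *m X 0.
  rewrite YE' (mx_derive_qm (cderD (cderM hA hx0) (cderN (cderM hB (cder_conj hx1))))
    (cderD (cderM hA hx1) (cderM hB (cder_conj hx0)))).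
  rewrite dXE [Z in _ = _ + _ *m Z]XE /lax_edge qmZ !qmM qmD expi0 conjc1.
  by apply: eq_qm; rewrite !rcE; ring.
rewrite dYE mulmxDr !mulmxA.
have -> : qad (Y 0) *m ((rho 0)%:C%C *: lax_edge (expi 0) a p c) = qad (X 0).
  have SU : SU2 ((rho 0)%:C%C *: lax_edge (expi 0) a p c).
    rewrite -[_ *: _]mulmx1 -(SU2_qadr (SX 0)) mulmxA -XY.
    by apply: SU2M => //; exact: SU2_qad.
  by rewrite XY qadM -mulmxA (SU2_qadl SU) mulmx1.
by rewrite addrC addKr.
Qed.

End LoopEdge.

End Derivatives.

(** * From Lax matrices and a frame to the pair of nets *)

Section FrameToNets.
Variable R : realType.
Local Notation C := (R[i]).
Local Notation iC := (iC R).
Implicit Types (L : lax_data R).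

Lemma unit_normc (z : C) : `|z| = 1 <-> z * conjc z = 1.
Proof.
split=> [E|E]; first by rewrite -sqr_normc E expr1n.
have : `|z| ^+ 2 == 1 by rewrite sqr_normc E.
by rewrite sqrp_eq1 // => /eqP.
Qed.

(** The Lax matrices are edge matrices with p = u, c = -1/u^2 and p = iv, c = 1/v^2; the signs of c
    thus depend on the direction of the edge. *)
Lemma laxUE L m n (z : C) : lu L m n != 0 -> z * conjc z = 1 ->
  laxU L m n z = ((lalpha L m n z)^-1)%:C%C *:
    lax_edge z (la L m n) (lu L m n)%:C%C (- ((lu L m n) ^+ 2)^-1).
Proof.
move=> u0 z1; have uC : (lu L m n)%:C%C != 0 :> C by rewrite real_eq0.
have z0 : z != 0 by apply: contra_eq_neq z1 => ->; rewrite mul0r eq_sym oner_eq0.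
have zV : z^-1 = conjc z by apply: (mulfI z0); rewrite mulfV // z1.
rewrite /laxU /lax_edge /qm /weight zV; congr (_ *: _); apply: eq_mx2 => //.
  by rewrite !rcE; field.
by rewrite ?conjcE !rcE; field.
Qed.

Lemma laxVE L m n (z : C) : lv L m n != 0 -> z * conjc z = 1 ->
  laxV L m n z = ((lbeta L m n z)^-1)%:C%C *:
    lax_edge z (lb L m n) (iC * (lv L m n)%:C%C) ((lv L m n) ^+ 2)^-1.
Proof.
move=> u0 z1; have uC : (lv L m n)%:C%C != 0 :> C by rewrite real_eq0.
have z0 : z != 0 by apply: contra_eq_neq z1 => ->; rewrite mul0r eq_sym oner_eq0.
have zV : z^-1 = conjc z by apply: (mulfI z0); rewrite mulfV // z1.
rewrite /laxV /lax_edge /qm /weight zV; congr (_ *: _); apply: eq_mx2 => //.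
  by rewrite !rcE; field.
by rewrite ?conjcE conj_iC !rcE; field.
Qed.

Definition lax_metric L (s : int -> int -> R) := forall m n,
  [/\ s m n != 0, s m n * s (m + 1) n = - lu L m n ^+ 2
    & s m n * s m (n + 1) = lv L m n ^+ 2].

(** The diagonal entry of the flatness condition is -iX z^2 + Y + iZ z^{-2}, with X, Y, Z
    independent of z. It vanishes on the circle, hence X = 0, which is the claim. *)
Lemma lax_uv L m n : is_lax L ->
  lu L m n * lu L m (n + 1) = lv L m n * lv L (m + 1) n.
Proof.
move=> [pos lax].
have [u0 v0] := pos m n; have [u0' _] := pos m (n + 1); have [_ v0'] := pos (m + 1) n.
set u := lu L m n in u0 *; set v := lv L m n in v0 *.
set u' := lu L m (n + 1) in u0' *; set v' := lv L (m + 1) n in v0' *.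
pose X : C := (v' / u - u' / v)%:C%C; pose Z : C := (u / v' - v / u')%:C%C.
pose Y : C := lb L (m + 1) n * la L m n - la L m (n + 1) * lb L m n
  - iC * (v' * u - (u * v')^-1 + u' * v - (u' * v)^-1)%:C%C.
have un : u%:C%C != 0 :> C by rewrite real_eq0 gt_eqF.
have vn : v%:C%C != 0 :> C by rewrite real_eq0 gt_eqF.
have un' : u'%:C%C != 0 :> C by rewrite real_eq0 gt_eqF.
have vn' : v'%:C%C != 0 :> C by rewrite real_eq0 gt_eqF.
have u0n : lu L m n != 0 by rewrite gt_eqF.
have v0n : lv L m n != 0 by rewrite gt_eqF.
have u0n' : lu L m (n + 1) != 0 by rewrite gt_eqF.
have v0n' : lv L (m + 1) n != 0 by rewrite gt_eqF.
have E z : z * conjc z = 1 -> - iC * X * (z * z) + Y + iC * Z * (conjc z * conjc z) = 0.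
  move=> z1; have [dU dV aE bE fl] := lax m n z ((unit_normc z).2 z1).
  have kU : ((lalpha L m n z)^-1)%:C%C != 0 :> C.
    by apply/eqP => k0; move: dU; rewrite /laxU k0 scale0r det0 => /eqP;
       rewrite eq_sym oner_eq0.
  have kV : ((lbeta L m n z)^-1)%:C%C != 0 :> C.
    by apply/eqP => k0; move: dV; rewrite /laxV k0 scale0r det0 => /eqP;
       rewrite eq_sym oner_eq0.
  move: fl; rewrite (laxUE (m := m) (n := n) u0n z1).
  rewrite (laxUE (m := m) (n := n + 1) u0n' z1) (laxVE (m := m) (n := n) v0n z1).
  rewrite (laxVE (m := m + 1) (n := n) v0n' z1) -/u -/v -/u' -/v' aE bE.
  rewrite -!scalemxAl -!scalemxAr !scalerA mulrC => /(scalerI (mulf_neq0 kU kV)).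
  rewrite /lax_edge !qmM => /qm_inj[+ _].
  move=> /eqP; rewrite -subr_eq0 => /eqP EE.
  pose Y' : C := lb L (m + 1) n * la L m n - la L m (n + 1) * lb L m n
    - iC * (v' * u - (u * v')^-1 + u' * v - (u' * v)^-1)%:C%C * (z * conjc z).
  have -> : Y = Y' by rewrite /Y /Y' z1 mulr1.
  rewrite -[RHS]EE /Y' /X /Z /weight !conjcE conj_iC !(rcB, rcE).
  by field; rewrite un vn un' vn'.
(* Three sample points with z^2 = 1, -1, i determine the three coefficients. *)
have E1 := E 1; rewrite conjc1 !mulr1 in E1; have {}E1 := E1 erefl.
have E2 := E iC; rewrite conj_iC mulrN iC2 opprK mulrNN iC2 in E2; have {}E2 := E2 erefl.
have E3 := E _ (expi_norm (pi / 4)); rewrite -conjcM expi_pi4 in E3.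
have X0 : X = 0.
  have two : 2 != 0 :> C by rewrite pnatr_eq0.
  apply: (mulfI two); rewrite mulr0.
  have Y0 : Y = 0.
    apply: (mulfI two); rewrite mulr0 -[RHS](addr0 0) -{1}E1 -E2; ring.
  have ZX : iC * (Z - X) = 0 by rewrite -[RHS]E1 Y0; ring.
  have {}ZX : Z = X.
    by move/eqP: ZX; rewrite mulf_eq0 (negPf (iC_neq0 R)) subr_eq0 => /eqP.
  transitivity (- (iC * iC) * X - iC * iC * Z); first by rewrite iC2 ZX; ring.
  rewrite -[RHS]E3 Y0 !conjcE conj_iC.
  have -> : (0%:C%C : C) = 0 by [].
  have -> : (1%:C%C : C) = 1 by [].
  by ring.
move/(congr1 (@complex.Re R)): X0 => /= /eqP; rewrite subr_eq0 => /eqP X0.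
have -> : v * v' = v * (v' / u) * u by field; exact: u0n.
by rewrite X0; field; exact: v0n.
Qed.

(** The prescribed edge products give the steps s -> -u^2/s and s -> v^2/s, which are involutions;
    they are compatible by the square of [lax_uv]. *)
Lemma lax_metric_exists L : is_lax L -> exists s, lax_metric L s.
Proof.
move=> isL; have [pos _] := isL.
have K (t x : R) : t != 0 -> t / (t / x) = x by move=> t0; rewrite invf_div mulrCA mulfV ?mulr1.
have u0 m n : - lu L m n ^+ 2 != 0.
  by rewrite oppr_eq0 sqrf_eq0; have [h _] := pos m n; rewrite gt_eqF.
have v0 m n : lv L m n ^+ 2 != 0.
  by rewrite sqrf_eq0; have [_ h] := pos m n; rewrite gt_eqF.
have flat m n (x : R) : lv L (m + 1) n ^+ 2 / (- lu L m n ^+ 2 / x)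
    = - lu L m (n + 1) ^+ 2 / (lv L m n ^+ 2 / x).
  have := congr1 (fun t => t ^+ 2) (lax_uv m n isL).
  rewrite /= !exprMn; move: (v0 m n) (u0 m n); rewrite oppr_eq0 !invf_div.
  move: (lu L m n ^+ 2) (lu L m (n + 1) ^+ 2) (lv L m n ^+ 2) (lv L (m + 1) n ^+ 2).
  move=> u2 u2' v2 v2' v20 u20 E.
  have -> : v2' = u2 * u2' / v2 by rewrite E; field.
  by field; rewrite u20 v20.
have [s [s0 s1 s2]] := @flat_section _ (1 : R)
  (fun m n x => - lu L m n ^+ 2 / x) (fun m n x => - lu L m n ^+ 2 / x)
  (fun m n x => lv L m n ^+ 2 / x) (fun m n x => lv L m n ^+ 2 / x)
  (fun m n x => K _ x (u0 m n)) (fun m n x => K _ x (u0 m n))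
  (fun m n x => K _ x (v0 m n)) (fun m n x => K _ x (v0 m n)) flat.
have sn0 : forall m n, s m n != 0.
  apply: int2_ind => [|m n|m n]; first by rewrite s0 oner_neq0.
    by rewrite s1 mulf_eq0 (negPf (u0 m n)) invr_eq0.
  by rewrite s2 mulf_eq0 (negPf (v0 m n)) invr_eq0.
exists s => m n; rewrite s1 s2; split=> //; first by field.
by field.
Qed.

(** The sign flips in the first direction and not in the second, so s_12 and s, and likewise s_1 and
    s_2, have opposite signs. *)
Lemma generic_signs (s : int -> int -> R) :
  (forall m n, s m n * s (m + 1) n < 0 /\ 0 < s m n * s m (n + 1)) ->
  generic (fun m n => (s m n)^-1).
Proof.
move=> sg m n; have [h1 h2] := sg m n; have [_ h3] := sg (m + 1) n.
rewrite !(inj_eq invr_inj) invr_eq0; split.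
- by apply: contraTneq h1 => ->; rewrite mul0r ltxx.
- by apply: contraTneq h3 => ->; rewrite mulrC -leNgt ltW.
- by apply: contraTneq h2 => ->; rewrite -leNgt ltW.
Qed.

Section Frame.
Variables (L : lax_data R) (Phi : int -> int -> C -> 'M[C]_2).
Variable s : int -> int -> R.
Hypotheses (isL : is_lax L) (isF : is_frame L Phi) (Ls : lax_metric L s).

Let phi m n := (s m n)^-1.

Let u_neq0 m n : lu L m n != 0. Proof. by have [/(_ m n)[h _] _] := isL; rewrite gt_eqF. Qed.
Let v_neq0 m n : lv L m n != 0. Proof. by have [/(_ m n)[_ h] _] := isL; rewrite gt_eqF. Qed.

Let c1E m n : phi m n * phi (m + 1) n = - (lu L m n ^+ 2)^-1.
Proof. by have [_ E _] := Ls m n; rewrite /phi -invfM E invrN. Qed.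

Let c2E m n : phi m n * phi m (n + 1) = (lv L m n ^+ 2)^-1.
Proof. by have [_ _ E] := Ls m n; rewrite /phi -invfM E. Qed.

Lemma lax_metric_signs m n : s m n * s (m + 1) n < 0 /\ 0 < s m n * s m (n + 1).
Proof.
have [_ -> ->] := Ls m n; rewrite oppr_lt0 !lt_neqAle !sqr_ge0 !andbT.
by rewrite ![0 == _]eq_sym !sqrf_eq0 u_neq0 v_neq0.
Qed.

Let gen : generic phi. Proof. exact/generic_signs/lax_metric_signs. Qed.

Let s_neq0 m n : s m n != 0. Proof. by case: (Ls m n). Qed.

Let SPhi m n g : SU2 (Phi m n (expi g)).
Proof. by have [h _] := isF; have [] := h m n (expi g) ((unit_normc _).2 (expi_norm g)). Qed.

Let dPhi m n t : mx_derivable (fun g => Phi m n (expi g)) t.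
Proof. by have [_ h] := isF. Qed.

Let r1 m n g := (lalpha L m n (expi g))^-1.
Let r2 m n g := (lbeta L m n (expi g))^-1.

Let Phi1 m n g : Phi (m + 1) n (expi g) = ((r1 m n g)%:C%C *:
  lax_edge (expi g) (la L m n) (lu L m n)%:C%C (phi m n * phi (m + 1) n)) *m Phi m n (expi g).
Proof.
have [h _] := isF; have [_ _ -> _] := h m n (expi g) ((unit_normc _).2 (expi_norm g)).
by rewrite (laxUE (u_neq0 m n) (expi_norm g)) c1E.
Qed.

Let Phi2 m n g : Phi m (n + 1) (expi g) = ((r2 m n g)%:C%C *:
  lax_edge (expi g) (lb L m n) (iC * (lv L m n)%:C%C) (phi m n * phi m (n + 1)))
  *m Phi m n (expi g).
Proof.
have [h _] := isF; have [_ _ _ ->] := h m n (expi g) ((unit_normc _).2 (expi_norm g)).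
by rewrite (laxVE (v_neq0 m n) (expi_norm g)) c2E.
Qed.

Let p_neq0 m n : (lu L m n)%:C%C != 0 :> C. Proof. by rewrite real_eq0. Qed.
Let q_neq0 m n : iC * (lv L m n)%:C%C != 0 :> C.
Proof. by rewrite mulf_neq0 ?iC_neq0 ?real_eq0. Qed.

Lemma exp_qkE (t : R) : exp_qk t = qm (conjc (expi t)) 0.
Proof.
rewrite /exp_qk qkE qm1 !qmZ qmD; apply: eq_qm; apply/eqP; rewrite eq_complex /=;
by apply/andP; split; apply/eqP; ring.
Qed.

Lemma S3_immersionE (F N : net R) : S3_immersion Phi F N <->
  forall m n, sphere_frame (expi (pi / 4)) 1 (Phi m n (expi (pi / 4)))
    (Phi m n (expi (- (pi / 4)))) (F m n) (N m n).
Proof.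
have E m n (X : 'M[C]_2) : - (invmx (Phi m n (expi (pi / 4))) *m qk R *m exp_qk (pi / 4) *m X)
    = qad (Phi m n (expi (pi / 4))) *m qm (iC * conjc (expi (pi / 4))) 0 *m X.
  rewrite (SU2_invmx (SPhi _ _ _)) -mulNmx -(mulmxA _ (qk R)) -mulmxN.
  apply: (congr1 (fun Z => _ *m Z *m _)); rewrite exp_qkE qkE qmM qmN.
  by apply: eq_qm; rewrite ?conjcE; ring.
have E' : qm ((1^-1)%:C%C * conjc (expi (pi / 4))) 0 = exp_qk (pi / 4) :> 'M[C]_2.
  by rewrite exp_qkE invr1 mul1r.
split=> [h m n|h z1 z2 M m n]; have [h1 h2] := h m n; split.
- by rewrite E' h1 (SU2_invmx (SPhi _ _ _)).
- by rewrite -E; exact: h2.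
- by rewrite /M /z1 -E' (SU2_invmx (SPhi m n (pi / 4))); exact: h1.
- by rewrite /M /z1 E; exact: h2.
Qed.

Lemma frame_sphere_net : exists F N : net R,
  [/\ S3_immersion Phi F N, [/\ qnet_S3 F N, noncollinear_faces F & minimal F N]
    & conformal_metric 0 F N s].
Proof.
set z := expi (pi / 4 : R); set z' := expi (- (pi / 4) : R).
pose F : net R := fun m n => qpoint (qad (Phi m n z) *m
  qm ((1^-1)%:C%C * conjc z) 0 *m Phi m n z').
pose N : net R := fun m n => qpoint (qad (Phi m n z) *m
  qm (iC * conjc z) 0 *m Phi m n z').
have AB m n : sphere_frame z 1 (Phi m n z) (Phi m n z') (F m n) (N m n).
  by split; rewrite qpointK //; apply: is_quat_frame; exact: SPhi.
have z1 := expi_norm (pi / 4 : R); have z2 := expi_pi4 R.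
have zE : z' = conjc z by rewrite /z' expiN.
have W c : weight z' c = conjc (weight z c) by rewrite zE conj_weight /weight conjcK.
have o0 := oner_neq0 R.
have edge m n m' n' u v c (r : R -> R) : v != 0 ->
   (forall g, Phi m' n' (expi g) = ((r g)%:C%C *: lax_edge (expi g) u v c) *m Phi m n (expi g)) ->
   N m' n' - N m n = (c - 0) *: (F m' n' - F m n) /\ F m' n' != F m n.
  move=> v0 E; have Ez := E (pi / 4); have Ez' := E (- (pi / 4)).
  (* With equal factors at both parameters, the transition matrices of the two frames share the same
     a and p, as [sphere_edge] requires. *)
  have rE := rho_pi4 (SPhi m n) (SPhi m' n') (dPhi m n) (dPhi m' n') E.
  have AB' := AB m' n'; rewrite -rE -/z -/z' in Ez Ez'; rewrite Ez Ez' in AB'.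
  have SU : SU2 ((r (pi / 4))%:C%C *: lax_edge z u v c).
    rewrite -[_ *: _]mulmx1 -(SU2_qadr (SPhi m n (pi / 4))) mulmxA -Ez.
    by apply: SU2M; [exact: SPhi|exact/SU2_qad/SPhi].
  have r0 : r (pi / 4) != 0.
    apply/eqP => r0; case: SU => _; rewrite r0 scale0r det0 => /eqP.
    by rewrite eq_sym oner_eq0.
  move: AB' SU; rewrite !lax_edgeZ /lax_edge W => AB' SU; split.
    exact: (sphere_edge_normal z1 z2 o0 SU (AB m n) AB' erefl erefl).
  apply: (sphere_edge_neq z2 o0 (SPhi m n _) (SPhi m n _) SU (AB m n) AB' erefl erefl).
  by rewrite mulf_neq0 // real_eq0.
have FN : edge_eq 0 phi F N.
  move=> m n; split.
    by have [] := edge _ _ _ _ _ _ _ _ (p_neq0 m n) (Phi1 m n).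
  by have [] := edge _ _ _ _ _ _ _ _ (q_neq0 m n) (Phi2 m n).
have F0 : edges_neq0 F.
  move=> m n; split.
    by have [] := edge _ _ _ _ _ _ _ _ (p_neq0 m n) (Phi1 m n).
  by have [] := edge _ _ _ _ _ _ _ _ (q_neq0 m n) (Phi2 m n).
have nrm m n : [/\ dot (F m n) (F m n) = 1^-1, dot (N m n) (N m n) = 1
    & dot (F m n) (N m n) = 0].
  by have := frame_norms z1 o0 (SPhi m n _) (SPhi m n _) (AB m n); rewrite expr1n.
have [sh cmc] := edge_eq_qnet FN gen F0.
exists F, N; split.
- exact/S3_immersionE.
- split=> //; move=> m n; apply: (face_noncollinear FN gen F0 (rho := 1^-1)).
  by move=> m' n'; case: (nrm m' n').
- apply/(conformal_metric_edge_eq (phi := phi)) => //.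
  by rewrite /dual_factor eqxx; exact: metric_product_inv.
Qed.

Lemma frame_euclid_net : exists F N : net R,
  [/\ R3_immersion Phi F N, qnet_R3 F N /\ constant_mean_curvature 1 F N
    & conformal_metric 1 F N s].
Proof.
pose X m n g := Phi m n (expi g).
have NE m n : - (invmx (X m n 0) *m qk R *m X m n 0) =
    qad (X m n 0) *m qm (1%:C%C * iC) 0 *m X m n 0.
  rewrite (SU2_invmx (SPhi m n 0)) -mulNmx -mulmxN.
  apply: (congr1 (fun Z => _ *m Z *m _)).
  by rewrite qkE qmN; apply: eq_qm; rewrite ?oppr0 // opprK mul1r.
have [N quatN'] : exists N : net R, forall m n,
    quat (N m n) = qad (X m n 0) *m qm (1%:C%C * iC) 0 *m X m n 0.
  exists (fun m n => qpoint (qad (X m n 0) *m qm (1%:C%C * iC) 0 *m X m n 0)).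
  by move=> m n; rewrite qpointK //; apply: is_quat_frame; exact: SPhi.
have XE m n g : X m n g = qm (X m n g 0 0) (X m n g 0 1).
  by have /SU2P[f [h [E _]]] := SPhi m n g; rewrite /X E !mx2E.
have dX m n : exists f h f' h', [/\ X m n 0 = qm f h, mx_derive (X m n) 0 = qm f' h'
    & f' * conjc f + f * conjc f' + h' * conjc h + h * conjc h' = 0].
  have [f' hf] := (mx_derivableP (X m n) 0).1 (dPhi m n 0) 0 0.
  have [h' hh] := (mx_derivableP (X m n) 0).1 (dPhi m n 0) 0 1.
  exists (X m n 0 0 0), (X m n 0 0 1), f', h'; split.
  - exact: XE.
  - by rewrite (funext (XE m n)); exact: mx_derive_qm.
  - have := cderD (cderM hf (cder_conj hf)) (cderM hh (cder_conj hh)).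
    move=> E; have := cder_unique (cder_eq E _ erefl) (cder_cst 1 0).
    rewrite !addrA; apply=> g; have /SU2P[f [h [Eg fh]]] := SPhi m n g.
    by rewrite /X Eg !mx2E.
(* The logarithmic derivative is imaginary because the unit norm has derivative 0. *)
have imag m n : qad (qad (X m n 0) *m mx_derive (X m n) 0)
    = - (qad (X m n 0) *m mx_derive (X m n) 0).
  have [f [h [f' [h' [-> -> E]]]]] := dX m n.
  rewrite qad_qm qmM qad_qm qmN; apply: eq_qm; rewrite ?conjcE; last by [].
  by apply/eqP; rewrite -subr_eq0 -[X in _ == X]E; apply/eqP; ring.
have [F quatF] : exists F : net R, forall m n, quat (F m n) =
   - (qad (X m n 0) *m mx_derive (X m n) 0) - (2^-1 : R)%:C%C *: quat (N m n).
  exists (fun m n => qpoint (- (qad (X m n 0) *m mx_derive (X m n) 0)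
     - (2^-1 : R)%:C%C *: quat (N m n))) => m n.
  rewrite qpointK //; have [f [h [f' [h' [-> -> _]]]]] := dX m n.
  apply: is_quatD; apply: is_quatN; last exact/is_quatZ/quat_is_quat.
  by apply: is_quatM; [apply: is_quat_qad|]; exact: is_quat_qm.
have N3' m n : qad (quat (N m n)) = - quat (N m n).
  rewrite quatN' !qadM qadK -mulNmx -mulmxN mulmxA.
  apply: (congr1 (fun Z => _ *m Z *m _)).
  by rewrite qad_qm qmN !conjcE conj_iC mulrN.
have N3 m n : in_R3 (N m n) by exact: in_R3_qad.
have F3 m n : in_R3 (F m n).
  apply: in_R3_qad; rewrite quatF qadD !qadN qadZ imag N3'.
  by apply/matrixP => i j; rewrite !mxE; ring.
have NN m n : dot (N m n) (N m n) = 1.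
  rewrite (dot_frame (SPhi m n 0) (SPhi m n 0) (quatN' m n) (quatN' m n)).
  by rewrite mul0r addr0 !conjcE conj_iC !mul1r mulrN iC2 opprK.
have edge m n m' n' u v c (r : R -> R) : v != 0 ->
   (forall g, X m' n' g = ((r g)%:C%C *: lax_edge (expi g) u v c) *m X m n g) ->
   N m' n' - N m n = (c - 1) *: (F m' n' - F m n) /\ F m' n' != F m n.
  move=> v0 E; have E0 := E 0; rewrite expi0 lax_edgeZ in E0.
  set U := lax_edge 1 _ _ c in E0.
  have SU : SU2 U.
    rewrite -[U]mulmx1 -(SU2_qadr (SPhi m n 0)) mulmxA -E0.
    by apply: SU2M; [exact: SPhi|exact/SU2_qad/SPhi].
  have r0 : r 0 != 0.
    apply/eqP => r0; have [_] := SU; rewrite /U r0 -lax_edgeZ scale0r det0 => /eqP.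
    by rewrite eq_sym oner_eq0.
  have dN := @euclid_normal_step _ (X m n 0) U _ _ c 1 SU erefl.
  rewrite -E0 -!quatN' in dN.
  have dF := loop_edge_derive (SPhi m n) (SPhi m' n') (dPhi m n) (dPhi m' n') E.
  have FE : quat (F m' n' - F m n) = qad (X m' n' 0) *m
      qm 0 (2 * iC * 1%:C%C * ((r 0)%:C%C * v)) *m X m n 0.
    rewrite quatB !quatF.
    transitivity (- (qad (X m' n' 0) *m mx_derive (X m' n') 0
        - qad (X m n 0) *m mx_derive (X m n) 0)
      - (2^-1 : R)%:C%C *: (quat (N m' n') - quat (N m n))).
      by apply/matrixP => i j; rewrite !mxE; ring.
    (* The derivative contributes ip (c + 1) and the term -N/2 contributes -ip (c - 1). Their sum
       2ip is free of c, and it is the quotient of the increment of N by c - 1. *)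
    rewrite dF dN scalerA -mulNmx -mulmxN scalemxAl scalemxAr -mulmxBl -mulmxBr.
    apply: (congr1 (fun Z => _ *m Z *m _)); rewrite -rcM qmN qmZ qmB.
    apply: eq_qm; first by ring.
    transitivity (iC * ((r 0)%:C%C * v) * (c + 1)%:C%C
      - (2^-1 * 2)%:C%C * ((c - 1)%:C%C * (iC * ((r 0)%:C%C * v)))).
      by rewrite !rcM rc_nat; ring.
    by rewrite mulVf ?pnatr_eq0 // rcB rcD; ring.
  split; first by apply: quat_inj; rewrite quatB quatZ FE dN.
  rewrite -subr_eq0 -quat_eq0 FE; apply/eqP.
  move=> /(congr1 (fun Z => X m' n' 0 *m Z *m qad (X m n 0))).
  rewrite mulmx0 mul0mx !mulmxA (SU2_qadr (SPhi _ _ _)) mul1mx -mulmxA.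
  rewrite (SU2_qadr (SPhi _ _ _)) mulmx1 qm0 => /qm_inj[_ /eqP].
  by apply/negP; rewrite !mulf_neq0 ?iC_neq0 ?real_eq0 ?pnatr_eq0 ?oner_eq0.
have FN : edge_eq 1 phi F N.
  move=> m n; split.
    by have [] := edge _ _ _ _ _ _ _ _ (p_neq0 m n) (Phi1 m n).
  by have [] := edge _ _ _ _ _ _ _ _ (q_neq0 m n) (Phi2 m n).
have F0 : edges_neq0 F.
  move=> m n; split.
    by have [] := edge _ _ _ _ _ _ _ _ (p_neq0 m n) (Phi1 m n).
  by have [] := edge _ _ _ _ _ _ _ _ (q_neq0 m n) (Phi2 m n).
have [sh cmc] := edge_eq_qnet FN gen F0.
exists F, N; split.
- move=> m n Y; split; first by rewrite quatN' NE.
  by rewrite quatF (SU2_invmx (SPhi m n 0)).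
- by [].
- apply/(conformal_metric_edge_eq (phi := phi)) => //.
  by rewrite /dual_factor oner_eq0; exact: metric_product_inv.
Qed.

End Frame.
End FrameToNets.

(** * Frames of minimal nets *)

Section Loops.
Variable R : realType.
Local Notation C := (R[i]).
Local Notation iC := (iC R).

Lemma sigma3_qm (a p : C) : sigma3 R *m qm a p *m sigma3 R = qm a (- p).
Proof. by rewrite /sigma3 /qm !mx2M; apply: eq_mx2; rewrite ?conjcE; ring. Qed.

Lemma sigma3_sqr : sigma3 R *m sigma3 R = 1%:M.
Proof. by rewrite /sigma3 mx2M mx2_scalar; apply: eq_mx2; ring. Qed.

Lemma sigma3M (X Y : 'M[C]_2) : sigma3 R *m (X *m Y) *m sigma3 R
  = (sigma3 R *m X *m sigma3 R) *m (sigma3 R *m Y *m sigma3 R).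
Proof.
by rewrite -!mulmxA (mulmxA (sigma3 R) (sigma3 R)) sigma3_sqr mul1mx.
Qed.

Definition smooth_quat (X : R -> 'M[C]_2) := exists f h : R -> C,
  [/\ forall g, X g = qm (f g) (h g), forall t, exists d, cder f t d
    & forall t, exists d, cder h t d].

Lemma smooth_quatM X Y : smooth_quat X -> smooth_quat Y ->
  smooth_quat (fun g => X g *m Y g).
Proof.
move=> [f [h [XE df dh]]] [f' [h' [YE df' dh']]].
exists (fun g => f g * f' g + - (h g * conjc (h' g))).
exists (fun g => f g * h' g + h g * conjc (f' g)); split=> [g|t|t].
- by rewrite XE YE qmM.
- have [a da] := df t; have [b db] := dh t; have [a' da'] := df' t.
  have [b' db'] := dh' t; eexists.
  exact: (cderD (cderM da da') (cderN (cderM db (cder_conj db')))).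
- have [a da] := df t; have [b db] := dh t; have [a' da'] := df' t.
  have [b' db'] := dh' t; eexists.
  exact: (cderD (cderM da db') (cderM db (cder_conj da'))).
Qed.

Lemma smooth_quat_qad X : smooth_quat X -> smooth_quat (fun g => qad (X g)).
Proof.
move=> [f [h [XE df dh]]].
exists (fun g => conjc (f g)), (fun g => - h g); split=> [g|t|t].
- by rewrite XE qad_qm.
- by have [a da] := df t; eexists; exact: (cder_conj da).
- by have [a da] := dh t; eexists; exact: (cderN da).
Qed.

Lemma smooth_quat_eq X Y : smooth_quat X -> X =1 Y -> smooth_quat Y.
Proof. by move=> h /funext <-. Qed.

Lemma smooth_quat_derivable X t : smooth_quat X -> mx_derivable X t.
Proof.
move=> [f [h [XE df dh]]]; rewrite (funext XE); apply/mx_derivableP => i j.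
have [a da] := df t; have [b db] := dh t.
have K (i' j' : 'I_2) : i = i' -> j = j' ->
    (exists d, cder (fun g => qm (f g) (h g) i' j') t d) ->
    exists d, cder (fun g => qm (f g) (h g) i j) t d by move=> -> ->.
have [i0|i1] := eqVneq i 0; have [j0|j1] := eqVneq j 0.
- by apply: (K 0 0) => //; exists a; apply: (cder_eq da) => // g; rewrite mx2E.
- apply: (K 0 1) => //; first by apply/val_inj; case: j j1 {K} => [[|[|]]].
  by exists b; apply: (cder_eq db) => // g; rewrite mx2E.
- apply: (K 1 0) => //; first by apply/val_inj; case: i i1 {K} => [[|[|]]].
  exists (- conjc b); apply: (cder_eq (cderN (cder_conj db))) => // g.
  by rewrite mx2E.
- apply: (K 1 1) => //.
  + by apply/val_inj; case: i i1 {K} => [[|[|]]].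
  + by apply/val_inj; case: j j1 {K} => [[|[|]]].
  by exists (conjc a); apply: (cder_eq (cder_conj da)) => // g; rewrite mx2E.
Qed.

Lemma circle_angle (x y : R) : x ^+ 2 + y ^+ 2 = 1 ->
  exists t, cos t = x /\ sin t = y.
Proof.
move=> xy.
have x1 : -1 <= x <= 1.
  by rewrite -ler_norml -(@ler_pXn2r _ 2) ?nnegrE // expr1n real_normK ?num_real //
     -xy lerDl sqr_ge0.
have cx : cos (acos x) = x by exact: acosK.
have : sin (acos x) ^+ 2 = y ^+ 2.
  by have := cos2Dsin2 (acos x); rewrite cx -xy => /addrI.
move=> /eqP; rewrite eqf_sqr => /orP[/eqP E|/eqP E].
  by exists (acos x).
by exists (- acos x); rewrite cosN sinN E opprK.
Qed.

Lemma polar (a : C) : exists t, a = expi t * (Num.sqrt (sqn a))%:C%C.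
Proof.
have [->|a0] := eqVneq a 0.
  exists 0; have -> : sqn (0 : C) = 0 by apply/eqP; rewrite sqn_eq0.
  by rewrite sqrtr0 mulr0.
pose r := Num.sqrt (sqn a); have r0 : r != 0 by rewrite gt_eqF // sqrtr_gt0 sqn_gt0.
have sE : sqn a = complex.Re a ^+ 2 + complex.Im a ^+ 2.
  by case: a {a0 r r0} => x y; rewrite /sqn /=; ring.
have [|t [ct st]] := @circle_angle (complex.Re a / r) (complex.Im a / r).
  by rewrite !exprMn -mulrDl -sE exprVn sqr_sqrtr ?sqn_ge0 // mulfV // sqn_eq0.
exists t; rewrite -/r /expi ct st; case: a {a0 sE ct st} r r0 => x y r r0 /=.
by apply/eqP; rewrite eq_complex /=; apply/andP; split; apply/eqP; field.
Qed.

(** Euler angles: y comes from the moduli of a and p, and x, w are half the sum and half the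
    difference of their arguments. *)
Lemma euler (a p : C) : unit_norm a p -> exists x y w,
  qm a p = qm (expi x) 0 *m qm (cos y)%:C%C (sin y)%:C%C *m qm (expi w) 0.
Proof.
move=> ap; have [t1 E1] := polar a; have [t2 E2] := polar p.
have [|y [cy sy]] := @circle_angle (Num.sqrt (sqn a)) (Num.sqrt (sqn p)).
  rewrite !sqr_sqrtr ?sqn_ge0 //.
  have : ((sqn a + sqn p)%:C%C : C) = 1 by rewrite rcD !sqnE.
  by move/(congr1 (@complex.Re R)).
exists ((t1 + t2) / 2), y, ((t1 - t2) / 2).
have eD (u v : R) : expi (u + v) = expi u * expi v.
  rewrite /expi cosD sinD; apply/eqP; rewrite eq_complex /=.
  by apply/andP; split; apply/eqP; ring.
rewrite !qmM; apply: eq_qm; rewrite ?conjcE.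
  rewrite {1}E1 -cy {1}(_ : t1 = (t1 + t2) / 2 + (t1 - t2) / 2); last by field.
  by rewrite eD; ring.
rewrite {1}E2 -sy -expiN.
rewrite {1}(_ : t2 = (t1 + t2) / 2 + - ((t1 - t2) / 2)); last by field.
by rewrite eD; ring.
Qed.

Lemma cder_expi_comp (f : R -> R) (t df : R) : is_derive t 1 f df ->
  cder (fun g => expi (f g)) t (df%:C%C * (iC * expi (f t))).
Proof.
move=> hf; split=> /=.
- apply: (eq_rder (is_derive1_comp (is_derive_cos (f t)) hf)) => //.
  by rewrite /=; ring.
- apply: (eq_rder (is_derive1_comp (is_derive_sin (f t)) hf)) => //.
  by rewrite /=; ring.
Qed.

Definition twisted_loop (f : C -> 'M[C]_2) :=
  [/\ forall z, SU2 (f z), forall z, f (- z) = sigma3 R *m f z *m sigma3 R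
    & smooth_quat (fun g => f (expi g))].

Lemma twisted_loopM f f' : twisted_loop f -> twisted_loop f' ->
  twisted_loop (fun z => f z *m f' z).
Proof.
move=> [S1 t1 d1] [S2 t2 d2]; split=> [z|z|]; first exact: SU2M.
  by rewrite t1 t2 sigma3M.
exact: smooth_quatM.
Qed.

(** A diagonal loop is twisted when its angle is even in z; 2 Re z Im z = sin(2 gamma) is even and
    equals 1 and -1 at the two parameters. *)
Lemma diagonal_loop (x y : R) : exists f, [/\ twisted_loop f,
  f (expi (pi / 4)) = qm (expi x) 0 & f (expi (- (pi / 4))) = qm (expi y) 0].
Proof.
pose h (z : C) := (x + y) / 2 + (x - y) / 2 * (2 * complex.Re z * complex.Im z).
have [_ E] := cos_sin_pi4 R.
exists (fun z => qm (expi (h z)) 0); split; last 2 first.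
- by rewrite /h /= E; congr (qm (expi _) 0); field.
- by rewrite /h /= cosN sinN mulrN E; congr (qm (expi _) 0); field.
split=> [z|z|].
- by apply: SU2_qm; rewrite /unit_norm expi_norm mul0r addr0.
- by rewrite sigma3_qm oppr0; congr (qm (expi _) 0); case: z => u v; rewrite /h /=; ring.
- exists (fun g => expi (h (expi g))), (fun=> 0); split=> // t; last first.
    by eexists; exact: cder_cst.
  have hc := is_derive_cos t; have hs := is_derive_sin t.
  have k u : is_derive t 1 (fun=> u : R) (0 : R) by exact: is_derive_cst.
  eexists; exact: (cder_expi_comp
    (rderD (k _) (rderM (k _) (rderM (rderM (k 2) hc) hs)))).
Qed.

(** Here twisting requires an angle that is odd in z, so a combination of cos gamma and sin gamma
    interpolates. *)
Lemma rotation_loop (x y : R) : exists f, [/\ twisted_loop f,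
  f (expi (pi / 4)) = qm (cos x)%:C%C (sin x)%:C%C
  & f (expi (- (pi / 4))) = qm (cos y)%:C%C (sin y)%:C%C].
Proof.
have [_ E] := cos_sin_pi4 R.
have c0 : cos (pi / 4) != 0 :> R.
  by apply/eqP => c0; move: E; rewrite c0 mulr0 mul0r => /esym/eqP; rewrite oner_eq0.
have s0 : sin (pi / 4) != 0 :> R.
  by apply/eqP => s0; move: E; rewrite s0 mulr0 => /esym/eqP; rewrite oner_eq0.
pose h (z : C) := (x + y) / (2 * cos (pi / 4)) * complex.Re z
  + (x - y) / (2 * sin (pi / 4)) * complex.Im z.
have h1 : h (expi (pi / 4)) = x by rewrite /h /=; field; rewrite c0 s0.
have h2 : h (expi (- (pi / 4))) = y by rewrite /h /= cosN sinN; field; rewrite c0 s0.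
exists (fun z => qm (cos (h z))%:C%C (sin (h z))%:C%C); split; last 2 first.
- by rewrite h1.
- by rewrite h2.
split=> [z|z|].
- by apply: SU2_qm; rewrite /unit_norm !conjcE -!rcM -rcD -!expr2 cos2Dsin2.
- have -> : h (- z) = - h z by case: z => u v; rewrite /h /=; ring.
  by rewrite sigma3_qm cosN sinN rcN.
- exists (fun g => (cos (h (expi g)))%:C%C), (fun g => (sin (h (expi g)))%:C%C).
  have hd (t : R) : exists d, is_derive t 1 (fun g : R => h (expi g)) (d : R).
    have k u : is_derive t 1 (fun=> u : R) (0 : R) by exact: is_derive_cst.
    by eexists; exact: (rderD (rderM (k _) (is_derive_cos t)) (rderM (k _) (is_derive_sin t))).
  split=> // t; have [d td] := hd t.
    by eexists; exact: (cder_real (is_derive1_comp (is_derive_cos _) td)).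
  by eexists; exact: (cder_real (is_derive1_comp (is_derive_sin _) td)).
Qed.

(* Two spectral values do not constrain a twisted loop: interpolate the Euler
   angles of the two matrices. *)
Lemma interpolating_loop (A B : 'M[C]_2) : SU2 A -> SU2 B ->
  exists f, [/\ twisted_loop f, f (expi (pi / 4)) = A & f (expi (- (pi / 4))) = B].
Proof.
move=> /SU2P[a [p [-> /euler[x [y [w ->]]]]]] /SU2P[b [q [-> /euler[x' [y' [w' ->]]]]]].
have [f1 [l1 e1 e1']] := diagonal_loop x x'.
have [f2 [l2 e2 e2']] := rotation_loop y y'.
have [f3 [l3 e3 e3']] := diagonal_loop w w'.
exists (fun z => f1 z *m f2 z *m f3 z); rewrite e1 e2 e3 e1' e2' e3'; split=> //.
by apply: twisted_loopM => //; exact: twisted_loopM.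
Qed.

End Loops.

(** * Gauging the edge matrices to the form of Lax matrices *)

Section GaugeFixing.
Variable R : realType.
Local Notation C := (R[i]).
Local Notation iC := (iC R).
Variables (z : C) (H k : R).
Hypotheses (z1 : z * conjc z = 1) (z2 : z * z = H%:C%C + iC * k%:C%C).
Hypothesis k0 : k != 0.
Variables (phi : int -> int -> R) (F N : net R).
Hypothesis nrm : forall m n, [/\ dot (F m n) (F m n) = (k ^+ 2)^-1,
  dot (N m n) (N m n) = 1 & dot (F m n) (N m n) = 0].
Hypotheses (FN : edge_eq H phi F N) (gen : generic phi) (F0 : edges_neq0 F).
Hypothesis sgn : forall m n,
  phi m n * phi (m + 1) n < 0 /\ 0 < phi m n * phi m (n + 1).

Let sg12 m n : phi (m + 1) n * phi m (n + 1) < 0.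
Proof.
have [h1 h2] := sgn m n.
have : phi m n ^+ 2 * (phi (m + 1) n * phi m (n + 1)) < 0.
  have -> : phi m n ^+ 2 * (phi (m + 1) n * phi m (n + 1))
    = (phi m n * phi (m + 1) n) * (phi m n * phi m (n + 1)) by ring.
  by rewrite nmulr_rlt0.
by rewrite pmulr_rlt0 // lt_neqAle sqr_ge0 eq_sym sqrf_eq0; have [-> _ _] := gen m n.
Qed.

(* The off-diagonal entries of the Lax matrices are made positive, respectively
   [i] times positive, by a diagonal gauge transformation; the cross relation
   [lax_cross] is its integrability condition. *)
Lemma gauge_fixed_lax : exists A B a b (P Q : int -> int -> R),
  [/\ forall m n, [/\ SU2 (A m n), SU2 (B m n), 0 < P m n & 0 < Q m n],
      forall m n, sphere_frame z k (A m n) (B m n) (F m n) (N m n),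
      lax_system phi a (fun m n => (P m n)%:C%C) b (fun m n => iC * (Q m n)%:C%C),
      forall m n, let c := phi m n * phi (m + 1) n in
      [/\ A (m + 1) n = lax_edge z (a m n) (P m n)%:C%C c *m A m n,
          B (m + 1) n = lax_edge (conjc z) (a m n) (P m n)%:C%C c *m B m n
        & edge_norm (a m n) (P m n)%:C%C c H = 1]
    & forall m n, let c := phi m n * phi m (n + 1) in
      [/\ A m (n + 1) = lax_edge z (b m n) (iC * (Q m n)%:C%C) c *m A m n,
          B m (n + 1) = lax_edge (conjc z) (b m n) (iC * (Q m n)%:C%C) c *m B m n
        & edge_norm (b m n) (iC * (Q m n)%:C%C) c H = 1]].
Proof.
have /choice[AB ABP] : forall mn : int * int, exists AB : 'M[C]_2 * 'M[C]_2,
   [/\ SU2 AB.1, SU2 AB.2 & sphere_frame z k AB.1 AB.2 (F mn.1 mn.2) (N mn.1 mn.2)].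
  move=> [m n]; have [dF dN dFN] := nrm m n.
  by have [A [B AB]] := sphere_frame_exists z1 k0 dF dN dFN; exists (A, B).
pose A0 m n := (AB (m, n)).1; pose B0 m n := (AB (m, n)).2.
have SA0 m n : SU2 (A0 m n) by have [] := ABP (m, n).
have SB0 m n : SU2 (B0 m n) by have [] := ABP (m, n).
have AB0 m n : sphere_frame z k (A0 m n) (B0 m n) (F m n) (N m n) by have [] := ABP (m, n).
have [a0 [p0 [b0 [q0 [L0 e1 e2]]]]] := lax_system_exists z1 z2 k0 SA0 SB0 AB0 FN gen F0.
pose np m n : R := Num.sqrt (sqn (p0 m n)); pose nq m n : R := Num.sqrt (sqn (q0 m n)).
have np0 m n : 0 < np m n by rewrite sqrtr_gt0 sqn_gt0 // (lax_p L0).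
have nq0 m n : 0 < nq m n by rewrite sqrtr_gt0 sqn_gt0 // (lax_q L0).
have np2 m n : p0 m n * conjc (p0 m n) = (np m n)%:C%C ^+ 2.
  by rewrite -rcX sqr_sqrtr ?sqn_ge0 // sqnE.
have nq2 m n : q0 m n * conjc (q0 m n) = (nq m n)%:C%C ^+ 2.
  by rewrite -rcX sqr_sqrtr ?sqn_ge0 // sqnE.
have p00 m n := lax_p L0 m n; have q00 m n := lax_q L0 m n.
have pc0 m n : conjc (p0 m n) != 0 by rewrite conjc_eq0.
have qc0 m n : conjc (q0 m n) != 0 by rewrite conjc_eq0.
(* A diagonal gauge g replaces p by g g_1 p, so p becomes |p| when g_1 = t1 g^*, and q becomes i |q|
   when g_2 = t2 g^*. *)
pose t1 m n : C := (np m n)%:C%C / p0 m n.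
pose t2 m n : C := iC * (nq m n)%:C%C / q0 m n.
have t1u m n : t1 m n * conjc (t1 m n) = 1.
  rewrite /t1 !conjcE mulrACA -invfM np2 -expr2 mulfV // expf_neq0 // real_eq0.
  by rewrite gt_eqF.
have t2u m n : t2 m n * conjc (t2 m n) = 1.
  rewrite /t2 !conjcE conj_iC.
  transitivity (- (iC * iC) * ((nq m n)%:C%C ^+ 2 / (q0 m n * conjc (q0 m n)))).
    by field; rewrite q00 qc0.
  by rewrite iC2 opprK mul1r nq2 mulfV // expf_neq0 // real_eq0 gt_eqF.
have K (t x : C) : t * conjc t = 1 -> t * conjc (t * conjc x) = x.
  by move=> tt; rewrite !conjcE mulrA tt mul1r.
(* The moduli of [lax_cross] give this up to sign, and phi_1 phi_2 < 0 selects the minus. It matches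
   i against its conjugate -i in the compatibility of the two gauge steps. *)
have cross m n : nq (m + 1) n * np m n * phi (m + 1) n
    = - (np m (n + 1) * nq m n * phi m (n + 1)).
  have E := lax_cross L0 m n.
  have : (nq (m + 1) n * np m n * phi (m + 1) n) ^+ 2
      == (np m (n + 1) * nq m n * phi m (n + 1)) ^+ 2.
    suff : (((nq (m + 1) n * np m n * phi (m + 1) n) ^+ 2)%:C%C : C)
      = ((np m (n + 1) * nq m n * phi m (n + 1)) ^+ 2)%:C%C.
      by move/(congr1 (@complex.Re R)) => /= ->.
    have := congr1 (fun x => x * conjc x) E; rewrite /= !conjcE => E'.
    rewrite !rcX !rcM !exprMn -!nq2 -!np2.
    transitivity (q0 (m + 1) n * conjc (p0 m n) * (phi (m + 1) n)%:C%C *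
      (conjc (q0 (m + 1) n) * p0 m n * (phi (m + 1) n)%:C%C)); first by ring.
    by rewrite E'; ring.
  rewrite eqf_sqr => /orP[/eqP EE|/eqP //].
  have h : (nq (m + 1) n * np m n) * (np m (n + 1) * nq m n)
     * (phi (m + 1) n * phi m (n + 1)) < 0.
    by rewrite pmulr_rlt0 ?sg12 // mulr_gt0 // mulr_gt0.
  have : 0 <= (nq (m + 1) n * np m n * phi (m + 1) n) ^+ 2 by exact: sqr_ge0.
  rewrite expr2 {2}EE (_ : _ * _ = nq (m + 1) n * np m n * (np m (n + 1) * nq m n)
     * (phi (m + 1) n * phi m (n + 1))); last by ring.
  by rewrite leNgt h.
have flat m n (x : C) : t2 (m + 1) n * conjc (t1 m n * conjc x)
    = t1 m (n + 1) * conjc (t2 m n * conjc x).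
  rewrite (conjcM (t1 m n)) (conjcM (t2 m n)) conjcK !mulrA; congr (_ * x).
  rewrite /t1 /t2 !conjcE conj_iC.
  have E := lax_cross L0 m n; have f1 : (phi (m + 1) n)%:C%C != 0 :> C.
    by rewrite real_eq0; have [] := gen (m + 1) n.
  have f2 : (phi m (n + 1))%:C%C != 0 :> C.
    by rewrite real_eq0; have [] := gen m (n + 1).
  have d1 : q0 (m + 1) n * conjc (p0 m n) != 0 by rewrite mulf_neq0.
  have d2 : p0 m (n + 1) * conjc (q0 m n) != 0 by rewrite mulf_neq0.
  transitivity (iC * (nq (m + 1) n * np m n * phi (m + 1) n)%:C%C
    / (q0 (m + 1) n * conjc (p0 m n) * (phi (m + 1) n)%:C%C)).
    by rewrite !rcM; field; rewrite f1 q00 pc0.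
  rewrite E cross rcN !rcM; field.
  by rewrite f2 p00 qc0.
have [g [g0 g1 g2]] := @flat_section _ (1 : C)
  (fun m n x => t1 m n * conjc x) (fun m n x => t1 m n * conjc x)
  (fun m n x => t2 m n * conjc x) (fun m n x => t2 m n * conjc x)
  (fun m n x => K _ x (t1u m n)) (fun m n x => K _ x (t1u m n))
  (fun m n x => K _ x (t2u m n)) (fun m n x => K _ x (t2u m n)) flat.
have gu : forall m n, g m n * conjc (g m n) = 1.
  apply: int2_ind => [|m n|m n]; first by rewrite g0 conjc1 mulr1.
    by rewrite g1 (conjcM (t1 m n)) conjcK mulrACA t1u mul1r mulrC.
  by rewrite g2 (conjcM (t2 m n)) conjcK mulrACA t2u mul1r mulrC.
have Sg m n : SU2 (qm (g m n) 0) by apply: SU2_qm; rewrite /unit_norm gu mul0r addr0.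
pose A m n := qm (g m n) 0 *m A0 m n; pose B m n := qm (g m n) 0 *m B0 m n.
have SA m n : SU2 (A m n) by exact: SU2M.
have SB m n : SU2 (B m n) by exact: SU2M.
have conjg m n (d : C) : qad (A m n) *m qm d 0 *m B m n
    = qad (A0 m n) *m qm d 0 *m B0 m n.
  rewrite /A /B qadM -!mulmxA; congr (_ *m _); rewrite !mulmxA; congr (_ *m _).
  rewrite qad_qm !qmM; apply: eq_qm; rewrite ?conjcE; last by ring.
  by transitivity (g m n * conjc (g m n) * d); [ring|rewrite gu mul1r].
have AB1 m n : sphere_frame z k (A m n) (B m n) (F m n) (N m n).
  by have [h1 h2] := AB0 m n; split; rewrite conjg.
(* The gauged frames represent the same net, so their system is obtained afresh and its off-diagonal
   entries are then identified, rather than transforming every equation. *)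
have [a [p [b [q [L f1 f2]]]]] := lax_system_exists z1 z2 k0 SA SB AB1 FN gen F0.
have entry m n m' n' (u v u0 v0 : C) c :
    A0 m' n' = lax_edge z u0 v0 c *m A0 m n -> A m' n' = lax_edge z u v c *m A m n ->
    v = g m n * g m' n' * v0.
  move=> E0; rewrite /A E0 => /(congr1 (mulmx^~ (qad (A0 m n)))).
  rewrite -!mulmxA (SU2_qadr (SA0 m n)) !mulmx1 /lax_edge !qmM => /qm_inj[_].
  rewrite !mul0r !mulr0 add0r addr0 => E.
  have w0 := weight_neq0 z1 z2 k0 c; apply: (mulIf w0).
  transitivity (g m n * (v * weight z c * conjc (g m n))); last by rewrite -E; ring.
  by transitivity (v * weight z c * (g m n * conjc (g m n))); [rewrite gu mulr1|ring].
have pE m n : p m n = (np m n)%:C%C.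
  have [h _ _] := f1 m n; have [h0 _ _] := e1 m n; rewrite (entry _ _ _ _ _ _ _ _ _ h0 h).
  transitivity (g m n * conjc (g m n) * (t1 m n * p0 m n)); first by rewrite g1; ring.
  by rewrite gu mul1r divfK.
have qE m n : q m n = iC * (nq m n)%:C%C.
  have [h _ _] := f2 m n; have [h0 _ _] := e2 m n; rewrite (entry _ _ _ _ _ _ _ _ _ h0 h).
  transitivity (g m n * conjc (g m n) * (t2 m n * q0 m n)); first by rewrite g2; ring.
  by rewrite gu mul1r divfK.
have pf : p = fun m n => (np m n)%:C%C by apply/funext => m; apply/funext => n.
have qf : q = fun m n => iC * (nq m n)%:C%C by apply/funext => m; apply/funext => n.
rewrite pf qf in L f1 f2.
by exists A, B, a, b, np, nq; split.
Qed.

End GaugeFixing.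

(** * Lax matrices and a frame for a given minimal net *)

Section MinimalFrame.
Variable R : realType.
Local Notation C := (R[i]).
Local Notation iC := (iC R).

(** As c^2 + 1 - 2cx = (c - x)^2 + (1 - x^2), a zero needs a = 0 and c = x with x = 1 or x = -1. *)
Lemma edge_norm_gt0_closed (a p : C) (c x : R) : p != 0 -> -1 <= x <= 1 ->
  (a = 0 -> c ^+ 2 != 1) -> 0 < edge_norm a p c x.
Proof.
move=> p0 /andP[x1 x2] ac; have sp := sqn_gt0 p0.
have x3 : 0 <= 1 - x ^+ 2 by rewrite (_ : _ - _ = (1 - x) * (1 + x)); [rewrite mulr_ge0; lra|ring].
have cE : c ^+ 2 + 1 - 2 * c * x = (c - x) ^+ 2 + (1 - x ^+ 2) by ring.
have c0 : 0 <= c ^+ 2 + 1 - 2 * c * x by rewrite cE addr_ge0 ?sqr_ge0.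
have [a0|a0] := eqVneq a 0; last first.
  by rewrite /edge_norm ltr_pwDl ?sqn_gt0 // mulr_ge0 // ltW.
rewrite /edge_norm ltr_wpDl ?sqn_ge0 // mulr_gt0 // lt_neqAle c0 andbT eq_sym.
have := ac a0; apply: contraNneq; rewrite cE => /eqP.
rewrite paddr_eq0 ?sqr_ge0 // sqrf_eq0 !subr_eq0 => /andP[/eqP -> /eqP <-].
by rewrite eqxx.
Qed.

Lemma edge_normZ (t : R) (a p : C) (c x : R) :
  edge_norm (t%:C%C * a) (t%:C%C * p) c x = t ^+ 2 * edge_norm a p c x.
Proof.
have sZ (u : C) : sqn (t%:C%C * u) = t ^+ 2 * sqn u.
  suff : ((sqn (t%:C%C * u))%:C%C : C) = (t ^+ 2 * sqn u)%:C%C.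
    by move/(congr1 (@complex.Re R)).
  by rewrite rcM !sqnE !conjcE rcX; ring.
by rewrite /edge_norm !sZ; ring.
Qed.

Lemma unit_square_Re (z : C) : z * conjc z = 1 ->
  -1 <= complex.Re (z * z) <= 1 /\
  z * z = (complex.Re (z * z))%:C%C + iC * (complex.Im (z * z))%:C%C.
Proof.
case: z => x y /(congr1 (@complex.Re R)) /= E; split; last first.
  by apply/eqP; rewrite eq_complex /=; apply/andP; split; apply/eqP; ring.
have hx : 0 <= x * x by rewrite -expr2 sqr_ge0.
have hy : 0 <= y * y by rewrite -expr2 sqr_ge0.
by apply/andP; split; lra.
Qed.

Lemma smooth_scaled_edge (a p : C) (c : R) :
  (forall x, -1 <= x <= 1 -> 0 < edge_norm a p c x) ->
  smooth_quat (fun g => ((Num.sqrt (edge_norm a p c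
    (complex.Re (expi g * expi g))))^-1)%:C%C *: lax_edge (expi g) a p c).
Proof.
move=> pos; pose D g := edge_norm a p c (cos g ^+ 2 - sin g ^+ 2).
have D0 g : 0 < D g.
  have [h _] := unit_square_Re (expi_norm g); have := pos _ h.
  by rewrite /= -!expr2.
have DE g : edge_norm a p c (complex.Re (expi g * expi g)) = D g.
  by rewrite /= -!expr2.
have hr (t : R) : exists d, is_derive t 1 (fun g : R => (Num.sqrt (D g))^-1) (d : R).
  have h := is_derive1_comp (is_derive1_sqrt (D0 t)) (derivable_norm a p c t).
  have n0 : Num.sqrt (D t) != 0 by rewrite gt_eqF // sqrtr_gt0.
  by eexists; exact: (is_deriveV (f := Num.sqrt \o D) n0 h).
exists (fun g => ((Num.sqrt (D g))^-1)%:C%C * a).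
exists (fun g => ((Num.sqrt (D g))^-1)%:C%C * (p * weight (expi g) c)).
split=> [g|t|t].
- by rewrite DE /lax_edge qmZ.
- by have [d hd] := hr t; eexists; exact: (cderM (cder_real hd) (cder_cst a t)).
- have [d hd] := hr t; eexists.
  exact: (cderM (cder_real hd) (cderZ p (cder_weight c t))).
Qed.

Lemma qad_sigma3 : qad (sigma3 R) = sigma3 R.
Proof.
have qadE (a b c d : C) : qad (mx2 a b c d) = mx2 (conjc a) (conjc c) (conjc b) (conjc d).
  by rewrite [LHS]mx2_eta; apply: eq_mx2; rewrite !mxE.
by rewrite /sigma3 qadE; apply: eq_mx2; rewrite ?conjcE.
Qed.

Lemma sigma3_qad (X : 'M[C]_2) :
  sigma3 R *m qad X *m sigma3 R = qad (sigma3 R *m X *m sigma3 R).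
Proof. by rewrite !qadM qad_sigma3 mulmxA. Qed.

Section Swap.
Variables (z : C) (A B U U' : 'M[C]_2) (F N F' N' : point R).
Hypotheses (z1 : z * conjc z = 1) (z2 : z * z = iC).
Hypotheses (SU : SU2 U).
Hypotheses (FN : sphere_frame z 1 A B F N)
  (FN' : sphere_frame z 1 (U *m A) (U' *m B) F' N').

(** A degenerate edge matrix is off-diagonal and thus exchanges z and z^* in M, and z^* = -i z^3
    turns F into a multiple of N. With c = -1 one gets e = 1, with c = 1 one gets e = -1. *)
Lemma swap_edge (p : C) (e : R) : U = qm 0 p -> U' = e%:C%C *: qm 0 p ->
  F' = e *: N.
Proof.
move=> UE UE'; apply: quat_inj; rewrite quatZ.
have [_ ->] := FN; have [-> _] := FN'.
rewrite qadM -!mulmxA scalemxAr; congr (_ *m _); rewrite !mulmxA scalemxAl.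
congr (_ *m _); rewrite -[RHS]mul1mx -(SU2_qadl SU) -mulmxA -[RHS]mulmxA.
congr (_ *m _); rewrite UE' UE invr1 qmZ !qmM qmZ.
rewrite qmM; apply: eq_qm; rewrite ?conjcE ?conj_iC; first by ring.
transitivity (e%:C%C * p * (conjc z * (z * conjc z))); first by rewrite z1; ring.
have -> : conjc z * (z * conjc z) = - iC * z.
  transitivity (z * (conjc z * conjc z)); first by ring.
  by rewrite -conjcM z2 conj_iC; ring.
by ring.
Qed.

End Swap.

Lemma minimal_frame (F N : net R) (s : int -> int -> R) :
  qnet_S3 F N -> noncollinear_faces F -> minimal F N -> conformal_metric 0 F N s ->
  (forall m n : int, s m n * s (m + 1) n < 0 /\ 0 < s m n * s m (n + 1)) ->
  (forall m n : int, F (m + 1) n <> N m n /\ F m (n + 1) <> - N m n) ->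
  exists L Phi, [/\ is_lax L, is_frame L Phi, S3_immersion Phi F N & lax_metric L s].
Proof.
move=> [[pl _ F0] nrm] ncol cmc cm sg swap; have [s0 _] := cm.
pose phi m n := (s m n)^-1.
have d0 : dual_factor (0 : R) = 1 by rewrite /dual_factor eqxx.
have FN : edge_eq 0 phi F N.
  apply/(conformal_metric_edge_eq (s := s)) => //; rewrite d0.
  exact: metric_product_inv.
have gen : generic phi by exact: generic_signs.
have sgn m n : phi m n * phi (m + 1) n < 0 /\ 0 < phi m n * phi m (n + 1).
  by rewrite /phi -!invfM invr_lt0 invr_gt0.
pose z : C := expi (pi / 4); pose z' : C := expi (- (pi / 4)).
have z1 : z * conjc z = 1 by exact: expi_norm.
have z2 : z * z = 0%:C%C + iC * 1%:C%C by exact: expi_pi4.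
have zz : z * z = iC by rewrite z2 mulr1 add0r.
have zE : z' = conjc z by rewrite /z' expiN.
have W c : weight (conjc z) c = conjc (weight z c) by rewrite conj_weight /weight conjcK.
have nrm' m n : [/\ dot (F m n) (F m n) = (1 ^+ 2)^-1, dot (N m n) (N m n) = 1
  & dot (F m n) (N m n) = 0] by rewrite expr1n; exact: nrm.
have [A [B [a [b [P [Q [pos AB L e1 e2]]]]]]] :=
  gauge_fixed_lax z1 z2 (oner_neq0 R) nrm' FN gen F0 sgn.
pose u m n := Num.sqrt (- (s m n * s (m + 1) n)).
pose v m n := Num.sqrt (s m n * s m (n + 1)).
have u0 m n : 0 < u m n by rewrite sqrtr_gt0 oppr_gt0; have [] := sg m n.
have v0 m n : 0 < v m n by rewrite sqrtr_gt0; have [] := sg m n.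
have u2 m n : u m n ^+ 2 = - (s m n * s (m + 1) n).
  by rewrite sqr_sqrtr // ltW // oppr_gt0; have [] := sg m n.
have v2 m n : v m n ^+ 2 = s m n * s m (n + 1).
  by rewrite sqr_sqrtr // ltW //; have [] := sg m n.
have c1E m n : - (u m n ^+ 2)^-1 = phi m n * phi (m + 1) n.
  by rewrite u2 invrN opprK invfM.
have c2E m n : (v m n ^+ 2)^-1 = phi m n * phi m (n + 1) by rewrite v2 invfM.
(* Multiplying an edge matrix by this factor makes its off-diagonal coefficient exactly u or iv. By
   the labels the factor agrees on opposite edges, and therefore so do alpha and beta. *)
pose t1 m n := u m n / P m n; pose t2 m n := v m n / Q m n.
have P0 m n : 0 < P m n by have [] := pos m n.
have Q0 m n : 0 < Q m n by have [] := pos m n.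
have t10 m n : 0 < t1 m n by rewrite divr_gt0.
have t20 m n : 0 < t2 m n by rewrite divr_gt0.
have sqnP (x : R) : sqn (x%:C%C : C) = x ^+ 2 by rewrite /sqn /=; ring.
have sqnQ (x : R) : sqn (iC * x%:C%C) = x ^+ 2 by rewrite /sqn /=; ring.
have t1_shift m n : t1 m (n + 1) = t1 m n.
  apply/eqP; rewrite -(@eqrXn2 _ 2) ?ltW // /t1 !exprMn !exprVn; apply/eqP.
  have := lax_label_p L m n; rewrite !sqnP -c1E -(c1E m (n + 1)) => E.
  apply: invr_inj; rewrite !invf_div; move: E.
  by rewrite !mulNr ![_^-1 * _]mulrC => /oppr_inj ->.
have t2_shift m n : t2 (m + 1) n = t2 m n.
  apply/eqP; rewrite -(@eqrXn2 _ 2) ?ltW // /t2 !exprMn !exprVn; apply/eqP.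
  have := lax_label_q L m n; rewrite !sqnQ -c2E -(c2E (m + 1) n) => E.
  by apply: invr_inj; rewrite !invf_div; move: E; rewrite ![_^-1 * _]mulrC => ->.
pose la m n := (t1 m n)%:C%C * a m n; pose lb m n := (t2 m n)%:C%C * b m n.
have uE m n : (u m n)%:C%C = (t1 m n)%:C%C * (P m n)%:C%C :> C.
  by rewrite -rcM divfK // gt_eqF.
have vE m n : iC * (v m n)%:C%C = (t2 m n)%:C%C * (iC * (Q m n)%:C%C) :> C.
  by rewrite mulrCA -rcM divfK // gt_eqF.
pose nU m n x := edge_norm (la m n) (u m n)%:C%C (phi m n * phi (m + 1) n) x.
pose nV m n x := edge_norm (lb m n) (iC * (v m n)%:C%C) (phi m n * phi m (n + 1)) x.
have nUE m n x : nU m n x = t1 m n ^+ 2 *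
    edge_norm (a m n) (P m n)%:C%C (phi m n * phi (m + 1) n) x.
  by rewrite /nU uE edge_normZ.
have nVE m n x : nV m n x = t2 m n ^+ 2 *
    edge_norm (b m n) (iC * (Q m n)%:C%C) (phi m n * phi m (n + 1)) x.
  by rewrite /nV vE edge_normZ.
have SUe m n : SU2 (lax_edge z (a m n) (P m n)%:C%C (phi m n * phi (m + 1) n)).
  have [EA _ _] := e1 m n; have [SA _ _ _] := pos m n; have [SA' _ _ _] := pos (m + 1) n.
  by rewrite -[lax_edge _ _ _ _]mulmx1 -(SU2_qadr SA) mulmxA -EA; apply: SU2M => //; exact: SU2_qad.
have SVe m n : SU2 (lax_edge z (b m n) (iC * (Q m n)%:C%C) (phi m n * phi m (n + 1))).
  have [EA _ _] := e2 m n; have [SA _ _ _] := pos m n; have [SA' _ _ _] := pos m (n + 1).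
  by rewrite -[lax_edge _ _ _ _]mulmx1 -(SU2_qadr SA) mulmxA -EA; apply: SU2M => //; exact: SU2_qad.
have nU0 m n x : -1 <= x <= 1 -> 0 < nU m n x.
  move=> x1; rewrite nUE mulr_gt0 ?exprn_gt0 //; apply: edge_norm_gt0_closed => //.
    by rewrite real_eq0 gt_eqF.
  move=> a0; apply/eqP => c1; have [h1 _] := sgn m n; have [hs _] := swap m n.
  have cE : phi m n * phi (m + 1) n = -1.
    move/eqP: c1; rewrite sqrf_eq1 => /orP[/eqP E|/eqP //].
    by move: h1; rewrite E ltr10.
  have [EA EB _] := e1 m n; have AB' := AB (m + 1) n; rewrite EA EB in AB'.
  apply: hs; rewrite -[N m n]scale1r.
  apply: (swap_edge z1 zz (SUe m n) (AB m n) AB' (e := 1)); rewrite /lax_edge a0 //.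
  rewrite scale1r W cE; congr (qm 0 (_ * _)); rewrite /weight rcN rc1 !conjcE; ring.
have nV0 m n x : -1 <= x <= 1 -> 0 < nV m n x.
  move=> x1; rewrite nVE mulr_gt0 ?exprn_gt0 //; apply: edge_norm_gt0_closed => //.
    by rewrite mulf_neq0 ?iC_neq0 // real_eq0 gt_eqF.
  move=> a0; apply/eqP => c1; have [_ h1] := sgn m n; have [_ hs] := swap m n.
  have cE : phi m n * phi m (n + 1) = 1.
    move/eqP: c1; rewrite sqrf_eq1 => /orP[/eqP //|/eqP E].
    by move: h1; rewrite E ltr0N1.
  have [EA EB _] := e2 m n; have AB' := AB m (n + 1); rewrite EA EB in AB'.
  apply: hs; rewrite -scaleN1r.
  apply: (swap_edge z1 zz (SVe m n) (AB m n) AB' (e := -1)); rewrite /lax_edge a0 //.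
  rewrite qmZ rcN rc1 W cE; apply: eq_qm; first by rewrite mulr0.
  by rewrite /weight rc1 !conjcE; ring.
pose Ld : lax_data R := LaxData la lb u v
  (fun m n y => Num.sqrt (nU m n (complex.Re (y * y))))
  (fun m n y => Num.sqrt (nV m n (complex.Re (y * y)))).
pose rU m n (y : C) := (Num.sqrt (nU m n (complex.Re (y * y))))^-1.
pose rV m n (y : C) := (Num.sqrt (nV m n (complex.Re (y * y))))^-1.
have UE m n y : y * conjc y = 1 -> laxU Ld m n y = (rU m n y)%:C%C *:
    lax_edge y (la m n) (u m n)%:C%C (phi m n * phi (m + 1) n).
  move=> y1; rewrite (@laxUE _ Ld m n y _ y1) /= ?c1E //.
  by rewrite gt_eqF.
have VE m n y : y * conjc y = 1 -> laxV Ld m n y = (rV m n y)%:C%C *: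
    lax_edge y (lb m n) (iC * (v m n)%:C%C) (phi m n * phi m (n + 1)).
  move=> y1; rewrite (@laxVE _ Ld m n y _ y1) /= ?c2E //.
  by rewrite gt_eqF.
have SU m n y : y * conjc y = 1 -> SU2 (laxU Ld m n y).
  move=> y1; have [yx y2] := unit_square_Re y1; rewrite UE //.
  exact: (edge_scale_SU2 y1 y2 (nU0 m n _ yx)).
have SV m n y : y * conjc y = 1 -> SU2 (laxV Ld m n y).
  move=> y1; have [yx y2] := unit_square_Re y1; rewrite VE //.
  exact: (edge_scale_SU2 y1 y2 (nV0 m n _ yx)).
have nU_shift m n x : nU m (n + 1) x = nU m n x.
  by rewrite !nUE t1_shift; have [-> _] := lax_norm L x m n.
have nV_shift m n x : nV (m + 1) n x = nV m n x.
  by rewrite !nVE t2_shift; have [_ ->] := lax_norm L x m n.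
have flat m n y : y * conjc y = 1 ->
    laxV Ld (m + 1) n y *m laxU Ld m n y = laxU Ld m (n + 1) y *m laxV Ld m n y.
  move=> y1; rewrite (UE m n y y1) (UE m (n + 1) y y1) (VE m n y y1) (VE (m + 1) n y y1).
  rewrite /rU /rV nU_shift nV_shift.
  rewrite /la /lb !uE !vE t1_shift t2_shift -!lax_edgeZ.
  rewrite -!scalemxAl -!scalemxAr (lax_flat L m n y1) !scalerA; congr (_ *: _).
  by ring.
have twist m n y : y * conjc y = 1 ->
    laxU Ld m n (- y) = sigma3 R *m laxU Ld m n y *m sigma3 R /\
    laxV Ld m n (- y) = sigma3 R *m laxV Ld m n y *m sigma3 R.
  move=> y1; have y1' : - y * conjc (- y) = 1 by rewrite conjcN mulrNN.
  have Wn c : weight (- y) c = - weight y c by rewrite /weight conjcN; ring.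
  rewrite (UE m n _ y1) (UE m n _ y1') (VE m n _ y1) (VE m n _ y1').
  by rewrite /rU /rV mulrNN !lax_edgeZ /lax_edge !sigma3_qm !Wn !mulrN.
have smU m n : smooth_quat (fun g => laxU Ld m n (expi g)).
  apply: (smooth_quat_eq (smooth_scaled_edge (nU0 m n))) => g.
  by rewrite (UE m n _ (expi_norm g)).
have smV m n : smooth_quat (fun g => laxV Ld m n (expi g)).
  apply: (smooth_quat_eq (smooth_scaled_edge (nV0 m n))) => g.
  by rewrite (VE m n _ (expi_norm g)).
have [SA00 SB00 _ _] := pos 0 0.
have [f0 [[Sf0 tf0 df0] f0z f0z']] := interpolating_loop SA00 SB00.
(* Off the unit circle the Lax matrices need not be invertible; acting there by the identity makes
   each step a bijection on all functions of the spectral parameter. *)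
pose op (M : C -> 'M[C]_2) (f : C -> 'M[C]_2) (y : C) :=
  if y * conjc y == 1 then M y *m f y else f y.
have opK (M : C -> 'M[C]_2) f : (forall y, y * conjc y = 1 -> SU2 (M y)) ->
    op (fun y => qad (M y)) (op M f) = f.
  move=> S; apply/funext => y; rewrite /op; case: eqP => [y1|//].
  by rewrite mulmxA (SU2_qadl (S y y1)) mul1mx.
have opK' (M : C -> 'M[C]_2) f : (forall y, y * conjc y = 1 -> SU2 (M y)) ->
    op M (op (fun y => qad (M y)) f) = f.
  move=> S; apply/funext => y; rewrite /op; case: eqP => [y1|//].
  by rewrite mulmxA (SU2_qadr (S y y1)) mul1mx.
have opflat m n f : op (laxV Ld (m + 1) n) (op (laxU Ld m n) f)
    = op (laxU Ld m (n + 1)) (op (laxV Ld m n) f).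
  apply/funext => y; rewrite /op; case: eqP => [y1|//].
  by rewrite !mulmxA (flat m n y y1).
have [Phi [Phi0 Phi1 Phi2]] := @flat_section _ f0
  (fun m n => op (laxU Ld m n)) (fun m n => op (fun y => qad (laxU Ld m n y)))
  (fun m n => op (laxV Ld m n)) (fun m n => op (fun y => qad (laxV Ld m n y)))
  (fun m n f => opK _ f (SU m n)) (fun m n f => opK' _ f (SU m n))
  (fun m n f => opK _ f (SV m n)) (fun m n f => opK' _ f (SV m n)) opflat.
have step1 m n y : y * conjc y = 1 -> Phi (m + 1) n y = laxU Ld m n y *m Phi m n y.
  by move=> y1; rewrite Phi1 /op y1 eqxx.
have step2 m n y : y * conjc y = 1 -> Phi m (n + 1) y = laxV Ld m n y *m Phi m n y.
  by move=> y1; rewrite Phi2 /op y1 eqxx.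
have back1 m n y : y * conjc y = 1 ->
    Phi m n y = qad (laxU Ld m n y) *m Phi (m + 1) n y.
  by move=> y1; rewrite step1 // mulmxA (SU2_qadl (SU m n y y1)) mul1mx.
have back2 m n y : y * conjc y = 1 ->
    Phi m n y = qad (laxV Ld m n y) *m Phi m (n + 1) y.
  by move=> y1; rewrite step2 // mulmxA (SU2_qadl (SV m n y y1)) mul1mx.
have SPhi : forall m n y, y * conjc y = 1 -> SU2 (Phi m n y).
  apply: int2_ind => [|m n|m n]; first by rewrite Phi0.
  - split=> S y y1; first by rewrite step1 //; apply: SU2M; [exact: SU|exact: S].
    by rewrite back1 //; apply: SU2M; [exact/SU2_qad/SU|exact: S].
  - split=> S y y1; first by rewrite step2 //; apply: SU2M; [exact: SV|exact: S].
    by rewrite back2 //; apply: SU2M; [exact/SU2_qad/SV|exact: S].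
have tPhi : forall m n y, y * conjc y = 1 ->
    Phi m n (- y) = sigma3 R *m Phi m n y *m sigma3 R.
  have yN (y : C) : y * conjc y = 1 -> (- y) * conjc (- y) = 1 by rewrite conjcN mulrNN.
  apply: int2_ind => [|m n|m n]; first by rewrite Phi0.
  - split=> S y y1; have [tU _] := twist m n y y1; have y1' := yN y y1.
      by rewrite (step1 m n y y1) (step1 m n _ y1') tU S // sigma3M.
    by rewrite (back1 m n y y1) (back1 m n _ y1') tU S // -sigma3_qad sigma3M.
  - split=> S y y1; have [_ tV] := twist m n y y1; have y1' := yN y y1.
      by rewrite (step2 m n y y1) (step2 m n _ y1') tV S // sigma3M.
    by rewrite (back2 m n y y1) (back2 m n _ y1') tV S // -sigma3_qad sigma3M.
have sPhi : forall m n, smooth_quat (fun g => Phi m n (expi g)).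
  apply: int2_ind => [|m n|m n]; first by rewrite Phi0.
  - split=> S.
      apply: (smooth_quat_eq (smooth_quatM (smU m n) S)) => g.
      by rewrite step1 // expi_norm.
    apply: (smooth_quat_eq (smooth_quatM (smooth_quat_qad (smU m n)) S)) => g.
    by rewrite -back1 // expi_norm.
  - split=> S.
      apply: (smooth_quat_eq (smooth_quatM (smV m n) S)) => g.
      by rewrite step2 // expi_norm.
    apply: (smooth_quat_eq (smooth_quatM (smooth_quat_qad (smV m n)) S)) => g.
    by rewrite -back2 // expi_norm.
have isL : is_lax Ld.
  split=> [m n|m n y /unit_normc y1]; first by split; [exact: u0|exact: v0].
  split; [by case: (SU m n y y1)|by case: (SV m n y y1)| | |exact: flat].
  - by rewrite /= nU_shift.
  - by rewrite /= nV_shift.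
have isF : is_frame Ld Phi.
  split=> [m n y /unit_normc y1|m n t]; last exact: smooth_quat_derivable.
  by split; [exact: SPhi|exact: tPhi|exact: step1|exact: step2].
have z1' : z' * conjc z' = 1 by rewrite zE conjcK mulrC.
have re0 : complex.Re (z * z) = 0 by rewrite zz.
have re0' : complex.Re (z' * z') = 0.
  by rewrite zE -conjcM zz conj_iC /= oppr0.
(* At both parameters x = 0 is the mean curvature of the net, where the unscaled determinant is 1.
   The normalisation then just removes [t1], and [Phi] has the same transition matrices as A and
   B. *)
have Uz m n y : y * conjc y = 1 -> complex.Re (y * y) = 0 -> laxU Ld m n y
    = lax_edge y (a m n) (P m n)%:C%C (phi m n * phi (m + 1) n).
  move=> y1 ry; have [_ _ e] := e1 m n.
  rewrite (UE m n y y1) /rU ry nUE e mulr1 sqrtr_sqr gtr0_norm // uE -lax_edgeZ.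
  by rewrite scalerA -rcM mulVf ?scale1r // gt_eqF.
have Vz m n y : y * conjc y = 1 -> complex.Re (y * y) = 0 -> laxV Ld m n y
    = lax_edge y (b m n) (iC * (Q m n)%:C%C) (phi m n * phi m (n + 1)).
  move=> y1 ry; have [_ _ e] := e2 m n.
  rewrite (VE m n y y1) /rV ry nVE e mulr1 sqrtr_sqr gtr0_norm // vE -lax_edgeZ.
  by rewrite scalerA -rcM mulVf ?scale1r // gt_eqF.
have cancel (M X Y : 'M[C]_2) : SU2 M -> M *m X = M *m Y -> X = Y.
  move=> S /(congr1 (mulmx (qad M))).
  by rewrite !mulmxA (SU2_qadl S) !mul1mx.
have PhiA : forall m n, Phi m n z = A m n.
  apply: int2_ind => [|m n|m n]; first by rewrite Phi0.
  - have [-> _ _] := e1 m n; rewrite (step1 m n z z1) -(Uz m n z z1 re0).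
    by split=> [->//|]; exact/cancel/SU.
  - have [-> _ _] := e2 m n; rewrite (step2 m n z z1) -(Vz m n z z1 re0).
    by split=> [->//|]; exact/cancel/SV.
have PhiB : forall m n, Phi m n z' = B m n.
  apply: int2_ind => [|m n|m n]; first by rewrite Phi0.
  - have [_ -> _] := e1 m n; rewrite -zE (step1 m n z' z1') -(Uz m n z' z1' re0').
    by split=> [->//|]; exact/cancel/SU.
  - have [_ -> _] := e2 m n; rewrite -zE (step2 m n z' z1') -(Vz m n z' z1' re0').
    by split=> [->//|]; exact/cancel/SV.
exists Ld, Phi; split=> //; last by move=> m n; rewrite /= u2 v2 opprK.
apply/(S3_immersionE isF) => m n.
by rewrite -/z -/z' PhiA PhiB; exact: AB.
Qed.

End MinimalFrame.

Theorem theorem7 (R : realType) :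
  (* minimal in S^3 -> constant mean curvature 1 in R^3 *)
  (forall (F N : net R) (s : int -> int -> R),
     qnet_S3 F N -> noncollinear_faces F -> minimal F N ->
     conformal_metric 0 F N s ->
     exists F' N' : net R,
       [/\ qnet_R3 F' N', constant_mean_curvature 1 F' N'
         & conformal_metric 1 F' N' s]) /\
  (* general curvatures *)
  (forall (H kappa H' kappa' : R) (F N : net R) (s : int -> int -> R),
     0 < kappa -> 0 <= kappa' -> H ^+ 2 + kappa = H' ^+ 2 + kappa' ->
     qnet_sphere kappa F N -> noncollinear_faces F ->
     constant_mean_curvature H F N -> conformal_metric H F N s ->
     exists (F' N' : net R) (s' : int -> int -> R),
       [/\ qnet_curvature kappa' F' N',
           0 < kappa' -> noncollinear_faces F',
           constant_mean_curvature H' F' N',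
           conformal_metric H' F' N' s'
         & black_white_equiv s s']) /\
  (* the nets are given by the immersion formulas with the same Lax matrices *)
  (forall (F N : net R) (s : int -> int -> R),
     qnet_S3 F N -> noncollinear_faces F -> minimal F N ->
     conformal_metric 0 F N s ->
     (forall m n : int, s m n * s (m + 1) n < 0 /\ 0 < s m n * s m (n + 1)) ->
     (forall m n : int, F (m + 1) n <> N m n /\ F m (n + 1) <> - N m n) ->
     exists L Phi (F' N' : net R),
       [/\ is_lax L /\ is_frame L Phi,
           S3_immersion Phi F N, R3_immersion Phi F' N',
           qnet_R3 F' N' /\ constant_mean_curvature 1 F' N'
         & conformal_metric 1 F' N' s]) /\
  (* conversely, every frame produces such a pair of nets *)
  (forall (L : lax_data R) (Phi : int -> int -> R[i] -> 'M[R[i]]_2),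
     is_lax L -> is_frame L Phi ->
     exists (F N F' N' : net R) (s : int -> int -> R),
       [/\ S3_immersion Phi F N /\ R3_immersion Phi F' N',
           [/\ qnet_S3 F N, noncollinear_faces F & minimal F N],
           qnet_R3 F' N' /\ constant_mean_curvature 1 F' N',
           conformal_metric 0 F N s
         & conformal_metric 1 F' N' s]).
Proof.
split; first exact: minimal_to_cmc1.
split; first exact: lawson.
split=> [F N s S3 ncol cmc cm sg sw|L Phi isL isF].
  have [L [Phi [isL isF im Ls]]] := minimal_frame S3 ncol cmc cm sg sw.
  have [F' [N' [im' [R3 cmc'] cm']]] := frame_euclid_net isL isF Ls.
  by exists L, Phi, F', N'; split.
have [s Ls] := lax_metric_exists isL.
have [F [N [im S3 cm]]] := frame_sphere_net isL isF Ls.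
have [F' [N' [im' R3 cm']]] := frame_euclid_net isL isF Ls.
by exists F, N, F', N', s.
Qed.
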